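(* Let $\beta\in(0,\frac12)$ be the absolute constant (weak Beurling exponent) fixed in the context. For every $\alpha\in\big(0,\frac{\beta}{1+3\beta}\big)$ there is a constant $C_\alpha>0$, depending only on $\alpha$, such that: if $G=(V^\bullet\sqcup V^\circ,E)$ is a finite orthodiagonal map with edges of length at most $\varepsilon$, $h:V^\bullet\to\mathbb{R}$ is harmonic, and $z,w\in V^\bullet$ satisfy $d>0$ and $|z-w|\ge d\big(\frac{\varepsilon}{d}\big)^\alpha$, where $d=\mathrm{dist}(z,\partial\widehat G)\wedge\mathrm{dist}(w,\partial\widehat G)$, then $$|h(z)-h(w)|\le C_\alpha\|h\|_\infty\Big(\frac{|z-w|}{d}\Big).$$
   Context: $a\wedge b=\min\{a,b\}$, $a\vee b=\max\{a,b\}$, $\|h\|_\infty=\max_{V^\bullet}|h|$. Orthodiagonal maps. A finite orthodiagonal map is a finite connected plane graph $G$ all of whose edges are straight line segments, each of whose inner (bounded) faces is a quadrilateral with orthogonal diagonals (non-convex quadrilaterals are allowed), and such that the boundary of the outer face is a simple closed curve. Such a $G$ is bipartite; write its vertex set as $V^\bullet\sqcup V^\circ$ (primal and dual vertices). Each inner face $Q$ has two primal and two dual vertices; let $|e_Q^\bullet|$, $|e_Q^\circ|$ be the distances between its two primal, resp. two dual, vertices. The primal network $G^\bullet$ has vertex set $V^\bullet$ and, for every inner face $Q$ of $G$, an edge joining the two primal vertices of $Q$ with conductance $c=|e_Q^\circ|/|e_Q^\bullet|$. The discrete Laplacian of $f:V^\bullet\to\mathbb{R}$ is $\Delta^\bullet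 f(x)=\sum_{y\sim x}c(x,y)(f(y)-f(x))$. $\partial V^\bullet$ is the set of primal vertices on the boundary of the outer face of $G$ and $\mathrm{Int}(V^\bullet)=V^\bullet\setminus\partial V^\bullet$. A function $V^\bullet\to\mathbb R$ is called harmonic if $\Delta^\bullet$ of it vanishes on $\mathrm{Int}(V^\bullet)$. $\widehat G$ is the open planar domain equal to the interior of the union of the inner faces, edges and vertices of $G$. Simple random walk on $G^\bullet$ is the Markov chain jumping from $x$ to $y\sim x$ with probability $c(x,y)/\sum_{y'\sim x}c(x,y')$. The constant $\beta$. There exist absolute constants $C,C',K>0$ and $\beta\in(0,\frac12)$ such that for every finite orthodiagonal map $G$ with edges of length at most $\varepsilon$: (i) (weak Beurling estimate) for every $u\in\mathrm{Int}(V^\bullet)$ and $r>0$, simple random walk $(S_n)$ on $G^\bullet$ started at $u$, with $\tau$ the hitting time of $\partial V^\bullet$, satisfies $\mathbb{P}^u(|S_\tau-u|\ge r)\le C\big(\frac{d_u\vee K\varepsilon}{r}\big)^\beta$ with $d_u=\mathrm{dist}(u,\partial V^\bullet)$; (ii) for every harmonic $h:V^\bullet\to\mathbb{R}$ and $x,y\in V^\bullet$ with $d'=\mathrm{dist}(x,\partial V^\bullet)\wedge\mathrm{dist}(y,\partial V^\bullet)>0$, $|h(y)-h(x)|\le C'\|h\|_\infty\big(\frac{|y-x|\vee K\varepsilon}{d'}\big)^\beta$. Such constants are fixed once and for all, and $\beta$ denotes this exponent. *)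

(* Defs.v *)
From HB Require Import structures.
From mathcomp Require Import all_boot all_order all_algebra.
From mathcomp Require Import all_classical all_reals all_analysis.
Set Implicit Arguments.
Unset Strict Implicit.
Unset Printing Implicit Defensive.
Import Order.TTheory GRing.Theory Num.Theory.
Import numFieldNormedType.Exports.
Local Open Scope classical_set_scope.
Local Open Scope ring_scope.

(* The plane is R * R. Its library norm is the sup norm, which is used below only
   through topology and boundedness; all distances are Euclidean ([eucl]). *)
Section Plane.
Variable R : realType.
Implicit Types (p q : R * R) (A : set (R * R)).

Definition eucl p q : R := Num.sqrt ((p.1 - q.1) ^+ 2 + (p.2 - q.2) ^+ 2).

Definition orthogonal_dir p q p' q' : Prop :=
  (q.1 - p.1) * (q'.1 - p'.1) + (q.2 - p.2) * (q'.2 - p'.2) = 0.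

Definition dist_to p A : R := inf [set eucl p q | q in A].

Definition seg p q : set (R * R) :=
  [set ((1 - t) * p.1 + t * q.1, (1 - t) * p.2 + t * q.2) | t in `[0, 1]].

Definition frontier A : set (R * R) := closure A `\` interior A.

Definition simple_closed_curve A : Prop :=
  exists g : R -> R * R,
    [/\ {within `[0, 1], continuous g}, g 0 = g 1,
        {in `[0, 1[ &, injective g} & g @` `[0, 1] = A].

Definition is_face_of_complement (K F : set (R * R)) : Prop :=
  exists2 p, ~ K p & F = connected_component (~` K) p.

End Plane.

(* A straight-line drawing of a finite bipartite graph; [primal] and [dual] are the
   two colour classes, so that all vertices are [primal + dual]. *)
Record bip_drawing (R : realType) := BipDrawing {
  primal : finType;
  dual : finType;
  ppos : primal -> R * R;
  dpos : dual -> R * R;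
  adj : primal -> dual -> bool
}.

Section Drawing.
Variables (R : realType) (D : bip_drawing R).

Definition vpos (v : primal D + dual D) : R * R :=
  match v with inl x => ppos x | inr u => dpos u end.

Definition vadj : rel (primal D + dual D) := fun v w =>
  match v, w with
  | inl x, inr u => adj x u
  | inr u, inl x => adj x u
  | _, _ => false
  end.

Definition edge_seg (x : primal D) (u : dual D) : set (R * R) :=
  seg (ppos x) (dpos u).

Definition drawing_set : set (R * R) :=
  [set p | (exists v, vpos v = p) \/ (exists x u, adj x u /\ edge_seg x u p)].

Definition plane_drawing : Prop :=
  [/\ injective vpos,
      forall x u v, adj x u -> edge_seg x u (vpos v) -> v = inl x \/ v = inr u
    & forall x u y w p, adj x u -> adj y w -> edge_seg x u p -> edge_seg y w p ->
        (x = y /\ u = w) \/ exists v, vpos v = p].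

Definition inner_face (F : set (R * R)) : Prop :=
  is_face_of_complement drawing_set F /\ bounded_set F.

(* The complement of the drawing has a single unbounded component. *)
Definition outer_face : set (R * R) :=
  [set p | exists F, [/\ is_face_of_complement drawing_set F, ~ bounded_set F & F p]].

End Drawing.

(* [quad] enumerates the inner faces without repetition. A face Q is bounded by the
   4-cycle (qp1 Q, qd1 Q, qp2 Q, qd2 Q), which a plane drawing makes a simple polygon,
   possibly non-convex. Connectedness is that of the graph. *)
Record orthodiagonal_map (R : realType) := OrthodiagonalMap {
  odraw :> bip_drawing R;
  quad : finType;
  region : quad -> set (R * R);
  qp1 : quad -> primal odraw;
  qp2 : quad -> primal odraw;
  qd1 : quad -> dual odraw;
  qd2 : quad -> dual odraw;
  od_plane : plane_drawing odraw;
  od_connected : forall v w, connect (@vadj R odraw) v w;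
  od_region_inj : injective region;
  od_region_faces : range region = [set F | inner_face odraw F];
  od_quad_distinct : forall Q, qp1 Q <> qp2 Q /\ qd1 Q <> qd2 Q;
  od_quad_adj : forall Q,
    [&& adj (qp1 Q) (qd1 Q), adj (qp2 Q) (qd1 Q),
        adj (qp2 Q) (qd2 Q) & adj (qp1 Q) (qd2 Q)];
  od_quad_frontier : forall Q, frontier (region Q) =
    edge_seg (qp1 Q) (qd1 Q) `|` edge_seg (qp2 Q) (qd1 Q) `|`
    edge_seg (qp2 Q) (qd2 Q) `|` edge_seg (qp1 Q) (qd2 Q);
  od_quad_orthogonal : forall Q,
    orthogonal_dir (ppos (qp1 Q)) (ppos (qp2 Q)) (dpos (qd1 Q)) (dpos (qd2 Q));
  od_outer_boundary : simple_closed_curve (frontier (outer_face odraw))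
}.

Section Network.
Variables (R : realType) (G : orthodiagonal_map R).
Implicit Types (x y : primal G) (f : primal G -> R).

Definition edges_at_most (eps : R) : Prop :=
  forall (x : primal G) (u : dual G), adj x u -> eucl (ppos x) (dpos u) <= eps.

Definition len_primal (Q : quad G) : R := eucl (ppos (qp1 Q)) (ppos (qp2 Q)).
Definition len_dual (Q : quad G) : R := eucl (dpos (qd1 Q)) (dpos (qd2 Q)).

(* Total conductance between x and y: distinct inner faces may have the same primal
   diagonal, and the corresponding parallel edges add up. *)
Definition cond x y : R :=
  \sum_(Q : quad G | [set qp1 Q; qp2 Q]%SET == [set x; y]%SET)
    len_dual Q / len_primal Q.

Definition laplacian f x : R := \sum_(y : primal G) cond x y * (f y - f x).

Definition bdry : set (primal G) :=
  [set x | frontier (outer_face G) (ppos x)].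

Definition discrete_harmonic f : Prop := forall x, ~ bdry x -> laplacian f x = 0.

Definition supnorm f : R := \big[Num.max/0]_(x : primal G) `|f x|.

Definition dist_bdry x : R := dist_to (ppos x) (@ppos R G @` bdry).

Definition hat_domain : set (R * R) :=
  interior (drawing_set G `|` \bigcup_(Q in [set: quad G]) region Q).

Definition dist_hat x : R := dist_to (ppos x) (frontier hat_domain).

Definition step_prob x y : R := cond x y / \sum_(y' : primal G) cond x y'.

(* The Markov chain is specified by its finite-dimensional distributions. *)
Definition is_srw (u : primal G) (d : measure_display) (T : measurableType d)
    (P : probability T R) (S : nat -> T -> primal G) : Prop :=
  (forall n x, measurable [set w | S n w = x]) /\
  (forall n (s : nat -> primal G),
     P [set w | forall k, (k <= n)%N -> S k w = s k] =
     ((s 0%N == u)%:R * \prod_(k < n) step_prob (s k) (s k.+1))%:E).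

(* The event |S_tau - u| >= r, where tau is the hitting time of the boundary. *)
Definition exit_far (u : primal G) (r : R) (T : Type) (S : nat -> T -> primal G)
    : set T :=
  [set w | exists n, [/\ bdry (S n w), forall m, (m < n)%N -> ~ bdry (S m w)
                       & r <= eucl (ppos (S n w)) (ppos u)]].

End Network.

Definition weak_beurling (R : realType) (C K beta : R) : Prop :=
  forall (G : orthodiagonal_map R) (eps : R), edges_at_most G eps ->
  forall (u : primal G) (r : R), ~ bdry u -> 0 < r ->
  forall (d : measure_display) (T : measurableType d) (P : probability T R)
    (S : nat -> T -> primal G), is_srw u P S ->
  (P (exit_far u r S) <=
     (C * (Num.max (dist_bdry u) (K * eps) / r) `^ beta)%:E)%E.

Definition hoelder_estimate (R : realType) (C' K beta : R) : Prop :=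
  forall (G : orthodiagonal_map R) (eps : R), edges_at_most G eps ->
  forall h : primal G -> R, discrete_harmonic h ->
  forall (x y : primal G), 0 < Num.min (dist_bdry x) (dist_bdry y) ->
  `|h y - h x| <= C' * supnorm h *
     (Num.max (eucl (ppos y) (ppos x)) (K * eps)
        / Num.min (dist_bdry x) (dist_bdry y)) `^ beta.

(* [beta] is a weak Beurling exponent, with accompanying absolute constants. *)
Definition beurling_constants (R : realType) (C C' K beta : R) : Prop :=
  [/\ 0 < C, 0 < C', 0 < K, 0 < beta < 2^-1 &
      weak_beurling C K beta /\ hoelder_estimate C' K beta].

(* Main.v *)
Require Import Defs.
From mathcomp Require Import all_boot all_order all_algebra.
From mathcomp Require Import all_classical all_reals all_analysis.
From mathcomp Require Import measurable_realfun ring lra.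
Import Order.TTheory GRing.Theory Num.Theory.
Import numFieldNormedType.Exports.
Local Open Scope ring_scope.
Set Implicit Arguments.
Unset Strict Implicit.
Unset Printing Implicit Defensive.

(* Average [h] against the kernel [u^2 (1 - u^2 |x - z|^2)_+^2], each face weighted by the
   product of its diagonals. The [u]-derivative of the kernel is, up to a factor, the
   Laplacian of the bump [(1 - |p|^2)_+^3]; summing by parts along both diagonals of every
   face, harmonicity of [h] and the closing of the dual edges around an inner vertex leave an
   error controlled by a Caccioppoli estimate. So the average changes by
   [O(|h| eps / delta)] between the scales [delta < d], while at scale [d] it is Lipschitz in
   its centre and at scale [delta] it is close to [h z] by the Hoelder estimate. The choice
   [delta = d (eps / d)^(1 - alpha)] balances the errors. Comparing weights with areas needs
   every face to be the open quadrilateral one expects, and a vertex at positive distance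
   from the boundary of the domain has to lie inside it; both come from elementary plane
   topology, the second through a half-angle parity function and the simple outer curve. *)

(** * Euclidean geometry of the plane and a radial bump function *)

(** Faces may be arbitrarily thin, so the discrete Laplacian of a smooth function at one vertex need
    not resemble the continuous one; only sums over faces do. In a face with diagonals [e], [f] and
    conductance [c = |f| / |e|], the quantities [c |e|^2] and [|f|^2 / c] both equal [|e| |f|], so
    second differences along the two diagonals add up to that weight times the Laplacian. Since [h]
    lives on primal vertices only, producing the difference along [f] costs terms of size [eps |f|]
    times the increment of [h] along [e]. Bounding that increment by [2 |h|] would lose a factor of
    order [1 / eps] or worse; pairing its energy with [|f|^2 / c] by Cauchy-Schwarz does not. In the
    final balance the errors are [eps / delta = (eps / d)^alpha] and [(delta / d)^beta = (eps /
    d)^((1 - alpha) beta)], up to constants; the assumption on [alpha] makes the second at most the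
    first, and the assumed lower bound on [|z - w|] absorbs both. *)

Ltac split_lra := apply/andP; split; lra.
Tactic Notation "coordwise" tactic(t) := congr pair => /=; rewrite /GRing.scale /=; t.

Section Vectors.
Variable R : realType.
Implicit Types p q e f w : R * R.

Definition dot p q : R := p.1 * q.1 + p.2 * q.2.
Definition cross p q : R := p.1 * q.2 - p.2 * q.1.
Definition nrm p : R := Num.sqrt (dot p p).

Lemma dot_ge0 p : 0 <= dot p p.
Proof. by rewrite /dot -!expr2 addr_ge0 ?sqr_ge0. Qed.

Lemma nrm_ge0 p : 0 <= nrm p. Proof. exact: sqrtr_ge0. Qed.

Lemma nrm_sqr p : nrm p ^+ 2 = dot p p.
Proof. by rewrite sqr_sqrtr ?dot_ge0. Qed.

Lemma ler_norm_sqr (a b : R) : 0 <= b -> a ^+ 2 <= b ^+ 2 -> `|a| <= b.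
Proof. by move=> b0; rewrite -[X in X <= _]real_normK ?num_real// ler_pXn2r ?nnegrE. Qed.

Lemma dot_cross_sqr p q : dot p q ^+ 2 + cross p q ^+ 2 = (nrm p * nrm q) ^+ 2.
Proof. by rewrite exprMn !nrm_sqr /dot /cross; ring. Qed.

Lemma ler_norm_dot p q : `|dot p q| <= nrm p * nrm q.
Proof.
apply: ler_norm_sqr; first by rewrite mulr_ge0 ?nrm_ge0.
by rewrite -dot_cross_sqr lerDl sqr_ge0.
Qed.

Lemma ler_norm_cross p q : `|cross p q| <= nrm p * nrm q.
Proof.
apply: ler_norm_sqr; first by rewrite mulr_ge0 ?nrm_ge0.
by rewrite -dot_cross_sqr lerDr sqr_ge0.
Qed.

Lemma ler_nrmD p q : nrm (p + q) <= nrm p + nrm q.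
Proof.
have h0 : 0 <= nrm p + nrm q by rewrite addr_ge0 ?nrm_ge0.
rewrite -(@ler_pXn2r _ 2) ?nnegrE ?nrm_ge0// sqrrD !nrm_sqr.
have : dot p q <= nrm p * nrm q := le_trans (ler_norm _) (ler_norm_dot p q).
rewrite /dot /= => h; lra.
Qed.

Lemma nrmN p : nrm (- p) = nrm p.
Proof. by rewrite /nrm /dot /= !mulrNN. Qed.

Lemma nrmB p q : nrm (p - q) = nrm (q - p).
Proof. by rewrite -opprB nrmN. Qed.

Lemma nrmZ (a : R) p : nrm (a *: p) = `|a| * nrm p.
Proof.
apply/eqP; rewrite -(@eqrXn2 _ 2) ?mulr_ge0 ?nrm_ge0//.
rewrite exprMn !nrm_sqr real_normK ?num_real//; apply/eqP.
by rewrite /dot /= /GRing.scale /=; ring.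
Qed.

Lemma eucl_nrm p q : eucl p q = nrm (p - q).
Proof. by rewrite /eucl /nrm /dot !expr2. Qed.

Lemma nrm_gt0 p : p != 0 -> 0 < nrm p.
Proof.
case: p => a b; rewrite xpair_eqE /= => h.
rewrite sqrtr_gt0 lt_neqAle dot_ge0 andbT eq_sym /dot /= -!expr2.
by rewrite paddr_eq0 ?sqr_ge0// !sqrf_eq0.
Qed.

Lemma ler_nrm_coord1 p : `|p.1| <= nrm p.
Proof. by apply: ler_norm_sqr; rewrite ?nrm_ge0// nrm_sqr /dot -!expr2 lerDl sqr_ge0. Qed.

Lemma ler_nrm_coord2 p : `|p.2| <= nrm p.
Proof. by apply: ler_norm_sqr; rewrite ?nrm_ge0// nrm_sqr /dot -!expr2 lerDr sqr_ge0. Qed.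

End Vectors.

Section OrthogonalFrame.
Variable R : realType.
Implicit Types p q e f w : R * R.

Lemma dot_orthogonal_frame p e f : dot e f = 0 ->
  dot p e ^+ 2 * dot f f + dot p f ^+ 2 * dot e e = dot p p * dot e e * dot f f.
Proof.
move=> ef.
have -> : dot p e ^+ 2 * dot f f + dot p f ^+ 2 * dot e e =
  dot p p * dot e e * dot f f + dot e f * (2 * dot p e * dot p f - dot p p * dot e f).
  by rewrite /dot; ring.
by rewrite ef mul0r addr0.
Qed.

Section Frame.
Variables e f : R * R.
Hypotheses (e0 : 0 < nrm e) (f0 : 0 < nrm f) (ef : dot e f = 0).

(** The sign compensates for the order in which the ends of each diagonal are listed, which a face
    does not prescribe. *)
Definition orient e f : R := Num.sg (cross e f).

Lemma norm_cross_orthogonal : `|cross e f| = nrm e * nrm f.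
Proof.
apply/eqP; rewrite -(@eqrXn2 _ 2) ?mulr_ge0 ?nrm_ge0//.
by rewrite real_normK ?num_real// -dot_cross_sqr ef expr0n /= add0r.
Qed.

Lemma orient_cross : orient e f * cross e f = nrm e * nrm f.
Proof. by rewrite /orient -normrEsg norm_cross_orthogonal. Qed.

Lemma cross_neq0 : cross e f != 0.
Proof. by rewrite -normr_gt0 norm_cross_orthogonal mulr_gt0. Qed.

Lemma orient_sqr : orient e f ^+ 2 = 1.
Proof. by rewrite /orient sqr_sg cross_neq0. Qed.

Lemma norm_orient : `|orient e f| = 1.
Proof. by rewrite /orient normr_sg cross_neq0. Qed.

(** A quarter turn carries the direction of [f] to that of [e], up to the sign [orient]. In a face
    the factor [nrm f / nrm e] is the conductance, so this turns fluxes along primal edges into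
    increments along dual edges. *)
Lemma orient_cross_dot w : orient e f * cross w f = nrm f / nrm e * dot w e.
Proof.
have e1 : nrm e != 0 by rewrite gt_eqF.
apply: (mulfI (x := nrm e ^+ 2)); first by rewrite expf_neq0.
have -> : nrm e ^+ 2 * (nrm f / nrm e * dot w e) = nrm e * nrm f * dot w e by field.
rewrite -orient_cross nrm_sqr.
have -> : dot e e * (orient e f * cross w f) =
  orient e f * cross e f * dot w e + orient e f * dot e f * cross w e.
  by rewrite /dot /cross; ring.
by rewrite ef mulr0 mul0r addr0.
Qed.

Lemma orient_cross_dotN w : orient e f * cross w e = - (nrm e / nrm f * dot w f).
Proof.
have f1 : nrm f != 0 by rewrite gt_eqF.
apply: (mulfI (x := nrm f ^+ 2)); first by rewrite expf_neq0.
have -> : nrm f ^+ 2 * - (nrm e / nrm f * dot w f) = - (nrm e * nrm f * dot w f).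
  by field.
rewrite -orient_cross nrm_sqr.
have -> : dot f f * (orient e f * cross w e) =
  - (orient e f * cross e f * dot w f) + orient e f * dot e f * cross w f.
  by rewrite /dot /cross; ring.
by rewrite ef mulr0 mul0r addr0.
Qed.

End Frame.
End OrthogonalFrame.

Section Bump.
Variable R : realType.
Implicit Types (a b t : R) (p q e f : R * R).

Definition pos a : R := Num.max 0 a.

Lemma pos_ge0 a : 0 <= pos a. Proof. by rewrite /pos le_max lexx. Qed.

Variant pos_spec a : R -> Type :=
| PosGe : 0 <= a -> pos_spec a a
| PosLt : a < 0 -> pos_spec a 0.

Lemma posP a : pos_spec a (pos a).
Proof. by rewrite /pos; case: (leP 0 a) => h; constructor. Qed.

Lemma pos_lip a b : `|pos b - pos a| <= `|b - a|.
Proof.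
have h1 := ler_norm (b - a); have h2 := ler_norm (a - b); rewrite distrC in h2.
by case: (posP a) => ha; case: (posP b) => hb; rewrite ler_norml; split_lra.
Qed.

Lemma pos_sqr_taylor a b :
  `|pos b ^+ 2 - pos a ^+ 2 - 2 * pos a * (b - a)| <= (b - a) ^+ 2.
Proof.
have h0 := sqr_ge0 (b - a); have h1 := sqr_ge0 a; have h2 := sqr_ge0 b.
case: (posP a) => ha; case: (posP b) => hb; rewrite ler_norml ?expr0n /=.
- by split_lra.
- have : 0 <= a * - b by rewrite mulr_ge0; lra.
  by move=> ?; split_lra.
- have : 0 <= - a * b by rewrite mulr_ge0; lra.
  by move=> ?; split_lra.
- by split_lra.
Qed.

(** The upper bound [1], which holds for [1 - |p|^2], lets the cubic part of the remainder be
    absorbed into the quadratic one. *)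
Lemma pos_cube_taylor a b : a <= 1 -> b <= 1 ->
  `|pos b ^+ 3 - pos a ^+ 3 - 3 * pos a ^+ 2 * (b - a)| <= 3 * (b - a) ^+ 2.
Proof.
case: (posP a) => ha; case: (posP b) => hb a1 b1; rewrite ler_norml.
- have -> : b ^+ 3 - a ^+ 3 - 3 * a ^+ 2 * (b - a) = (b - a) ^+ 2 * (b + 2 * a) by ring.
  have := sqr_ge0 (b - a) => h; apply/andP; split; nra.
- have -> : 0 ^+ 3 - a ^+ 3 - 3 * a ^+ 2 * (b - a) = a ^+ 2 * (2 * a - 3 * b) by ring.
  have h : 0 <= a * - b by rewrite mulr_ge0; lra.
  have h1 : a ^+ 2 <= a by nra.
  have h2 : 0 <= a ^+ 2 by exact: sqr_ge0.
  have h3 : 0 <= b ^+ 2 by exact: sqr_ge0.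
  have h4 : a ^+ 2 * - b <= a * - b by apply: ler_wpM2r; lra.
  have h5 : a ^+ 2 * a <= a ^+ 2 by rewrite ler_piMr.
  apply/andP; split; last by nra.
  have : 0 <= a ^+ 2 * (2 * a - 3 * b) by rewrite mulr_ge0//; lra.
  have : 0 <= (b - a) ^+ 2 by exact: sqr_ge0.
  lra.
- have -> : b ^+ 3 - 0 ^+ 3 - 3 * 0 ^+ 2 * (b - a) = b ^+ 2 * b by ring.
  have h5 : b ^+ 2 * b <= b ^+ 2 by rewrite ler_piMr ?sqr_ge0.
  have h6 : 0 <= b ^+ 2 * b by rewrite mulr_ge0 ?sqr_ge0.
  have h7 : b ^+ 2 <= (b - a) ^+ 2 by rewrite ler_pXn2r// ?nnegrE; lra.
  split_lra.
- rewrite !expr0n /=; have := sqr_ge0 (b - a) => h; split_lra.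
Qed.

Definition radial p : R := pos (1 - dot p p).
(** The third power is the least integer power whose Hessian is Lipschitz across the unit circle;
    [grad_bump_taylor] and [hess_bump_lip] need exactly that. *)
Definition bump p : R := radial p ^+ 3.
Definition grad_bump p : R * R := (- 6 * radial p ^+ 2) *: p.
Definition hess_bump p e : R :=
  - 6 * radial p ^+ 2 * dot e e + 24 * radial p * dot p e ^+ 2.

Lemma radial_ge0 p : 0 <= radial p. Proof. exact: pos_ge0. Qed.

Lemma radial_le1 p : radial p <= 1.
Proof. by rewrite /radial; case: posP => // _; rewrite gerBl dot_ge0. Qed.

Lemma radial_eq0 p : 1 <= nrm p -> radial p = 0.
Proof.
move=> h; have : 1 <= dot p p by rewrite -nrm_sqr exprn_ege1.
by rewrite /radial; case: posP => //; lra.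
Qed.

Let norm_m6 a : `|- 6 * a| = 6 * `|a|.
Proof. by rewrite normrM normrN normr_nat. Qed.

Section Increment.
Variables (p e : R * R).
Hypotheses (p3 : nrm p <= 3) (e1 : nrm e <= 1).
Let l := nrm e.
Let a := 1 - dot p p.
Let b := 1 - dot (p + e) (p + e).

Let l0 : 0 <= l. Proof. exact: nrm_ge0. Qed.
Let ll : dot e e = l ^+ 2. Proof. by rewrite nrm_sqr. Qed.
Let pe : `|dot p e| <= 3 * l.
Proof. by apply: le_trans (ler_norm_dot _ _) _; rewrite ler_wpM2r. Qed.
Let ba : b - a = - 2 * dot p e - l ^+ 2.
Proof. by rewrite -ll /b /a /dot /=; ring. Qed.
Let ba7 : `|b - a| <= 7 * l.
Proof.
move: pe; rewrite ba !ler_norml => /andP[h1 h2].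
have : l ^+ 2 <= l by rewrite expr2 ler_piMr.
have := sqr_ge0 l; lra.
Qed.
Let ba49 : (b - a) ^+ 2 <= 49 * l ^+ 2.
Proof.
rewrite -[X in X <= _]real_normK ?num_real//.
have -> : 49 * l ^+ 2 = (7 * l) ^+ 2 by ring.
by rewrite ler_pXn2r ?nnegrE// mulr_ge0.
Qed.

Lemma radial_lip : `|radial (p + e) - radial p| <= 7 * l.
Proof. exact: le_trans (pos_lip _ _) ba7. Qed.

Lemma bump_taylor :
  `|bump (p + e) - bump p - dot (grad_bump p) e| <= 150 * l ^+ 2.
Proof.
have a1 : a <= 1 by rewrite gerBl dot_ge0.
have b1 : b <= 1 by rewrite gerBl dot_ge0.
have := pos_cube_taylor a1 b1; rewrite -/(radial _) -/(radial _) => h.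
have -> : bump (p + e) - bump p - dot (grad_bump p) e =
  radial (p + e) ^+ 3 - radial p ^+ 3 - 3 * radial p ^+ 2 * (b - a)
  - 3 * radial p ^+ 2 * l ^+ 2.
  by rewrite ba /bump /grad_bump /dot /= /GRing.scale /=; ring.
have h1 : 0 <= radial p ^+ 2 * l ^+ 2 <= l ^+ 2.
  rewrite mulr_ge0 ?sqr_ge0//= ler_piMl ?sqr_ge0// expr_le1 ?radial_ge0 ?radial_le1//.
move: h h1 ba49; rewrite !ler_norml => /andP[h1 h2] /andP[h3 h4] h5.
split_lra.
Qed.

Lemma radial_sqr_lip : `|radial (p + e) ^+ 2 - radial p ^+ 2| <= 14 * l.
Proof.
rewrite subr_sqr normrM.
have -> : 14 * l = (7 * l) * 2 by ring.
apply: ler_pM => //; first exact: radial_lip.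
rewrite ger0_norm ?addr_ge0 ?radial_ge0//.
have := radial_le1 (p + e); have := radial_le1 p; lra.
Qed.

Lemma grad_bump_lip : nrm (grad_bump (p + e) - grad_bump p) <= 258 * l.
Proof.
have -> : grad_bump (p + e) - grad_bump p =
  (- 6 * radial (p + e) ^+ 2) *: e + (- 6 * (radial (p + e) ^+ 2 - radial p ^+ 2)) *: p.
  rewrite /grad_bump; coordwise ring.
apply: le_trans (ler_nrmD _ _) _; rewrite !nrmZ.
rewrite !norm_m6.
have h : `|radial (p + e) ^+ 2| <= 1.
  by rewrite ger0_norm ?sqr_ge0// expr_le1 ?radial_ge0 ?radial_le1.
have h2 : `|radial (p + e) ^+ 2| * l <= l by rewrite ler_piMl.
have h3 := radial_sqr_lip.
have h4 : `|radial (p + e) ^+ 2 - radial p ^+ 2| * nrm p <= 14 * l * 3.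
  by apply: ler_pM => //; exact: nrm_ge0.
rewrite -/l; lra.
Qed.

Lemma grad_bump_taylor :
  `|dot (grad_bump (p + e) - grad_bump p) e - hess_bump p e| <= 1002 * l ^+ 3.
Proof.
set B := radial (p + e); set A := radial p.
have -> : dot (grad_bump (p + e) - grad_bump p) e - hess_bump p e =
  - 6 * (B ^+ 2 - A ^+ 2) * l ^+ 2
  - 6 * dot p e * (B ^+ 2 - A ^+ 2 - 2 * A * (b - a))
  + 12 * A * l ^+ 2 * dot p e.
  by rewrite ba -ll /grad_bump /hess_bump -/A -/B /dot /= /GRing.scale /=; ring.
have h1 := radial_sqr_lip; rewrite -/A -/B in h1.
have h2 : `|B ^+ 2 - A ^+ 2 - 2 * A * (b - a)| <= 49 * l ^+ 2.
  by apply: le_trans (pos_sqr_taylor a b) ba49.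
have A0 : `|A| <= 1 by rewrite ger0_norm ?radial_le1 ?radial_ge0.
have t1 : `|- 6 * (B ^+ 2 - A ^+ 2) * l ^+ 2| <= 84 * l ^+ 3.
  rewrite normrM norm_m6 (ger0_norm (sqr_ge0 _)).
  have -> : 84 * l ^+ 3 = 6 * (14 * l) * l ^+ 2 by ring.
  by rewrite ler_wpM2r ?sqr_ge0// ler_wpM2l.
have t2 : `|6 * dot p e * (B ^+ 2 - A ^+ 2 - 2 * A * (b - a))| <= 882 * l ^+ 3.
  rewrite 2!normrM normr_nat.
  have -> : 882 * l ^+ 3 = (6 * (3 * l)) * (49 * l ^+ 2) by ring.
  by apply: ler_pM => //; rewrite ?mulr_ge0// ler_wpM2l.
have t3 : `|12 * A * l ^+ 2 * dot p e| <= 36 * l ^+ 3.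
  rewrite 3!normrM normr_nat (ger0_norm (sqr_ge0 _)).
  have -> : 36 * l ^+ 3 = 12 * 1 * l ^+ 2 * (3 * l) by ring.
  apply: ler_pM; rewrite ?mulr_ge0 ?sqr_ge0//.
  by rewrite ler_wpM2r ?sqr_ge0// ler_wpM2l.
move: t1 t2 t3; rewrite !ler_norml => /andP[? ?] /andP[? ?] /andP[? ?].
split_lra.
Qed.

Lemma hess_bump_lip f :
  `|hess_bump (p + e) f - hess_bump p f| <= 1764 * l * nrm f ^+ 2.
Proof.
set B := radial (p + e); set A := radial p; set m := nrm f.
have m0 : 0 <= m by exact: nrm_ge0.
have -> : hess_bump (p + e) f - hess_bump p f =
  - 6 * (B ^+ 2 - A ^+ 2) * m ^+ 2 + 24 * ((B - A) * dot p f ^+ 2)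
  + 24 * (B * (dot e f * (dot p f + dot (p + e) f))).
  by rewrite nrm_sqr /hess_bump -/A -/B /dot /=; ring.
have pf : `|dot p f| <= 3 * m.
  by apply: le_trans (ler_norm_dot _ _) _; rewrite ler_wpM2r.
have ef : `|dot e f| <= l * m by exact: ler_norm_dot.
have em : `|dot e f| <= m.
  by apply: le_trans ef _; rewrite ler_piMl.
have B0 : `|B| <= 1 by rewrite ger0_norm ?radial_le1 ?radial_ge0.
have h1 := radial_sqr_lip; rewrite -/A -/B in h1.
have t1 : `|- 6 * (B ^+ 2 - A ^+ 2) * m ^+ 2| <= 84 * l * m ^+ 2.
  rewrite normrM norm_m6 (ger0_norm (sqr_ge0 _)).
  have -> : 84 * l * m ^+ 2 = 6 * (14 * l) * m ^+ 2 by ring.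
  by rewrite ler_wpM2r ?sqr_ge0// ler_wpM2l.
have t2 : `|24 * ((B - A) * dot p f ^+ 2)| <= 1512 * l * m ^+ 2.
  rewrite 2!normrM normr_nat.
  have -> : 1512 * l * m ^+ 2 = 24 * (7 * l * (3 * m) ^+ 2) by ring.
  rewrite ler_wpM2l//; apply: ler_pM; rewrite ?radial_lip//.
  by rewrite normrX ler_pXn2r ?nnegrE ?mulr_ge0.
have t3 : `|24 * (B * (dot e f * (dot p f + dot (p + e) f)))| <= 168 * l * m ^+ 2.
  rewrite 3!normrM normr_nat.
  have -> : 168 * l * m ^+ 2 = 24 * (1 * (l * m * (7 * m))) by ring.
  rewrite ler_wpM2l//; apply: ler_pM => //; apply: ler_pM => //.
  have -> : dot (p + e) f = dot p f + dot e f by rewrite /dot /=; ring.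
  move: pf em; rewrite !ler_norml => /andP[? ?] /andP[? ?]; split_lra.
move: t1 t2 t3; rewrite !ler_norml => /andP[? ?] /andP[? ?] /andP[? ?].
split_lra.
Qed.

End Increment.
End Bump.

(** * A discrete Caccioppoli argument on an orthodiagonal network *)

Section SumBound.
Variables (R : realType) (T : finType).

Lemma ler_norm_sum_pred (P : pred T) (F G : T -> R) :
  (forall i, P i -> `|F i| <= G i) -> (forall i, ~~ P i -> F i = 0) ->
  `|\sum_i F i| <= \sum_(i | P i) G i.
Proof.
move=> h1 h2; rewrite (bigID P)/= [X in _ + X]big1// addr0.
by apply: le_trans (ler_norm_sum _ _ _) _; exact: ler_sum.
Qed.

End SumBound.

Section OrthodiagonalNetwork.
Variables (R : realType) (Pr Du Qd : finType).
Variables (X : Pr -> R * R) (U : Du -> R * R).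
Variables (x1 x2 : Qd -> Pr) (v1 v2 : Qd -> Du).

Definition incid (x : Pr) (Q : Qd) : R := (x == x1 Q)%:R - (x == x2 Q)%:R.

Lemma sum_incid (T : Pr -> Qd -> R) :
  \sum_x \sum_Q incid x Q * T x Q = \sum_Q (T (x1 Q) Q - T (x2 Q) Q).
Proof.
rewrite exchange_big /=; apply: eq_bigr => Q _.
have pick y : \sum_x (x == y)%:R * T x Q = T y Q.
  rewrite (bigD1 y)//= eqxx mul1r big1 ?addr0// => x /negPf ->.
  by rewrite mul0r.
rewrite /incid -[in RHS](pick (x1 Q)) -[in RHS](pick (x2 Q)) -sumrB.
by apply: eq_bigr => x _; rewrite mulrBl.
Qed.

Let e Q : R * R := X (x2 Q) - X (x1 Q).
Let f Q : R * R := U (v2 Q) - U (v1 Q).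
Let s Q := orient (e Q) (f Q).
Let c Q := nrm (f Q) / nrm (e Q).

(** With orthogonal diagonals this is twice the area of the quadrilateral, convex or not. *)
Definition quad_weight Q : R := nrm (e Q) * nrm (f Q).
Notation W := quad_weight.
Notation P1 Q := (X (x1 Q)).
Notation P2 Q := (X (x2 Q)).
Notation D1 Q := (U (v1 Q)).
Notation D2 Q := (U (v2 Q)).

Variables (eps H : R) (h : Pr -> R).
Hypotheses (eps1 : 0 <= eps <= 8^-1).
Hypotheses (e0 : forall Q, 0 < nrm (e Q)) (f0 : forall Q, 0 < nrm (f Q)).
Hypothesis ef0 : forall Q, dot (e Q) (f Q) = 0.
Hypotheses (l11 : forall Q, nrm (D1 Q - P1 Q) <= eps)
  (l12 : forall Q, nrm (D1 Q - P2 Q) <= eps)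
  (l21 : forall Q, nrm (D2 Q - P1 Q) <= eps)
  (l22 : forall Q, nrm (D2 Q - P2 Q) <= eps).
(** Radius [5] leaves room for the nesting below: [bump] lives in the unit disc, the nonzero terms
    of the sum within radius [2], and the cut-off [plateau] is [1] up to radius [3] and [0] from
    radius [4] on. *)
Hypothesis harm : forall x, nrm (X x) < 5 ->
  \sum_Q c Q * incid x Q * (h (x2 Q) - h (x1 Q)) = 0.
Hypothesis flux : forall x, nrm (X x) < 5 -> forall F : Du -> R,
  \sum_Q s Q * incid x Q * (F (v2 Q) - F (v1 Q)) = 0.
Hypothesis hH : forall x, `|h x| <= H.

Let eps0 : 0 <= eps. Proof. by case/andP: eps1. Qed.
Let eps8 : eps <= 8^-1. Proof. by case/andP: eps1. Qed.

Let dh Q := h (x2 Q) - h (x1 Q).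

Let e_eps Q : nrm (e Q) <= 2 * eps.
Proof.
have -> : e Q = (D1 Q - P1 Q) - (D1 Q - P2 Q).
  by rewrite /e opprB [RHS]addrC addrA subrK.
by apply: le_trans (ler_nrmD _ _) _; rewrite nrmN; have := l11 Q; have := l12 Q; lra.
Qed.

Let f_eps Q : nrm (f Q) <= 2 * eps.
Proof.
have -> : f Q = (D2 Q - P1 Q) - (D1 Q - P1 Q).
  by rewrite /f opprB addrA subrK.
by apply: le_trans (ler_nrmD _ _) _; rewrite nrmN; have := l11 Q; have := l21 Q; lra.
Qed.

Let c0 Q : 0 < c Q. Proof. by rewrite divr_gt0. Qed.

Let weight_gt0 Q : 0 < W Q. Proof. by rewrite mulr_gt0. Qed.

Let ce Q : c Q * nrm (e Q) = nrm (f Q).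
Proof. by rewrite /c divfK// gt_eqF. Qed.

Let cVf Q : (c Q)^-1 * nrm (f Q) = nrm (e Q).
Proof. by rewrite /c invf_div divfK// gt_eqF. Qed.

Lemma green_primal (psi : Pr -> R) : (forall x, 5 <= nrm (X x) -> psi x = 0) ->
  \sum_Q c Q * (psi (x2 Q) - psi (x1 Q)) * dh Q = 0.
Proof.
move=> psi0; apply/eqP; rewrite -oppr_eq0 -sumrN; apply/eqP.
rewrite (eq_bigr (fun Q => psi (x1 Q) * (c Q * dh Q) - psi (x2 Q) * (c Q * dh Q))).
  rewrite -(sum_incid (fun x Q => psi x * (c Q * dh Q))) big1// => x _.
  have [x5|x5] := leP 5 (nrm (X x)).
    by rewrite big1// => Q _; rewrite psi0// mul0r mulr0.
  rewrite -[RHS](mulr0 (psi x)) -[in RHS](harm x5) mulr_sumr; apply: eq_bigr => Q _.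
  rewrite /dh; ring.
move=> Q _; ring.
Qed.

(** The function on dual vertices may change with [x], because the balance [flux] is applied around
    one primal vertex at a time. This freedom is what [discrete_green] exploits. *)
Lemma green_dual (g : Pr -> R) (F : Pr -> Du -> R) :
  (forall x Q, 5 <= nrm (X x) -> x = x1 Q \/ x = x2 Q ->
     g x * (F x (v2 Q) - F x (v1 Q)) = 0) ->
  \sum_Q s Q * (g (x1 Q) * (F (x1 Q) (v2 Q) - F (x1 Q) (v1 Q)) -
                g (x2 Q) * (F (x2 Q) (v2 Q) - F (x2 Q) (v1 Q))) = 0.
Proof.
move=> F0.
rewrite (eq_bigr (fun Q => s Q * (g (x1 Q) * (F (x1 Q) (v2 Q) - F (x1 Q) (v1 Q))) -
   s Q * (g (x2 Q) * (F (x2 Q) (v2 Q) - F (x2 Q) (v1 Q))))); last first.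
  by move=> Q _; rewrite mulrBr.
rewrite -(sum_incid (fun x Q => s Q * (g x * (F x (v2 Q) - F x (v1 Q))))).
rewrite big1// => x _.
have [x5|x5] := leP 5 (nrm (X x)).
  rewrite big1// => Q _; rewrite /incid.
  case: (eqVneq x (x1 Q)) => [xx|]; first by rewrite F0; [rewrite !mulr0|exact: x5|left].
  case: (eqVneq x (x2 Q)) => [xx|]; first by rewrite F0; [rewrite !mulr0|exact: x5|right].
  by rewrite subrr mul0r.
rewrite -[RHS](mulr0 (g x)) -[in RHS](flux x5 (F x)) mulr_sumr; apply: eq_bigr => Q _.
ring.
Qed.

Let near2 Q := nrm (P1 Q) <= 2.
Let near5 Q := nrm (P1 Q) <= 5.

Let x2E Q : P2 Q = P1 Q + e Q. Proof. by rewrite /e addrC subrK. Qed.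

Let x2_le Q : nrm (P2 Q) <= nrm (P1 Q) + 4^-1.
Proof.
rewrite x2E; apply: le_trans (ler_nrmD _ _) _; rewrite lerD2l.
by have := e_eps Q; have := eps8; lra.
Qed.

Let x1_le Q : nrm (P1 Q) <= nrm (P2 Q) + 4^-1.
Proof.
have -> : P1 Q = P2 Q + (- e Q) by rewrite x2E addrK.
apply: le_trans (ler_nrmD _ _) _; rewrite lerD2l nrmN.
by have := e_eps Q; have := eps8; lra.
Qed.

Definition plateau (p : R * R) : R := Num.min 1 (pos (4 - nrm p)).

Let plateau_lip (p q : R * R) : `|plateau (p + q) - plateau p| <= nrm q.
Proof.
have h1 := ler_nrmD p q.
have h2 : nrm p <= nrm (p + q) + nrm q.
  by rewrite -(nrmN q) -{1}(addrK q p); exact: ler_nrmD.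
have min_lip (a b : R) : `|Num.min 1 b - Num.min 1 a| <= `|b - a|.
  have h3 := ler_norm (b - a); have h4 := ler_norm (a - b); rewrite distrC in h4.
  by case: (leP 1 a) => ha; case: (leP 1 b) => hb; rewrite ler_norml; split_lra.
apply: le_trans (min_lip _ _) _; apply: le_trans (pos_lip _ _) _.
by rewrite ler_norml; split_lra.
Qed.

(** Testing harmonicity with [chi^2 h] gives the exact identity [h0], since [(chi2^2 h2 - chi1^2 h1)
    (h2 - h1) = (chi2 h2 - chi1 h1)^2 - h1 h2 (chi2 - chi1)^2]. The left side of [h0] dominates the
    energy where [chi = 1], and each face contributes at most [H^2 c |e|^2 = H^2 W] to the right
    side. *)
Lemma caccioppoli : \sum_(Q | near2 Q) c Q * dh Q ^+ 2 <=
  H ^+ 2 * \sum_(Q | near5 Q) W Q.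
Proof.
pose chi x := plateau (X x).
have chi0 x : 4 <= nrm (X x) -> chi x = 0.
  by rewrite /chi /plateau => h4; case: posP => h5; [have -> : 4 - nrm (X x) = 0 by lra|];
    rewrite min_r.
have chi1 x : nrm (X x) <= 3 -> chi x = 1.
  by rewrite /chi /plateau => h4; case: posP => h5; [rewrite min_l//; lra|lra].
have h0 : \sum_Q c Q * (chi (x2 Q) * h (x2 Q) - chi (x1 Q) * h (x1 Q)) ^+ 2 =
  \sum_Q c Q * (h (x1 Q) * h (x2 Q)) * (chi (x2 Q) - chi (x1 Q)) ^+ 2.
  apply/eqP; rewrite -subr_eq0 -sumrB; apply/eqP.
  rewrite -[RHS](@green_primal (fun x => chi x ^+ 2 * h x)).
    by apply: eq_bigr => Q _; rewrite /dh; ring.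
  by move=> x x5; rewrite chi0 ?expr0n ?mul0r//; lra.
apply: (@le_trans _ _ (\sum_Q c Q * (chi (x2 Q) * h (x2 Q) - chi (x1 Q) * h (x1 Q)) ^+ 2)).
  rewrite [X in _ <= X](bigID near2)/= -[X in X <= _]addr0; apply: lerD.
    apply: ler_sum => Q n2; rewrite !chi1 ?mul1r//; rewrite /near2 in n2.
      lra.
    by have := x2_le Q; lra.
  by apply: sumr_ge0 => Q _; rewrite mulr_ge0 ?sqr_ge0 ?ltW.
rewrite h0; apply: le_trans (ler_norm _) _; rewrite mulr_sumr.
apply: ler_norm_sum_pred => Q.
  move=> _; rewrite 2!normrM (gtr0_norm (c0 Q)) (ger0_norm (sqr_ge0 _)).
  have -> : H ^+ 2 * W Q = c Q * H ^+ 2 * nrm (e Q) ^+ 2.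
    by rewrite /quad_weight -ce; ring.
  apply: ler_pM; [by apply: mulr_ge0 => //; exact: ltW|exact: sqr_ge0| |].
    rewrite ler_wpM2l ?(ltW (c0 _))// expr2 normrM.
    by apply: ler_pM.
  rewrite -[X in X <= _]real_normK ?num_real// ler_pXn2r ?nnegrE ?nrm_ge0//.
  by rewrite /chi x2E; exact: plateau_lip.
rewrite /near5 -ltNge => n5; rewrite !chi0 ?subrr ?expr0n ?mulr0//.
  lra.
by have := x1_le Q; lra.
Qed.

(* [- 12 * radial_theta] is the Laplacian of [bump]. *)
Definition radial_theta (p : R * R) : R := radial p ^+ 2 - 2 * dot p p * radial p.

(** Second differences of [bump] along the two diagonals, weighted so that both have the size of
    [W Q]. *)
Let bracket Q : R :=
  c Q * dot (grad_bump (P2 Q) - grad_bump (P1 Q)) (e Q) +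
  (c Q)^-1 * dot (grad_bump (D2 Q) - grad_bump (D1 Q)) (f Q).

(** The price of summing by parts: it multiplies the increment of [h]. The first two terms are
    first-order Taylor errors along [e]; the third pairs the change of the gradient along [f] with
    an edge. All three are of order [eps |f|]. *)
Let defect Q : R :=
  c Q * (dot (grad_bump (P2 Q)) (e Q) - (bump (P2 Q) - bump (P1 Q))) +
  c Q * (dot (grad_bump (D2 Q)) (e Q) - (bump (P2 Q) - bump (P1 Q))) +
  s Q * cross (grad_bump (D2 Q) - grad_bump (D1 Q)) (D1 Q - P2 Q).

Let grad_bump0 (p : R * R) : 1 <= nrm p -> grad_bump p = 0.
Proof. by move=> h1; rewrite /grad_bump radial_eq0// expr0n mulr0 scale0r. Qed.

Let bump0 (p : R * R) : 1 <= nrm p -> bump p = 0.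
Proof. by move=> h1; rewrite /bump radial_eq0// expr0n. Qed.

Let v_ge x u : nrm (U u - X x) <= eps -> nrm (X x) - 8^-1 <= nrm (U u).
Proof.
move=> h1; have := ler_nrmD (U u) (X x - U u); rewrite addrC subrK nrmB.
by have := eps8; lra.
Qed.

Let v_le x u : nrm (U u - X x) <= eps -> nrm (U u) <= nrm (X x) + 8^-1.
Proof.
move=> h1; have := ler_nrmD (X x) (U u - X x); rewrite addrC subrK.
by have := eps8; lra.
Qed.

(** Three exact identities are combined. [E1] tests harmonicity with [bump]; [E2] is the dual
    balance for a function linear in the dual position, that is, linear functions are discrete
    harmonic; [E3] is the dual balance for [cross (grad_bump (U u)) (U u - X x)], which brings in
    gradients at dual vertices. *)
Lemma discrete_green : \sum_Q (h (x1 Q) * bracket Q + dh Q * defect Q) = 0.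
Proof.
have E1 : \sum_Q c Q * (bump (P2 Q) - bump (P1 Q)) * dh Q = 0.
  apply: (@green_primal (fun x => bump (X x))) => x x5; apply: bump0; lra.
have E2 : \sum_Q c Q * (h (x1 Q) * dot (grad_bump (P1 Q)) (e Q) -
                        h (x2 Q) * dot (grad_bump (P2 Q)) (e Q)) = 0.
  rewrite -[RHS](@green_dual h (fun x u => cross (grad_bump (X x)) (U u))).
    apply: eq_bigr => Q _; rewrite !mulrBr !(mulrCA (c Q)) -!orient_cross_dot//.
    rewrite -/(s Q) /f /cross /=; ring.
  move=> x Q x5 _; rewrite grad_bump0; last lra.
  by rewrite /cross /= !mul0r !subr0 mulr0.
have E3 : \sum_Q s Q * (h (x1 Q) *
    (cross (grad_bump (D2 Q)) (D2 Q - P1 Q) -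
     cross (grad_bump (D1 Q)) (D1 Q - P1 Q)) -
   h (x2 Q) *
    (cross (grad_bump (D2 Q)) (D2 Q - P2 Q) -
     cross (grad_bump (D1 Q)) (D1 Q - P2 Q))) = 0.
  apply: (@green_dual h (fun x u => cross (grad_bump (U u)) (U u - X x))) => x Q x5 xQ.
  suff v0 u : nrm (U u - X x) <= eps -> grad_bump (U u) = 0.
    by case: xQ => xQ; rewrite xQ !v0 -?xQ// ?xQ// /cross /= !mul0r !subr0 mulr0.
  move=> ux; apply: grad_bump0; have := v_ge ux; lra.
(* The combination is [- E2 - E3 - 2 E1]; the two copies of [E1] supply the two increments of [bump]
   subtracted in [defect]. *)
apply: (@eq_trans _ _ (0 - 0 - 2 * 0)); last by rewrite mulr0 !subr0.
rewrite -[X in X - _ - _]oppr0 -[X in - X - _ - _]E2 -[X in _ - X - _]E3 -[X in _ - _ * X]E1.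
rewrite mulr_sumr -!sumrN -!big_split/=.
apply: eq_bigr => Q _.
have K1 : c Q * dot (grad_bump (D2 Q)) (e Q) = s Q * cross (grad_bump (D2 Q)) (f Q).
  by rewrite -orient_cross_dot.
have K2 : (c Q)^-1 * dot (grad_bump (D2 Q) - grad_bump (D1 Q)) (f Q) =
   - (s Q * cross (grad_bump (D2 Q) - grad_bump (D1 Q)) (e Q)).
  by rewrite /s orient_cross_dotN// opprK /c invf_div.
apply/eqP; rewrite -subr_eq0; apply/eqP.
transitivity (dh Q * (c Q * dot (grad_bump (D2 Q)) (e Q)
    - s Q * cross (grad_bump (D2 Q)) (f Q))); last by rewrite K1 subrr mulr0.
rewrite /bracket /defect K2 /dh; move: (s Q) (c Q) => sQ cQ.
by rewrite /e /f /dot /cross /=; ring.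
Qed.

Let cM_le (k : R) Q : 0 <= k -> c Q * (k * nrm (e Q) ^+ 2) <= 2 * k * eps * nrm (f Q).
Proof.
move=> k0; have -> : c Q * (k * nrm (e Q) ^+ 2) = k * nrm (f Q) * nrm (e Q).
  by rewrite -ce; ring.
have -> : 2 * k * eps * nrm (f Q) = k * nrm (f Q) * (2 * eps) by ring.
by apply: ler_wpM2l => //; rewrite mulr_ge0// ltW.
Qed.

Lemma defect_le Q : near2 Q -> `|defect Q| <= 1116 * eps * nrm (f Q).
Proof.
rewrite /near2 => n2; have x23 : nrm (P2 Q) <= 3 by have := x2_le Q; lra.
have v13 : nrm (D1 Q) <= 3 by have := v_le (l11 Q); lra.
have e1 : nrm (- e Q) <= 1 by rewrite nrmN; have := e_eps Q; have := eps8; lra.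
have f1 : nrm (f Q) <= 1 by have := f_eps Q; have := eps8; lra.
have eps1' : eps <= 1 by have := eps8; lra.
have B1 : `|dot (grad_bump (P2 Q)) (e Q) - (bump (P2 Q) - bump (P1 Q))|
    <= 150 * nrm (e Q) ^+ 2.
  have := bump_taylor x23 e1; rewrite nrmN x2E addrK => h1.
  by rewrite distrC; apply: le_trans h1; rewrite /dot /= le_eqVlt; apply/orP; left;
    apply/eqP; rewrite -normrN; congr (`|_|); ring.
have B2 : `|dot (grad_bump (D2 Q) - grad_bump (P2 Q)) (e Q)| <=
    258 * eps * nrm (e Q).
  apply: le_trans (ler_norm_dot _ _) _; rewrite ler_wpM2r ?nrm_ge0//.
  have -> : D2 Q = P2 Q + (D2 Q - P2 Q) by rewrite addrC subrK.
  apply: le_trans (grad_bump_lip x23 _) _; first exact: le_trans (l22 Q) _.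
  by apply: ler_wpM2l (l22 Q); exact: ler0n.
have B3 : `|s Q * cross (grad_bump (D2 Q) - grad_bump (D1 Q))
    (D1 Q - P2 Q)| <= 258 * eps * nrm (f Q).
  rewrite normrM /s norm_orient// mul1r; apply: le_trans (ler_norm_cross _ _) _.
  have -> : 258 * eps * nrm (f Q) = 258 * nrm (f Q) * eps by ring.
  apply: ler_pM; rewrite ?nrm_ge0//.
  have -> : D2 Q = D1 Q + f Q by rewrite /f addrC subrK.
  exact: grad_bump_lip.
have c1 := c0 Q.
have C1 : `|c Q * (dot (grad_bump (P2 Q)) (e Q) - (bump (P2 Q) - bump (P1 Q)))|
   <= 300 * eps * nrm (f Q).
  rewrite normrM gtr0_norm//; apply: (@le_trans _ _ (c Q * (150 * nrm (e Q) ^+ 2))).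
    by rewrite ler_wpM2l// ltW.
  by apply: le_trans (cM_le _ _) _ => //; lra.
have C2 : `|c Q * dot (grad_bump (D2 Q) - grad_bump (P2 Q)) (e Q)|
   <= 258 * eps * nrm (f Q).
  rewrite normrM gtr0_norm// -ce.
  have -> : 258 * eps * (c Q * nrm (e Q)) = c Q * (258 * eps * nrm (e Q)) by ring.
  by rewrite ler_wpM2l// ltW.
have -> : defect Q =
  2 * (c Q * (dot (grad_bump (P2 Q)) (e Q) - (bump (P2 Q) - bump (P1 Q)))) +
  c Q * dot (grad_bump (D2 Q) - grad_bump (P2 Q)) (e Q) +
  s Q * cross (grad_bump (D2 Q) - grad_bump (D1 Q)) (D1 Q - P2 Q).
  by rewrite /defect /dot /=; ring.
move: C1 C2 B3; rewrite !ler_norml => /andP[? ?] /andP[? ?] /andP[? ?].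
split_lra.
Qed.

(** In the orthogonal frame [e], [f] the weighted Hessian terms sum to [W Q] times the trace of the
    Hessian, whatever the shape of the face ([H1]). The dual half is expanded at [D1 Q], and [B3]
    moves its Hessian to [P1 Q]. *)
Lemma bracket_le Q : near2 Q ->
  `|bracket Q + 12 * W Q * radial_theta (P1 Q)| <= 5772 * eps * W Q.
Proof.
rewrite /near2 => n2; have x13 : nrm (P1 Q) <= 3 by lra.
have v13 : nrm (D1 Q) <= 3 by have := v_le (l11 Q); lra.
have e1 : nrm (e Q) <= 1 by have := e_eps Q; have := eps8; lra.
have f1 : nrm (f Q) <= 1 by have := f_eps Q; have := eps8; lra.
have eps1' : eps <= 1 by have := eps8; lra.
have H1 : c Q * hess_bump (P1 Q) (e Q) + (c Q)^-1 * hess_bump (P1 Q) (f Q) =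
    - (12 * W Q * radial_theta (P1 Q)).
  have E : c Q * nrm (e Q) ^+ 2 = W Q by rewrite /quad_weight -ce; ring.
  have F : (c Q)^-1 * nrm (f Q) ^+ 2 = W Q by rewrite /quad_weight -cVf; ring.
  have G : c Q * dot (P1 Q) (e Q) ^+ 2 + (c Q)^-1 * dot (P1 Q) (f Q) ^+ 2 =
      dot (P1 Q) (P1 Q) * W Q.
    apply: (mulfI (x := W Q)); first by rewrite gt_eqF.
    have := dot_orthogonal_frame (P1 Q) (ef0 Q); rewrite -2![dot (_ Q) _]nrm_sqr.
    have -> : nrm (f Q) ^+ 2 = c Q * W Q by rewrite /quad_weight mulrA ce.
    have -> : nrm (e Q) ^+ 2 = (c Q)^-1 * W Q.
      by rewrite /quad_weight [X in _ = _ * X]mulrC mulrA cVf.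
    move=> fr; transitivity (dot (P1 Q) (e Q) ^+ 2 * (c Q * W Q) +
       dot (P1 Q) (f Q) ^+ 2 * ((c Q)^-1 * W Q)); first by ring.
    by rewrite fr; field; rewrite !gt_eqF.
  rewrite /hess_bump -!nrm_sqr.
  transitivity (- 6 * radial (P1 Q) ^+ 2 * (c Q * nrm (e Q) ^+ 2 + (c Q)^-1 * nrm (f Q) ^+ 2)
     + 24 * radial (P1 Q) * (c Q * dot (P1 Q) (e Q) ^+ 2 + (c Q)^-1 * dot (P1 Q) (f Q) ^+ 2)).
    by ring.
  by rewrite E F G /radial_theta; ring.
have B1 : `|c Q * (dot (grad_bump (P2 Q) - grad_bump (P1 Q)) (e Q) -
     hess_bump (P1 Q) (e Q))| <= 2004 * eps * W Q.
  rewrite normrM gtr0_norm//; apply: (@le_trans _ _ (c Q * (1002 * nrm (e Q) ^+ 3))).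
    by rewrite ler_wpM2l ?(ltW (c0 Q))// x2E; exact: grad_bump_taylor.
  have -> : c Q * (1002 * nrm (e Q) ^+ 3) = 1002 * W Q * nrm (e Q).
    by rewrite /quad_weight -ce; ring.
  have -> : 2004 * eps * W Q = 1002 * W Q * (2 * eps) by ring.
  by apply: ler_wpM2l (e_eps Q); apply: mulr_ge0; [exact: ler0n|exact: ltW].
have cV0 : 0 < (c Q)^-1 by rewrite invr_gt0.
have B2 : `|(c Q)^-1 * (dot (grad_bump (D2 Q) - grad_bump (D1 Q)) (f Q) -
     hess_bump (D1 Q) (f Q))| <= 2004 * eps * W Q.
  rewrite normrM gtr0_norm//; apply: (@le_trans _ _ ((c Q)^-1 * (1002 * nrm (f Q) ^+ 3))).
    rewrite ler_wpM2l ?(ltW cV0)//.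
    have -> : D2 Q = D1 Q + f Q by rewrite /f addrC subrK.
    exact: grad_bump_taylor.
  have -> : (c Q)^-1 * (1002 * nrm (f Q) ^+ 3) = 1002 * W Q * nrm (f Q).
    by rewrite /quad_weight -cVf; ring.
  have -> : 2004 * eps * W Q = 1002 * W Q * (2 * eps) by ring.
  by apply: ler_wpM2l (f_eps Q); apply: mulr_ge0; [exact: ler0n|exact: ltW].
have B3 : `|(c Q)^-1 * (hess_bump (D1 Q) (f Q) - hess_bump (P1 Q) (f Q))| <=
    1764 * eps * W Q.
  rewrite normrM gtr0_norm//.
  have -> : 1764 * eps * W Q = (c Q)^-1 * (1764 * eps * nrm (f Q) ^+ 2).
    by rewrite /quad_weight -cVf; ring.
  rewrite ler_wpM2l ?(ltW cV0)//.
  have -> : D1 Q = P1 Q + (D1 Q - P1 Q) by rewrite addrC subrK.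
  apply: le_trans (hess_bump_lip x13 _ _) _; first exact: le_trans (l11 Q) _.
  by apply: ler_wpM2r (sqr_ge0 _) _ _ _; apply: ler_wpM2l (l11 Q); exact: ler0n.
rewrite -[X in _ + X]opprK -H1.
have -> : bracket Q - (c Q * hess_bump (P1 Q) (e Q) + (c Q)^-1 * hess_bump (P1 Q) (f Q)) =
  c Q * (dot (grad_bump (P2 Q) - grad_bump (P1 Q)) (e Q) - hess_bump (P1 Q) (e Q))
  + (c Q)^-1 * (dot (grad_bump (D2 Q) - grad_bump (D1 Q)) (f Q) - hess_bump (D1 Q) (f Q))
  + (c Q)^-1 * (hess_bump (D1 Q) (f Q) - hess_bump (P1 Q) (f Q)).
  by rewrite /bracket; ring.
move: B1 B2 B3; rewrite !ler_norml => /andP[? ?] /andP[? ?] /andP[? ?].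
split_lra.
Qed.

Lemma far_terms Q : ~~ near2 Q ->
  [/\ bracket Q = 0, defect Q = 0 & radial_theta (P1 Q) = 0].
Proof.
rewrite /near2 -ltNge => n2.
have X1 : 1 <= nrm (P1 Q) by lra.
have X2 : 1 <= nrm (P2 Q) by have := x1_le Q; lra.
have V1 : 1 <= nrm (D1 Q) by have := v_ge (l11 Q); lra.
have V2 : 1 <= nrm (D2 Q) by have := v_ge (l21 Q); lra.
rewrite /bracket /defect /radial_theta !grad_bump0// !bump0// radial_eq0//.
by rewrite /dot /cross /= !(mul0r, mulr0, subr0, addr0, expr0n).
Qed.

(** The defect is absorbed by [2 |dh| |f| <= c dh^2 / H + H |f|^2 / c] with [|f|^2 / c = W], and
    [caccioppoli] controls the energy. The constant comes from [(5772 + 2 * 558) / 12 = 574]. *)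
Lemma radial_kernel_sum_le :
  `|\sum_Q h (x1 Q) * W Q * radial_theta (P1 Q)| <=
  600 * eps * H * \sum_(Q | nrm (P1 Q) <= 5) W Q.
Proof.
set N := (X in _ <= _ * X).
have H0 (Q : Qd) : 0 <= H.
  by apply: (le_trans (normr_ge0 (h (x1 Q)))); exact: hH.
have N0 : 0 <= N by apply: sumr_ge0 => Q _; exact: ltW.
(* [H] is inverted below. If it is not positive, [h] vanishes at every [x1 Q], or there is no face
   at all. *)
have [Hp|Hn] := ltP 0 H; last first.
  rewrite big1 ?normr0; last first.
    move=> Q _; have := hH (x1 Q) => h1.
    have -> : h (x1 Q) = 0 by apply/eqP; rewrite -normr_le0; exact: le_trans h1 Hn.
    by rewrite !mul0r.
  case: (pickP (fun _ : Qd => true)) => [Q _|no].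
    by apply: mulr_ge0 N0; apply: mulr_ge0 (H0 Q); apply: mulr_ge0 eps0; exact: ler0n.
  have -> : N = 0 by rewrite /N; apply: big1 => Q; have := no Q.
  by rewrite mulr0.
pose D Q := h (x1 Q) * (bracket Q + 12 * W Q * radial_theta (P1 Q))
  + dh Q * defect Q.
have E : 12 * (\sum_Q h (x1 Q) * W Q * radial_theta (P1 Q)) = \sum_Q D Q.
  rewrite -[LHS]addr0 -[X in _ + X]discrete_green mulr_sumr -big_split/=.
  by apply: eq_bigr => Q _; rewrite /D; ring.
have D0 Q : ~~ near2 Q -> D Q = 0.
  by move=> /far_terms[b0 d0 t0]; rewrite /D b0 d0 t0 !(mulr0, addr0).
have Dle Q : near2 Q -> `|D Q| <= 5772 * eps * H * W Q +
    558 * eps * (H^-1 * (c Q * dh Q ^+ 2) + H * W Q).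
  move=> n2; apply: le_trans (ler_normD _ _) _; rewrite !normrM; apply: lerD.
    have -> : 5772 * eps * H * W Q = H * (5772 * eps * W Q) by ring.
    by apply: ler_pM; [exact: normr_ge0|exact: normr_ge0|exact: hH|exact: bracket_le].
  apply: (@le_trans _ _ (`|dh Q| * (1116 * eps * nrm (f Q)))).
    by apply: ler_wpM2l; [exact: normr_ge0|exact: defect_le].
  have -> : `|dh Q| * (1116 * eps * nrm (f Q)) = 558 * eps * (2 * (`|dh Q| * nrm (f Q))) by ring.
  apply: ler_wpM2l; first by apply: mulr_ge0 eps0; exact: ler0n.
  have -> : H^-1 * (c Q * dh Q ^+ 2) + H * W Q =
     H^-1 * (c Q)^-1 * ((c Q * `|dh Q|) ^+ 2 + (H * nrm (f Q)) ^+ 2).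
    rewrite -[dh Q ^+ 2]real_normK ?num_real// /quad_weight -cVf; field.
    by rewrite !gt_eqF.
  have -> : 2 * (`|dh Q| * nrm (f Q)) =
     H^-1 * (c Q)^-1 * (2 * ((c Q * `|dh Q|) * (H * nrm (f Q)))).
    by field; rewrite !gt_eqF.
  apply: ler_wpM2l; first by apply: mulr_ge0; rewrite invr_ge0 ltW.
  rewrite -subr_ge0.
  have -> : (c Q * `|dh Q|) ^+ 2 + (H * nrm (f Q)) ^+ 2 - 2 * (c Q * `|dh Q| * (H * nrm (f Q)))
    = (c Q * `|dh Q| - H * nrm (f Q)) ^+ 2 by ring.
  exact: sqr_ge0.
have N2 : \sum_(Q | near2 Q) W Q <= N.
  rewrite /N [X in _ <= X](bigID near2)/=.
  rewrite [X in _ <= X + _](eq_bigl near2).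
    by rewrite lerDl; apply: sumr_ge0 => Q _; exact: ltW.
  by move=> Q; apply: andb_idl => h2; apply: le_trans h2 _; rewrite ler_nat.
have := ler_norm_sum_pred Dle D0; rewrite -E normrM normr_nat.
rewrite big_split/= -!mulr_sumr big_split/= -!mulr_sumr.
have := caccioppoli; rewrite -/N; set S := \sum_(Q | _) c Q * _ => SH.
have SH' : H^-1 * S <= H * N.
  rewrite -(ler_pM2l Hp) mulrA divff ?gt_eqF// mul1r; apply: le_trans SH _.
  by rewrite expr2 mulrA.
set M := \sum_(Q | _) _ in N2 *.
have h1 : 5772 * eps * H * M <= 5772 * eps * H * N.
  by apply: ler_wpM2l N2; apply: mulr_ge0 (ltW Hp); apply: mulr_ge0 eps0; exact: ler0n.
have h2 : 558 * eps * (H^-1 * S + H * M) <= 558 * eps * (2 * (H * N)).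
  apply: ler_wpM2l; first by apply: mulr_ge0 eps0; exact: ler0n.
  have MN : H * M <= H * N by apply: ler_wpM2l N2; exact: ltW.
  by rewrite mulr2n mulrDl mul1r; apply: lerD.
have h3 : 0 <= eps * H * N by apply: mulr_ge0 N0; apply: mulr_ge0 eps0 _; exact: ltW.
move=> hh; rewrite -(@ler_pM2l _ 12) ?ltr0n//; apply: le_trans hh _; apply: le_trans (lerD h1 h2) _.
have -> : 5772 * eps * H * N + 558 * eps * (2 * (H * N)) = 6888 * (eps * H * N) by ring.
have -> : 12 * (600 * eps * H * N) = 7200 * (eps * H * N) by ring.
by apply: ler_wpM2r h3 _ _ _; rewrite ler_nat.
Qed.

End OrthodiagonalNetwork.

Local Open Scope classical_set_scope.

(** * Plane topology *)

Section PlaneTopology.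
Variable R : realType.
Implicit Types (p q m : R * R) (A B K : set (R * R)).

(** Away from the frontier the closure and the interior of [A] agree, so [A] cuts [B] in a
    relatively clopen set. *)
Lemma connected_sub_frontier A B : connected B -> B `&` A !=set0 ->
  B `&` frontier A = set0 -> B `<=` A.
Proof.
move=> cB BA0 Bfr.
have Bcl p : B p -> closure A p -> A^° p.
  move=> Bp clp; apply: contrapT => np.
  by have : (B `&` frontier A) p by []; rewrite Bfr.
suff -> : B = B `&` A by move=> p [].
apply/esym/cB => //.
- exists A^°; first exact: open_interior.
  apply/seteqP; split => p [Bp Ap]; split => //.
    by apply: Bcl => //; exact: subset_closure.
  exact: interior_subset.
- exists (closure A); first exact: closed_closure.
  apply/seteqP; split => p [Bp Ap]; split => //; first exact: subset_closure.
  by apply: interior_subset; exact: Bcl.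
Qed.

Definition affine (a b c : R) p : R := a * p.1 + b * p.2 + c.

Lemma affine_continuous a b c : continuous (affine a b c).
Proof.
move=> p; rewrite /affine; apply: cvgD; last exact: cvg_cst.
apply: cvgD; apply: cvgM; (try exact: cvg_cst).
  exact: cvg_fst.
exact: cvg_snd.
Qed.

Lemma open_affine_gt0 a b c : open [set p | 0 < affine a b c p].
Proof.
apply: (@open_comp _ _ (affine a b c) [set x | 0 < x]); last exact: open_gt.
by move=> p _; exact: affine_continuous.
Qed.

Lemma near_affine_gt0 a b c m : 0 < affine a b c m ->
  \forall p \near m, 0 < affine a b c p.
Proof. by move=> h; apply: open_nbhs_nbhs; split; [exact: open_affine_gt0|]. Qed.

Lemma affine_conv a b c p q (t : R) :
  affine a b c ((1 - t) * p.1 + t * q.1, (1 - t) * p.2 + t * q.2) =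
  (1 - t) * affine a b c p + t * affine a b c q.
Proof. by rewrite /affine /=; ring. Qed.

Definition convex_set A := forall p q, A p -> A q -> seg p q `<=` A.

Lemma convex_setI A B : convex_set A -> convex_set B -> convex_set (A `&` B).
Proof. by move=> cA cB p q [Ap Bp] [Aq Bq] r pqr; split; [exact: (cA p q)|exact: (cB p q)]. Qed.

Lemma conv_gt0 (x y t : R) : 0 <= t <= 1 -> 0 < x -> 0 < y -> 0 < (1 - t) * x + t * y.
Proof.
move=> /andP[t0 t1] x0 y0; have [->|tn] := eqVneq t 0.
  by rewrite subr0 mul1r mul0r addr0.
rewrite ltr_wpDl//; first by rewrite mulr_ge0 ?subr_ge0// ltW.
by rewrite mulr_gt0// lt_neqAle eq_sym tn.
Qed.

Lemma convex_affine_gt0 a b c : convex_set [set p | 0 < affine a b c p].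
Proof.
move=> p q /= hp hq _ [t /= t01 <-]; rewrite /= affine_conv; apply: conv_gt0 => //.
Qed.

Lemma convex_affine_ge0 a b c : convex_set [set p | 0 <= affine a b c p].
Proof.
move=> p q /= hp hq _ [t /= t01 <-]; rewrite /= affine_conv.
move: t01; rewrite in_itv /= => /andP[t0 t1].
by rewrite addr_ge0// mulr_ge0// subr_ge0.
Qed.

Lemma seg_left p q : seg p q p.
Proof. by exists 0; rewrite /= ?in_itv/= ?lexx ?ler01// subr0 !mul1r !mul0r !addr0; case: p. Qed.

Lemma seg_right p q : seg p q q.
Proof. by exists 1; rewrite /= ?in_itv/= ?lexx ?ler01// subrr !mul1r !mul0r !add0r; case: q. Qed.

Lemma segC p q : seg p q = seg q p.
Proof.
suff h p' q' : seg p' q' `<=` seg q' p' by apply/seteqP; split; exact: h.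
move=> _ [t /= t01 <-]; exists (1 - t).
  by move: t01; rewrite /= !in_itv /= subr_ge0 gerBl andbC.
by congr pair; ring.
Qed.

Let seg_fun_continuous p q :
  continuous (fun t : R => ((1 - t) * p.1 + t * q.1, (1 - t) * p.2 + t * q.2)).
Proof.
have h (x y : R) : continuous (fun t : R => (1 - t) * x + t * y).
  move=> t; apply: cvgD; apply: cvgM; (try exact: cvg_cst); last exact: cvg_id.
  by apply: cvgB; [exact: cvg_cst|exact: cvg_id].
move=> t; exact: (cvg_pair (h p.1 q.1 t) (h p.2 q.2 t)).
Qed.

Lemma connected_seg p q : connected (seg p q).
Proof.
apply: connected_continuous_connected; first exact: segment_connected.
by apply: continuous_subspaceT; exact: seg_fun_continuous.
Qed.

Lemma closed_seg p q : closed (seg p q).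
Proof.
apply: compact_closed; first exact: norm_hausdorff.
apply: continuous_compact; last exact: segment_compact.
by apply: continuous_subspaceT; exact: seg_fun_continuous.
Qed.

Lemma convex_connected A : convex_set A -> connected A.
Proof.
move=> cA; have [->|/set0P[p Ap]] := eqVneq A set0; first exact: connected0.
have -> : A = \bigcup_(q in A) seg p q.
  apply/seteqP; split => q; first by move=> Aq; exists q => //; exact: seg_right.
  by move=> [r Ar]; exact: cA.
apply: bigcup_connected; last by move=> q _; exact: connected_seg.
by exists p => q _; exact: seg_left.
Qed.

Lemma plane_ballP m (r : R) p : ball m r p <-> `|m.1 - p.1| < r /\ `|m.2 - p.2| < r.
Proof. by []. Qed.

Lemma convex_ball m (r : R) : convex_set (ball m r).
Proof.
have h (x a b t : R) : 0 <= t <= 1 -> `|x - a| < r -> `|x - b| < r ->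
    `|x - ((1 - t) * a + t * b)| < r.
  move=> t01; rewrite !ltr_norml => /andP[a1 a2] /andP[b1 b2]; apply/andP; split.
    rewrite -subr_gt0; have -> : x - ((1 - t) * a + t * b) - - r =
      (1 - t) * (x - a + r) + t * (x - b + r) by ring.
    by apply: conv_gt0 => //; lra.
  rewrite -subr_gt0; have -> : r - (x - ((1 - t) * a + t * b)) =
      (1 - t) * (r - (x - a)) + t * (r - (x - b)) by ring.
  by apply: conv_gt0 => //; lra.
move=> p q /plane_ballP[p1 p2] /plane_ballP[q1 q2] _ [t /= t01 <-].
by apply/plane_ballP; split; apply: h => //; move: t01; rewrite in_itv.
Qed.

Lemma near_plane m A : (\forall p \near m, A p) ->
  exists2 r : R, 0 < r & ball m r `<=` A.
Proof. by move=> /nbhs_ballP[r r0 h]; exists r. Qed.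

Lemma closure_near A m : closure A m <-> forall r : R, 0 < r -> exists2 p, A p & ball m r p.
Proof.
split=> [clm r r0|h B /nbhs_ballP[r r0 rB]].
  by have [p [Ap mp]] := clm _ (nbhsx_ballx m r r0); exists p.
by have [p Ap mp] := h r r0; exists p; split => //; exact: rB.
Qed.

Lemma near_closed_out K m : closed K -> ~ K m -> \forall p \near m, ~ K p.
Proof. by move=> cK Km; apply: open_nbhs_nbhs; split => //; exact: closed_openC. Qed.

Lemma connected_component_eq K p q :
  connected_component K p q -> connected_component K p = connected_component K q.
Proof. by move=> /same_connected_component. Qed.

Definition ray p (v : R * R) : set (R * R) :=
  [set (p.1 + s * v.1, p.2 + s * v.2) | s in [set s | 0 <= s]].

Lemma ray_convex p v : convex_set (ray p v).
Proof.
move=> _ _ [s /= s0 <-] [s' /= s'0 <-] _ [t /= t01 <-] /=.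
move: t01; rewrite in_itv /= => /andP[t0 t1].
exists ((1 - t) * s + t * s') => /=; last by congr pair; ring.
by rewrite addr_ge0// mulr_ge0// subr_ge0.
Qed.

Lemma ray_start p v : ray p v p.
Proof. by exists 0; rewrite /= ?lexx// !mul0r !addr0; case: p. Qed.

Lemma bounded_planeP A : bounded_set A <->
  exists M : R, forall p, A p -> `|p.1| <= M /\ `|p.2| <= M.
Proof.
have nE p : `|p| = Num.max `|p.1| `|p.2| by [].
split=> [bA|[M hM]].
  have [M _ hM] := ex_strict_bound_gt0 bA; exists M => p Ap.
  have := hM p Ap; rewrite /= nE gt_max => /andP[h1 h2].
  by split; exact: ltW.
exists M; split; first exact: num_real.
by move=> M' MM' p /hM[h1 h2]; rewrite /= nE ge_max !(le_trans _ (ltW MM')).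
Qed.

Lemma ray_unbounded p (v : R * R) A : v != 0 -> ray p v `<=` A -> ~ bounded_set A.
Proof.
move=> v0 rA /bounded_planeP[M hM].
have w0 : `|v.1| + `|v.2| != 0.
  apply: contra v0; rewrite paddr_eq0// !normr_eq0 => /andP[/eqP h1 /eqP h2].
  by case: v h1 h2 {rA} => ? ? /= -> ->.
have w1 : 0 < `|v.1| + `|v.2| by rewrite lt_neqAle eq_sym w0 addr_ge0.
set s := (2 * `|M| + `|p.1| + `|p.2| + 1) / (`|v.1| + `|v.2|).
have s0 : 0 <= s by rewrite divr_ge0 ?addr_ge0 ?mulr_ge0// ltW.
have [] := hM (p.1 + s * v.1, p.2 + s * v.2); first by apply: rA; exists s.
move=> /= h1 h2.
have a1 : s * `|v.1| <= `|p.1 + s * v.1| + `|p.1|.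
  by rewrite -[s in s * _]ger0_norm// -normrM -{1}(addKr p.1 (s * v.1)) addrC -(normrN p.1) ler_normD.
have a2 : s * `|v.2| <= `|p.2 + s * v.2| + `|p.2|.
  by rewrite -[s in s * _]ger0_norm// -normrM -{1}(addKr p.2 (s * v.2)) addrC -(normrN p.2) ler_normD.
have : s * (`|v.1| + `|v.2|) = 2 * `|M| + `|p.1| + `|p.2| + 1 by rewrite divfK.
have := ler_norm M; rewrite mulrDr; lra.
Qed.

End PlaneTopology.

(** * Regions bounded by an orthodiagonal quadrilateral *)

Section AffineFunctions.
Variable R : realType.
Implicit Types (g : R * R -> R) (m p q : R * R).

Definition is_affine g := exists a b c, forall p, g p = affine a b c p.

Lemma is_affine_cst (k : R) : is_affine (fun=> k).
Proof. by exists 0, 0, k => p; rewrite /affine; ring. Qed.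

Lemma is_affineD g g' : is_affine g -> is_affine g' -> is_affine (fun p => g p + g' p).
Proof.
move=> [a [b [c h]]] [a' [b' [c' h']]]; exists (a + a'), (b + b'), (c + c') => p.
by rewrite h h' /affine; ring.
Qed.

Lemma is_affineZ (k : R) g : is_affine g -> is_affine (fun p => k * g p).
Proof.
move=> [a [b [c h]]]; exists (k * a), (k * b), (k * c) => p.
by rewrite h /affine; ring.
Qed.

Lemma is_affine_dot (p0 e : R * R) : is_affine (fun p => dot (p - p0) e).
Proof. by exists e.1, e.2, (- dot p0 e) => p; rewrite /affine /dot /=; ring. Qed.

Lemma is_affine_cross (p0 e : R * R) : is_affine (fun p => cross e (p - p0)).
Proof. by exists (- e.2), e.1, (- cross e p0) => p; rewrite /affine /cross /=; ring. Qed.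

Lemma convex_is_affine_gt0 g : is_affine g -> convex_set [set p | 0 < g p].
Proof.
move=> [a [b [c h]]]; rewrite (_ : [set p | _] = [set p | 0 < affine a b c p]).
  exact: convex_affine_gt0.
by apply/seteqP; split => p /=; rewrite h.
Qed.

Lemma convex_is_affine_ge0 g : is_affine g -> convex_set [set p | 0 <= g p].
Proof.
move=> [a [b [c h]]]; rewrite (_ : [set p | _] = [set p | 0 <= affine a b c p]).
  exact: convex_affine_ge0.
by apply/seteqP; split => p /=; rewrite h.
Qed.

Lemma near_is_affine_gt0 g m : is_affine g -> 0 < g m -> \forall p \near m, 0 < g p.
Proof.
move=> [a [b [c h]]]; rewrite h => /near_affine_gt0; apply: filterS => p.
by rewrite h.
Qed.

Lemma is_affine_conv g p q (t : R) : is_affine g ->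
  g ((1 - t) * p.1 + t * q.1, (1 - t) * p.2 + t * q.2) = (1 - t) * g p + t * g q.
Proof. by move=> [a [b [c h]]]; rewrite !h affine_conv. Qed.

Lemma is_affine_ray g p (v : R * R) (s : R) : is_affine g ->
  g (p.1 + s * v.1, p.2 + s * v.2) = g p + s * (g v - g 0).
Proof. by move=> [a [b [c h]]]; rewrite !h /affine /=; ring. Qed.

End AffineFunctions.

Section Kite.
Variables (R : realType) (p1 p2 w1 w2 : R * R).
Let e : R * R := p2 - p1.
Let f : R * R := w2 - w1.
Hypotheses (e0 : 0 < nrm e) (f0 : 0 < nrm f) (ef : dot e f = 0).

(** Coordinates along the diagonals in which every vertex lies on an axis: [p1 = (a, 0)],
    [p2 = (a + 1, 0)], [w1 = (0, c)], [w2 = (0, c + 1)]. *)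
Definition kite_x (p : R * R) : R := dot (p - w1) e / dot e e.
Definition kite_y (p : R * R) : R := dot (p - p1) f / dot f f.
Notation X := kite_x.
Notation Y := kite_y.

Let ee0 : dot e e != 0. Proof. by rewrite -nrm_sqr expf_neq0// gt_eqF. Qed.
Let ff0 : dot f f != 0. Proof. by rewrite -nrm_sqr expf_neq0// gt_eqF. Qed.

Lemma is_affine_kite_x : is_affine X.
Proof.
have [a [b [c h]]] := is_affineZ (dot e e)^-1 (is_affine_dot w1 e).
by exists a, b, c => p; rewrite -h /X mulrC.
Qed.

Lemma is_affine_kite_y : is_affine Y.
Proof.
have [a [b [c h]]] := is_affineZ (dot f f)^-1 (is_affine_dot p1 f).
by exists a, b, c => p; rewrite -h /Y mulrC.
Qed.

Let X1 : X w1 = 0. Proof. by rewrite /X subrr /dot /= !mul0r addr0 mul0r. Qed.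
Let fe : dot f e = 0. Proof. by rewrite -ef /dot; ring. Qed.
Let X2 : X w2 = 0. Proof. by rewrite /X -/f fe mul0r. Qed.
Let Y1 : Y p1 = 0. Proof. by rewrite /Y subrr /dot /= !mul0r addr0 mul0r. Qed.
Let Y2 : Y p2 = 0. Proof. by rewrite /Y -/e ef mul0r. Qed.
Let a := X p1.
Let c := Y w1.
Let Xp2 : X p2 = a + 1.
Proof.
rewrite -[1](divff ee0) /a /X -mulrDl; congr (_ / _).
by rewrite /e /dot /=; ring.
Qed.
Let Yw2 : Y w2 = c + 1.
Proof.
rewrite -[1](divff ff0) /c /Y -mulrDl; congr (_ / _).
by rewrite /f /dot /=; ring.
Qed.

Lemma kite_coord_inj p q : X p = X q -> Y p = Y q -> p = q.
Proof.
move=> /(mulIf (invr_neq0 ee0)) hx /(mulIf (invr_neq0 ff0)) hy.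
have he : dot (p - q) e = 0.
  have -> : dot (p - q) e = dot (p - w1) e - dot (q - w1) e by rewrite /dot /=; ring.
  by rewrite hx subrr.
have hf : dot (p - q) f = 0.
  have -> : dot (p - q) f = dot (p - p1) f - dot (q - p1) f by rewrite /dot /=; ring.
  by rewrite hy subrr.
have := dot_orthogonal_frame (p - q) ef; rewrite he hf expr0n !mul0r addr0.
move=> /esym/eqP; rewrite !mulf_eq0 (negPf ee0) (negPf ff0) !orbF => pq0.
apply/eqP; rewrite -subr_eq0; apply: contraT => /nrm_gt0.
by rewrite /nrm (eqP pq0) sqrtr0 ltxx.
Qed.

Lemma seg_kite (x w p : R * R) : Y x = 0 -> X w = 0 -> Y w != 0 ->
  seg x w p <-> 0 <= Y p / Y w <= 1 /\ X p = X x * (1 - Y p / Y w).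
Proof.
move=> Yx Xw Yw; split=> [[t /= t01 <-]|[/andP[h0 h1] hX]].
  rewrite !is_affine_conv ?Yx ?Xw; [|exact: is_affine_kite_x|exact: is_affine_kite_y].
  rewrite !mulr0 add0r addr0 mulfK//; split; last by rewrite mulrC.
  by move: t01; rewrite in_itv.
exists (Y p / Y w) => /=; first by rewrite in_itv /= h0.
apply: kite_coord_inj; rewrite is_affine_conv.
- by rewrite Xw mulr0 addr0 mulrC.
- exact: is_affine_kite_x.
- by rewrite Yx mulr0 add0r divfK.
- exact: is_affine_kite_y.
Qed.

(** The line [p1 p2] separates [w1] from [w2], so this diagonal cuts the quadrilateral into two
    triangles with apexes [w1] and [w2]. The free value of [a] allows a reflex angle at [p1] or
    [p2]. *)
Hypothesis split : -1 < c < 0.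
Let d := c + 1.
Let c0 : c < 0. Proof. by case/andP: split. Qed.
Let d0 : 0 < d. Proof. by rewrite /d; case/andP: split => h _; rewrite -ltrBlDr sub0r. Qed.

(* The line at height [y] along the diagonal [w1 w2] meets the quadrilateral, possibly
   non-convex, in a segment [kite_tau y] times as long as the diagonal [p1 p2]. *)
Definition kite_tau (y : R) : R := if 0 <= y then 1 - y / (Y w1 + 1) else 1 - y / Y w1.
Notation tau := kite_tau.

Definition kite_interior : set (R * R) :=
  [set p | X p1 * tau (Y p) < X p < (X p1 + 1) * tau (Y p)].

Definition kite_boundary : set (R * R) :=
  seg p1 w1 `|` seg p2 w1 `|` seg p2 w2 `|` seg p1 w2.

Let tauE0 : tau 0 = 1. Proof. by rewrite /tau lexx mul0r subr0. Qed.
Let tau_up y : 0 <= y -> tau y = 1 - y / d. Proof. by rewrite /tau => ->. Qed.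
Let tau_down y : y <= 0 -> tau y = 1 - y / c.
Proof.
rewrite le_eqVlt => /orP[/eqP ->|y0]; first by rewrite tauE0 mul0r subr0.
by rewrite /tau leNgt y0.
Qed.
Let div_up y : (0 <= y / d) = (0 <= y).
Proof. by rewrite pmulr_lge0// invr_gt0. Qed.
Let div_down y : (0 <= y / c) = (y <= 0).
Proof. by rewrite nmulr_lge0// invr_lt0. Qed.

Lemma kite_boundaryE p : kite_boundary p <->
  0 <= tau (Y p) /\ (X p = a * tau (Y p) \/ X p = (a + 1) * tau (Y p)).
Proof.
have cn : Y w1 != 0 by rewrite lt_eqF.
have dn : Y w2 != 0 by rewrite Yw2 gt_eqF.
have S11 := seg_kite p Y1 X1 cn; have S12 := seg_kite p Y1 X2 dn.
have S21 := seg_kite p Y2 X1 cn; have S22 := seg_kite p Y2 X2 dn.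
rewrite Yw2 -/d -/c Xp2 -/a ?div_up ?div_down in S11 S12 S21 S22.
split=> [[[[/S11|/S21]|/S22]|/S12] [/andP[h0 h1] ->]|[h0]].
- by rewrite tau_down// subr_ge0; split => //; left.
- by rewrite tau_down// subr_ge0; split => //; right.
- by rewrite tau_up// subr_ge0; split => //; right.
- by rewrite tau_up// subr_ge0; split => //; left.
case: (lerP 0 (Y p)) => [y0|/ltW y0]; rewrite ?(tau_up y0) ?(tau_down y0) in h0 *.
  rewrite subr_ge0 in h0.
  by move=> [h|h]; [right; apply/S12|left; right; apply/S22]; rewrite y0 h0.
rewrite subr_ge0 in h0.
by move=> [h|h]; do 2 left; [left; apply/S11|right; apply/S21]; rewrite y0 h0.
Qed.

Lemma kite_interior_tau p : kite_interior p -> 0 < tau (Y p).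
Proof. by move=> /andP[h1 h2]; have := lt_trans h1 h2; rewrite mulrDl mul1r ltrDl. Qed.

Let is_affine_sub (b k : R) : is_affine (fun p => X p - b * (1 - Y p / k)).
Proof.
have h1 := is_affineD is_affine_kite_x (is_affineD (is_affine_cst (- b))
  (is_affineZ (b / k) is_affine_kite_y)).
by move: h1 => [u [v [w h]]]; exists u, v, w => p; rewrite -h; ring.
Qed.

Let is_affine_opp g : is_affine g -> is_affine (fun p : R * R => - g p).
Proof.
move=> /(is_affineZ (- 1))[u [v [w h]]]; exists u, v, w => p.
by rewrite -h mulN1r.
Qed.

Let convex_strip k : convex_set [set p | a * (1 - Y p / k) < X p < (a + 1) * (1 - Y p / k)].
Proof.
rewrite (_ : [set p | _] = [set p | 0 < X p - a * (1 - Y p / k)] `&`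
    [set p | 0 < - (X p - (a + 1) * (1 - Y p / k))]).
  by apply: convex_setI; apply: convex_is_affine_gt0 => //; exact: is_affine_opp.
apply/seteqP; split => p /=; rewrite oppr_gt0 subr_gt0 subr_lt0.
  by move=> /andP[].
by move=> [-> ->].
Qed.

Lemma kite_interior_connected : connected kite_interior.
Proof.
have -> : kite_interior =
    ([set p | a * (1 - Y p / d) < X p < (a + 1) * (1 - Y p / d)] `&` [set p | 0 <= Y p]) `|`
    ([set p | a * (1 - Y p / c) < X p < (a + 1) * (1 - Y p / c)] `&` [set p | 0 <= - Y p]).
  apply/seteqP; split => p.
    rewrite /kite_interior /=; case: (lerP 0 (Y p)) => [y0|/ltW y0].
      by rewrite tau_up//; left.
    by rewrite tau_down// oppr_ge0; right.
  move=> [[/= h y0]|[/= h]]; rewrite /kite_interior/=; first by rewrite tau_up.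
  by rewrite oppr_ge0 => y0; rewrite tau_down.
apply: connectedU.
- pose m := ((1 - 2^-1) * p1.1 + 2^-1 * p2.1, (1 - 2^-1) * p1.2 + 2^-1 * p2.2).
  have Ym : Y m = 0.
    by rewrite is_affine_conv ?Y1 ?Y2; [rewrite !mulr0 addr0|exact: is_affine_kite_y].
  have Xm : X m = a + 2^-1.
    by rewrite is_affine_conv ?Xp2 -/a; [field|exact: is_affine_kite_x].
  have Im (k : R) : a * (1 - 0 / k) < a + 2^-1 < (a + 1) * (1 - 0 / k).
    by rewrite mul0r subr0 !mulr1; split_lra.
  by exists m; split; split; rewrite /= ?Ym ?Xm ?oppr0 ?lexx.
- apply: convex_connected; apply: convex_setI; first exact: convex_strip.
  by apply: convex_is_affine_ge0; exact: is_affine_kite_y.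
- apply: convex_connected; apply: convex_setI; first exact: convex_strip.
  by apply: convex_is_affine_ge0; apply: is_affine_opp; exact: is_affine_kite_y.
Qed.

(** Where [tau] is negative, the ray along [f] away from the diagonal [p1 p2] works, because [tau]
    only decreases on it. Elsewhere [p] lies beyond one end of its slice, and a ray along [e] or
    [- e] keeps its height while moving away from the slice. *)
Lemma kite_escape p : ~ kite_interior p -> ~ kite_boundary p ->
  exists2 v : R * R, v != 0 & ray p v `&` kite_boundary = set0.
Proof.
have Xv v s : X (p.1 + s * v.1, p.2 + s * v.2) = X p + s * (dot v e / dot e e).
  rewrite is_affine_ray; last exact: is_affine_kite_x.
  by congr (_ + _ * _); rewrite /X -mulrBl; congr (_ / _); rewrite /dot /=; ring.
have Yv v s : Y (p.1 + s * v.1, p.2 + s * v.2) = Y p + s * (dot v f / dot f f).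
  rewrite is_affine_ray; last exact: is_affine_kite_y.
  by congr (_ + _ * _); rewrite /Y -mulrBl; congr (_ / _); rewrite /dot /=; ring.
have nz (v : R * R) : 0 < nrm v -> v != 0.
  by apply: contraTneq => ->; rewrite /nrm /dot !mul0r addr0 sqrtr0 ltxx.
have Ne v w : dot (- v) w = - dot v w :> R by rewrite /dot /=; ring.
move=> nI nC; have [tneg|tpos] := ltP (tau (Y p)) 0.
  have [y0|/ltW y0] := lerP 0 (Y p).
    exists f; first exact: nz.
    apply/seteqP; split => // _ [[s s0 <-]] /kite_boundaryE[]; have {}s0 : 0 <= s := s0.
    have ys : 0 <= Y p + s by rewrite addr_ge0.
    rewrite Yv divff// mulr1 (tau_up ys) subr_ge0 => h.
    move: tneg; rewrite tau_up// subr_lt0 ltNge => /negP[].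
    by apply: le_trans h; rewrite ler_pM2r ?invr_gt0// lerDl.
  exists (- f); first by rewrite nz// nrmN.
  apply/seteqP; split => // _ [[s s0 <-]] /kite_boundaryE[]; have {}s0 : 0 <= s := s0.
  have ys : Y p - s <= 0 by rewrite subr_le0 (le_trans y0).
  rewrite Yv Ne mulNr divff// mulrN1 (tau_down ys) subr_ge0 => h.
  move: tneg; rewrite tau_down// subr_lt0 ltNge => /negP[].
  by apply: le_trans h; rewrite ler_nM2r ?invr_lt0// gerBl.
have bnd : X p < a * tau (Y p) \/ (a + 1) * tau (Y p) < X p.
  have [h1|h1] := ltP (X p) (a * tau (Y p)); first by left.
  have [h2|h2] := ltP ((a + 1) * tau (Y p)) (X p); first by right.
  exfalso; have [h3|h3] := eqVneq (X p) (a * tau (Y p)).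
    by apply: nC; apply/kite_boundaryE; split => //; left.
  have [h4|h4] := eqVneq (X p) ((a + 1) * tau (Y p)).
    by apply: nC; apply/kite_boundaryE; split => //; right.
  by apply: nI; rewrite /kite_interior /= !lt_neqAle h1 h2 eq_sym h3 h4.
have ineq : a * tau (Y p) <= (a + 1) * tau (Y p) by rewrite mulrDl mul1r lerDl.
case: bnd => hX.
  exists (- e); first by rewrite nz// nrmN.
  apply/seteqP; split => // _ [[s s0 <-]] /kite_boundaryE[_]; have {}s0 : 0 <= s := s0.
  rewrite Xv Yv !Ne ef oppr0 mul0r mulr0 addr0 mulNr divff// mulrN1.
  by move=> [h|h]; lra.
exists e; first exact: nz.
apply/seteqP; split => // _ [[s s0 <-]] /kite_boundaryE[_]; have {}s0 : 0 <= s := s0.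
rewrite Xv Yv ef mul0r mulr0 addr0 divff// mulr1.
by move=> [h|h]; lra.
Qed.

(** Escaping rays stand in for the Jordan curve theorem: a point of [F] outside the kite would drag
    a whole ray into the bounded set [F]. Conversely the kite is connected, meets [F] and misses its
    frontier. *)
Lemma kite_regionE (F : set (R * R)) : F !=set0 -> bounded_set F ->
  F `&` kite_boundary = set0 -> frontier F = kite_boundary -> F = kite_interior.
Proof.
move=> [p0 Fp0] bF FC frF.
have FI : F `<=` kite_interior.
  move=> p Fp; apply: contrapT => nI.
  have nC : ~ kite_boundary p by move=> Cp; have : (F `&` kite_boundary) p by []; rewrite FC.
  have [v v0 rC] := kite_escape nI nC.
  apply: (ray_unbounded v0 _ bF).
  apply: connected_sub_frontier.
  - by apply: convex_connected; exact: ray_convex.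
  - by exists p; split => //; exact: ray_start.
  - by rewrite frF.
apply/seteqP; split => //; apply: connected_sub_frontier.
- exact: kite_interior_connected.
- by exists p0; split => //; exact: FI.
rewrite frF; apply/seteqP; split => // p [/andP[h1 h2] /kite_boundaryE[_ [h|h]]].
  by rewrite -h ltxx in h1.
by rewrite -h ltxx in h2.
Qed.

Let near_side (x w m : R * R) : Y x = 0 -> X w = 0 -> (Y w = c \/ Y w = d) ->
  seg x w m -> m <> x -> \forall q \near m, 0 < Y q / Y w.
Proof.
move=> Yx Xw Yw sm mx.
have Yw0 : Y w != 0 by case: Yw => ->; [rewrite lt_eqF|rewrite gt_eqF].
have /(seg_kite m Yx Xw Yw0)[/andP[h0 h1] hX] := sm.
have af : is_affine (fun q => Y q / Y w).
  have [u [v [z h]]] := is_affineZ (Y w)^-1 is_affine_kite_y.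
  by exists u, v, z => q; rewrite -h mulrC.
apply: (near_is_affine_gt0 af); rewrite lt_neqAle h0 andbT eq_sym.
apply/eqP => h2; apply: mx; apply: kite_coord_inj.
  by rewrite hX h2 subr0 mulr1.
by rewrite Yx; move/eqP: h2; rewrite mulf_eq0 invr_eq0 (negPf Yw0) orbF => /eqP.
Qed.

Let side_cross (x w q : R * R) : Y x = 0 -> X w = 0 -> Y w != 0 ->
  cross (w - x) (q - x) = - (Y w * cross e f) * (X q - X x * (1 - Y q / Y w)).
Proof.
move=> Yx Xw Yw.
have cc : cross e f ^+ 2 = dot e e * dot f f.
  by rewrite -!nrm_sqr -exprMn -dot_cross_sqr ef expr0n add0r.
have dX (u v : R * R) : dot (u - v) e = (X u - X v) * dot e e.
  by rewrite /X -mulrBl divfK//; rewrite /dot /=; ring.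
have dY (u v : R * R) : dot (u - v) f = (Y u - Y v) * dot f f.
  by rewrite /Y -mulrBl divfK//; rewrite /dot /=; ring.
apply: (mulIf (cross_neq0 e0 f0 ef)).
have -> : cross (w - x) (q - x) * cross e f =
    dot (w - x) e * dot (q - x) f - dot (w - x) f * dot (q - x) e by rewrite /dot /cross; ring.
rewrite (dX w) (dX q) (dY w) (dY q) Yx Xw.
transitivity (- (Y w * (X q - X x * (1 - Y q / Y w))) * cross e f ^+ 2); last by ring.
by rewrite cc; field.
Qed.

Let tauw (w q : R * R) : (Y w = c \/ Y w = d) -> 0 < Y q / Y w -> tau (Y q) = 1 - Y q / Y w.
Proof.
move=> [->|->] h; first by rewrite tau_down// -div_down ltW.
by rewrite tau_up// -div_up ltW.
Qed.

Let kw1 : Y w1 = c \/ Y w1 = d. Proof. by left. Qed.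
Let kw2 : Y w2 = c \/ Y w2 = d. Proof. by right. Qed.
Let cross0 : cross e f != 0. Proof. exact: cross_neq0. Qed.
Let kw1n : Y w1 != 0. Proof. by rewrite lt_eqF. Qed.
Let kw2n : Y w2 != 0. Proof. by rewrite Yw2 gt_eqF. Qed.

Let sgN (k A : R) : 0 < k * A -> - (k * cross e f) * A * cross e f < 0.
Proof.
have -> : - (k * cross e f) * A * cross e f = - (k * A * cross e f ^+ 2) by ring.
by move=> kA; rewrite oppr_lt0; apply: mulr_gt0; rewrite // exprn_even_gt0.
Qed.

Let sgP (k A : R) : k * A < 0 -> 0 < - (k * cross e f) * A * cross e f.
Proof.
have -> : - (k * cross e f) * A * cross e f = - (k * A) * cross e f ^+ 2 by ring.
by move=> kA; apply: mulr_gt0; rewrite ?oppr_gt0// exprn_even_gt0.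
Qed.

(** Near a point of a side other than its end on the diagonal [p1 p2], only the triangle whose apex
    is on that side is seen. There one of the two inequalities of [kite_interior] is the half-plane
    bounded by the side, which [side_cross] rewrites as a cross product. *)
Lemma kite_side m : [/\
  seg p1 w1 m -> m <> p1 -> \forall q \near m, kite_interior q ->
     0 < cross (w1 - p1) (q - p1) * cross e f,
  seg p1 w2 m -> m <> p1 -> \forall q \near m, kite_interior q ->
     cross (w2 - p1) (q - p1) * cross e f < 0,
  seg p2 w1 m -> m <> p2 -> \forall q \near m, kite_interior q ->
     cross (w1 - p2) (q - p2) * cross e f < 0 &
  seg p2 w2 m -> m <> p2 -> \forall q \near m, kite_interior q ->
     0 < cross (w2 - p2) (q - p2) * cross e f].
Proof.
split=> sm mx.
- have := near_side Y1 X1 kw1 sm mx; apply: filterS => q h /andP[].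
  rewrite (tauw kw1 h) side_cross// -/a => h1 h2.
  by apply: sgP; rewrite nmulr_rlt0// subr_gt0.
- have := near_side Y1 X2 kw2 sm mx; apply: filterS => q h /andP[].
  rewrite (tauw kw2 h) side_cross// -/a => h1 h2.
  by apply: sgN; rewrite pmulr_rgt0 ?subr_gt0// Yw2.
- have := near_side Y2 X1 kw1 sm mx; apply: filterS => q h /andP[].
  rewrite (tauw kw1 h) side_cross// Xp2 -/a => h1 h2.
  by apply: sgN; rewrite nmulr_rgt0// subr_lt0.
- have := near_side Y2 X2 kw2 sm mx; apply: filterS => q h /andP[].
  rewrite (tauw kw2 h) side_cross// Xp2 -/a => h1 h2.
  by apply: sgP; rewrite pmulr_rlt0 ?subr_lt0// Yw2.
Qed.

(** A point of the triangle with apex [w] is [p1 + lam (w - p1) + mu e] with [0 <= lam] and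
    [0 < mu <= 1 - lam], while [nrm e <= 2 * eps]. *)
Lemma kite_interior_le (eps : R) p : nrm (w1 - p1) <= eps -> nrm (w2 - p1) <= eps ->
  nrm (w1 - p2) <= eps -> kite_interior p -> nrm (p - p1) <= 2 * eps.
Proof.
move=> l11 l12 l21 Ip; have t0 := kite_interior_tau Ip.
have eps0 : 0 <= eps by apply: le_trans l11; exact: nrm_ge0.
have le : nrm e <= 2 * eps.
  have -> : e = (w1 - p1) - (w1 - p2) by rewrite /e opprB [RHS]addrC addrA subrK.
  by apply: le_trans (ler_nrmD _ _) _; rewrite nrmN; lra.
have [w [Yw lw Xw]] : exists w, [/\ tau (Y p) = 1 - Y p / Y w /\ 0 <= Y p / Y w, nrm (w - p1) <= eps & X w = 0 /\ Y w != 0].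
  have [y0|/ltW y0] := lerP 0 (Y p).
    by exists w2; rewrite Yw2 -/d div_up tau_up//; do ?split => //; rewrite gt_eqF.
  by exists w1; rewrite -/c div_down tau_down//; do ?split => //; rewrite lt_eqF.
case: Yw => Yw lam0; case: Xw => Xw Yw0; move: Ip => /andP[]; rewrite Yw.
set lam := Y p / Y w in Yw lam0 * => h1 h2; rewrite Yw in t0.
pose mu := X p - a * (1 - lam).
have -> : p - p1 = lam *: (w - p1) + mu *: e.
  apply: (addIr p1); rewrite subrK; symmetry.
  apply: kite_coord_inj.
    rewrite /X.
    have -> : dot (lam *: (w - p1) + mu *: e + p1 - w1) e =
      lam * (dot (w - w1) e - dot (p1 - w1) e) + mu * dot e e + dot (p1 - w1) e.
      rewrite /dot /= /GRing.scale /=; ring.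
    apply: (@eq_trans _ _ (lam * (X w - X p1) + mu + X p1)); first by rewrite /X; field.
    by rewrite Xw -/a /mu -/(X p); ring.
  rewrite /Y.
  have -> : dot (lam *: (w - p1) + mu *: e + p1 - p1) f =
      lam * dot (w - p1) f + mu * dot e f.
      rewrite /dot /= /GRing.scale /=; ring.
  by rewrite ef mulr0 addr0 -mulrA -/(Y w) -/(Y p) /lam divfK.
apply: le_trans (ler_nrmD _ _) _; rewrite !nrmZ.
have mu0 : 0 < mu by rewrite subr_gt0.
have mu1 : mu <= 1 - lam by rewrite lerBlDr -[X in X + _]mul1r -mulrDl addrC ltW.
rewrite !ger0_norm//; last exact: ltW.
have h3 : lam * nrm (w - p1) <= lam * eps by rewrite ler_wpM2l.
have h4 : mu * nrm e <= (1 - lam) * (2 * eps).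
  by apply: ler_pM => //; [exact: ltW|exact: nrm_ge0].
have : 0 <= lam * eps by rewrite mulr_ge0.
lra.
Qed.

End Kite.

(** * Faces of an orthodiagonal map *)

Section KiteCrossing.
Variable R : realType.

(** In diagonal coordinates both pairs lie on half-axes, [x] and [w] being the points closer to the
    origin. Each of the two segments joins a closer point to a farther one, so they cross. *)
Lemma opposite_edges_meet (p1 p2 w1 w2 x x' w w' : R * R) (s r A B : R) :
  0 < nrm (p2 - p1) -> 0 < nrm (w2 - w1) -> dot (p2 - p1) (w2 - w1) = 0 ->
  0 <= A -> 0 <= B ->
  kite_y p1 w1 w2 x = 0 -> kite_y p1 w1 w2 x' = 0 ->
  kite_x p1 p2 w1 w = 0 -> kite_x p1 p2 w1 w' = 0 ->
  kite_x p1 p2 w1 x = s * A -> kite_x p1 p2 w1 x' = s * (A + 1) ->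
  kite_y p1 w1 w2 w = r * B -> kite_y p1 w1 w2 w' = r * (B + 1) ->
  exists m, seg x w' m /\ seg x' w m.
Proof.
move=> e0 f0 ef A0 B0 Yx Yx' Xw Xw' Xx Xx' Yw Yw'.
have S0 : 0 < A + B + 1 by rewrite ltr_wpDl ?addr_ge0.
have mem (t : R) : 0 <= t -> t <= A + B + 1 -> `[0, 1]%classic (t / (A + B + 1)).
  by move=> t0 t1; rewrite /= in_itv /= divr_ge0 ?(ltW S0)//= ler_pdivrMr// mul1r.
have t01 : `[0, 1]%classic (B / (A + B + 1)) by apply: mem; lra.
have t01' : `[0, 1]%classic ((B + 1) / (A + B + 1)) by apply: mem; lra.
eexists; split; first by exists (B / (A + B + 1)).
exists ((B + 1) / (A + B + 1)) => //.
have Sn : A + B + 1 != 0 by rewrite gt_eqF.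
have hx := is_affine_kite_x p1 p2 w1; have hy := is_affine_kite_y p1 w1 w2.
apply: (kite_coord_inj e0 f0 ef); rewrite !is_affine_conv//.
  by rewrite Xx Xx' Xw Xw'; field.
by rewrite Yx Yx' Yw Yw'; field.
Qed.

End KiteCrossing.

Section Drawing.
Variables (R : realType) (G : orthodiagonal_map R).
Implicit Types (x y : primal G) (u v w : dual G) (Q : quad G).
Notation D := (drawing_set G).

Lemma vpos_inj : injective (@vpos R G). Proof. by case: (od_plane G). Qed.

Lemma vertex_on_edge x u z : adj x u -> edge_seg x u (vpos z) -> z = inl x \/ z = inr u.
Proof. by case: (od_plane G) => _ h _; exact: h. Qed.

Lemma edges_meet x u y w p : adj x u -> adj y w -> edge_seg x u p -> edge_seg y w p ->
  (x = y /\ u = w) \/ exists z, @vpos R G z = p.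
Proof. by case: (od_plane G) => _ _ h; exact: h. Qed.

Lemma ppos_inj : injective (@ppos R G).
Proof. by move=> x y h; have /vpos_inj[] : @vpos R G (inl x) = vpos (inl y). Qed.

Lemma dpos_inj : injective (@dpos R G).
Proof. by move=> x y h; have /vpos_inj[] : @vpos R G (inr x) = vpos (inr y). Qed.

Lemma ppos_dpos x u : ppos x <> dpos u.
Proof.
move=> h; have /vpos_inj : @vpos R G (inl x) = vpos (inr u) by [].
by [].
Qed.

Definition qe Q := ppos (qp2 Q) - ppos (qp1 Q).
Definition qf Q := dpos (qd2 Q) - dpos (qd1 Q).

Lemma qe_gt0 Q : 0 < nrm (qe Q).
Proof.
apply: nrm_gt0; rewrite subr_eq0; apply/eqP => /ppos_inj.
by have [/nesym h _] := od_quad_distinct Q.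
Qed.

Lemma qf_gt0 Q : 0 < nrm (qf Q).
Proof.
apply: nrm_gt0; rewrite subr_eq0; apply/eqP => /dpos_inj.
by have [_ /nesym h] := od_quad_distinct Q.
Qed.

Lemma qe_qf Q : dot (qe Q) (qf Q) = 0.
Proof. exact: od_quad_orthogonal. Qed.

Lemma qf_qe Q : dot (qf Q) (qe Q) = 0.
Proof. by rewrite -(qe_qf Q) /dot; ring. Qed.

Lemma quad_adj Q : [/\ adj (qp1 Q) (qd1 Q), adj (qp2 Q) (qd1 Q),
  adj (qp2 Q) (qd2 Q) & adj (qp1 Q) (qd2 Q)].
Proof. by have := od_quad_adj Q => /and4P. Qed.

Lemma opposite_disjoint x y u w p : x <> y -> u <> w -> adj x u -> adj y w ->
  edge_seg x u p -> edge_seg y w p -> False.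
Proof.
move=> xy uw xu yw px py; have [[]//|[z zp]] := edges_meet xu yw px py.
rewrite -zp in px py.
by have [h|h] := vertex_on_edge xu px; have [] := vertex_on_edge yw py; rewrite h => -[].
Qed.

Let Yp Q := kite_y (ppos (qp1 Q)) (dpos (qd1 Q)) (dpos (qd2 Q)).
Let Xp Q := kite_x (ppos (qp1 Q)) (ppos (qp2 Q)) (dpos (qd1 Q)).

(** If neither diagonal crosses the line of the other, the four vertices lie on two half-axes and
    two opposite edges meet, against planarity. The four cases are the choices of half-axes. *)
Lemma quad_split Q : -1 < Yp Q (dpos (qd1 Q)) < 0 \/ -1 < Xp Q (ppos (qp1 Q)) < 0.
Proof.
have e0 := qe_gt0 Q; have f0 := qf_gt0 Q; have ef := qe_qf Q.
have ee0 : dot (qe Q) (qe Q) != 0 by rewrite -nrm_sqr expf_neq0// gt_eqF.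
have ff0 : dot (qf Q) (qf Q) != 0 by rewrite -nrm_sqr expf_neq0// gt_eqF.
set p1 := ppos (qp1 Q); set p2 := ppos (qp2 Q).
set w1 := dpos (qd1 Q); set w2 := dpos (qd2 Q).
set c := Yp Q w1; set a := Xp Q p1.
have X1 : Xp Q w1 = 0 by rewrite /Xp /kite_x subrr /dot /= !mul0r addr0 mul0r.
have X2 : Xp Q w2 = 0 by rewrite /Xp /kite_x -/(qf Q) qf_qe mul0r.
have Y1 : Yp Q p1 = 0 by rewrite /Yp /kite_y subrr /dot /= !mul0r addr0 mul0r.
have Y2 : Yp Q p2 = 0 by rewrite /Yp /kite_y -/(qe Q) qe_qf mul0r.
have Xp2 : Xp Q p2 = a + 1.
  rewrite -[1](divff ee0) /a /Xp /kite_x -mulrDl; congr (_ / _).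
  by rewrite /qe /dot /=; ring.
have Yw2 : Yp Q w2 = c + 1.
  rewrite -[1](divff ff0) /c /Yp /kite_y -mulrDl; congr (_ / _).
  by rewrite /qf /dot /=; ring.
have [a1 a2 a3 a4] := quad_adj Q; have [dp dd] := od_quad_distinct Q.
have [hc|hc] := boolP (-1 < c < 0); first by left.
have [ha|ha] := boolP (-1 < a < 0); first by right.
exfalso.
have {}hc : 0 <= c \/ c <= -1.
  by move: hc; rewrite negb_and -!leNgt => /orP[]; [right|left].
have {}ha : 0 <= a \/ a <= -1.
  by move: ha; rewrite negb_and -!leNgt => /orP[]; [right|left].
case: ha hc => [ha|ha] [hc|hc].
- have [||||m [m1 m2]] := @opposite_edges_meet R p1 p2 w1 w2 p1 p2 w1 w2 1 1 a c e0 f0 ef ha hc Y1 Y2 X1 X2;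
    rewrite ?mul1r//.
  exact: (opposite_disjoint dp (nesym dd) a4 a2 m1 m2).
- have hc' : 0 <= - c - 1 by lra.
  have [||||m [m1 m2]] := @opposite_edges_meet R p1 p2 w1 w2 p1 p2 w2 w1 1 (-1) a (- c - 1) e0 f0 ef ha hc' Y1 Y2 X2 X1;
    rewrite ?mul1r//.
  + by rewrite -/(Yp Q w2) Yw2; ring.
  + by rewrite -/(Yp Q w1) -/c; ring.
  exact: (opposite_disjoint dp dd a1 a3 m1 m2).
- have ha' : 0 <= - a - 1 by lra.
  have [||||m [m1 m2]] := @opposite_edges_meet R p1 p2 w1 w2 p2 p1 w1 w2 (-1) 1 (- a - 1) c e0 f0 ef ha' hc Y2 Y1 X1 X2;
    rewrite ?mul1r//.
  + by rewrite -/(Xp Q p2) Xp2; ring.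
  + by rewrite -/(Xp Q p1) -/a; ring.
  exact: (opposite_disjoint (nesym dp) (nesym dd) a3 a1 m1 m2).
- have ha' : 0 <= - a - 1 by lra. have hc' : 0 <= - c - 1 by lra.
  have [||||m [m1 m2]] := @opposite_edges_meet R p1 p2 w1 w2 p2 p1 w2 w1 (-1) (-1) (- a - 1) (- c - 1) e0 f0 ef ha' hc' Y2 Y1 X2 X1.
  + by rewrite -/(Xp Q p2) Xp2; ring.
  + by rewrite -/(Xp Q p1) -/a; ring.
  + by rewrite -/(Yp Q w2) Yw2; ring.
  + by rewrite -/(Yp Q w1) -/c; ring.
  exact: (opposite_disjoint (nesym dp) dd a2 a4 m1 m2).
Qed.

Lemma edge_sub_drawing x u : adj x u -> edge_seg x u `<=` D.
Proof. by move=> xu p px; right; exists x, u. Qed.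

Lemma closed_drawing : closed D.
Proof.
have -> : D = (\bigcup_(z in [set: primal G + dual G]) [set vpos z]) `|`
   \bigcup_(xu in [set xu : primal G * dual G | adj xu.1 xu.2]) edge_seg xu.1 xu.2.
  apply/seteqP; split => p.
    move=> [[z <-]|[x [u [xu px]]]]; [left|right]; first by exists z.
    by exists (x, u).
  by move=> [[z _ ->]|[[x u] /= xu px]]; [left|right]; [exists z|exists x, u].
apply: closedU; apply: closed_bigcup.
- exact: finite_finset.
- move=> z _; apply: compact_closed; [exact: norm_hausdorff|exact: compact_set1].
- exact: finite_finset.
- by move=> xu _; exact: closed_seg.
Qed.

Lemma region_face Q : inner_face G (region Q).
Proof. by have : range (@region _ G) (region Q) by [exists Q]; rewrite od_region_faces. Qed.

Lemma region_component Q p : region Q p -> region Q = connected_component (~` D) p.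
Proof.
have [[p0 _ ->] _] := region_face Q => h.
exact: connected_component_eq.
Qed.

Lemma region_nonempty Q : region Q !=set0.
Proof.
have [[p0 h ->] _] := region_face Q; exists p0.
exact: connected_component_refl.
Qed.

Lemma region_bounded Q : bounded_set (region Q).
Proof. by have [] := region_face Q. Qed.

Lemma region_off_drawing Q p : region Q p -> ~ D p.
Proof.
by have [[p0 h ->] _] := region_face Q => /connected_component_sub.
Qed.

Lemma region_inj_meet Q Q' p : region Q p -> region Q' p -> Q = Q'.
Proof.
by move=> h h'; apply: od_region_inj; rewrite (region_component h) (region_component h').
Qed.

Lemma connected_sub_region Q (A : set (R * R)) p : connected A -> A `<=` ~` D ->
  A p -> region Q p -> A `<=` region Q.
Proof.
move=> cA AD Ap Qp; rewrite (region_component Qp).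
exact: connected_component_max.
Qed.

Let kiteb Q := kite_boundary (ppos (qp1 Q)) (ppos (qp2 Q)) (dpos (qd1 Q)) (dpos (qd2 Q)).
Let kiteb' Q := kite_boundary (dpos (qd1 Q)) (dpos (qd2 Q)) (ppos (qp1 Q)) (ppos (qp2 Q)).

Let kiteb_swap Q : kiteb' Q = kiteb Q.
Proof.
rewrite /kiteb' /kiteb /kite_boundary.
rewrite (segC (dpos (qd1 Q)) (ppos (qp1 Q))) (segC (dpos (qd2 Q)) (ppos (qp1 Q))).
rewrite (segC (dpos (qd2 Q)) (ppos (qp2 Q))) (segC (dpos (qd1 Q)) (ppos (qp2 Q))).
by apply/seteqP; split => p [[[h|h]|h]|h]; rewrite /setU/=; tauto.
Qed.

Let region_kiteb Q : region Q `&` kiteb Q = set0.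
Proof.
apply/seteqP; split => // p [/region_off_drawing h].
have [a1 a2 a3 a4] := quad_adj Q.
by move=> [[[k|k]|k]|k]; apply: h; [apply: (edge_sub_drawing a1)|apply: (edge_sub_drawing a2)|apply: (edge_sub_drawing a3)|apply: (edge_sub_drawing a4)].
Qed.

Lemma region_kite Q : -1 < Yp Q (dpos (qd1 Q)) < 0 ->
  region Q = kite_interior (ppos (qp1 Q)) (ppos (qp2 Q)) (dpos (qd1 Q)) (dpos (qd2 Q)).
Proof.
move=> sp; apply: (kite_regionE (qe_gt0 Q) (qf_gt0 Q) (qe_qf Q) sp).
- exact: region_nonempty.
- exact: region_bounded.
- exact: region_kiteb.
- exact: od_quad_frontier.
Qed.

Lemma region_kite_swap Q : -1 < Xp Q (ppos (qp1 Q)) < 0 ->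
  region Q = kite_interior (dpos (qd1 Q)) (dpos (qd2 Q)) (ppos (qp1 Q)) (ppos (qp2 Q)).
Proof.
move=> sp; apply: (kite_regionE (qf_gt0 Q) (qe_gt0 Q) (qf_qe Q) sp).
- exact: region_nonempty.
- exact: region_bounded.
- by rewrite -/(kiteb' Q) kiteb_swap; exact: region_kiteb.
- by rewrite -/(kiteb' Q) kiteb_swap; exact: od_quad_frontier.
Qed.

Lemma region_side Q m : [/\
  edge_seg (qp1 Q) (qd1 Q) m -> m <> ppos (qp1 Q) -> m <> dpos (qd1 Q) ->
    \forall q \near m, region Q q ->
     0 < cross (dpos (qd1 Q) - ppos (qp1 Q)) (q - ppos (qp1 Q)) * cross (qe Q) (qf Q),
  edge_seg (qp1 Q) (qd2 Q) m -> m <> ppos (qp1 Q) -> m <> dpos (qd2 Q) ->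
    \forall q \near m, region Q q ->
     cross (dpos (qd2 Q) - ppos (qp1 Q)) (q - ppos (qp1 Q)) * cross (qe Q) (qf Q) < 0,
  edge_seg (qp2 Q) (qd1 Q) m -> m <> ppos (qp2 Q) -> m <> dpos (qd1 Q) ->
    \forall q \near m, region Q q ->
     cross (dpos (qd1 Q) - ppos (qp2 Q)) (q - ppos (qp2 Q)) * cross (qe Q) (qf Q) < 0 &
  edge_seg (qp2 Q) (qd2 Q) m -> m <> ppos (qp2 Q) -> m <> dpos (qd2 Q) ->
    \forall q \near m, region Q q ->
     0 < cross (dpos (qd2 Q) - ppos (qp2 Q)) (q - ppos (qp2 Q)) * cross (qe Q) (qf Q)].
Proof.
have [sp|sp] := quad_split Q.
  rewrite (region_kite sp).
  have [s1 s2 s3 s4] := kite_side (qe_gt0 Q) (qf_gt0 Q) (qe_qf Q) sp m.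
  by split=> sm mx _; [exact: s1|exact: s2|exact: s3|exact: s4].
rewrite (region_kite_swap sp).
have [s1 s2 s3 s4] := kite_side (qf_gt0 Q) (qe_gt0 Q) (qf_qe Q) sp m.
(* Exchanging primal and dual reverses both the edge vector and the sign of [cross (qe Q) (qf Q)],
   so the inequalities are unchanged. *)
have sw (p w q : R * R) (c : R) : cross (p - w) (q - w) * c = cross (w - p) (q - p) * - c.
  by rewrite /cross /=; ring.
have cfe : cross (qf Q) (qe Q) = - cross (qe Q) (qf Q) by rewrite /cross; ring.
split; rewrite /edge_seg segC => sm _ mx.
- have := s1 sm mx; apply: filterS => q h /h.
  by rewrite -/(qf Q) -/(qe Q) cfe sw opprK.
- have := s3 sm mx; apply: filterS => q h /h.
  by rewrite -/(qf Q) -/(qe Q) cfe sw opprK.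
- have := s2 sm mx; apply: filterS => q h /h.
  by rewrite -/(qf Q) -/(qe Q) cfe sw opprK.
- have := s4 sm mx; apply: filterS => q h /h.
  by rewrite -/(qf Q) -/(qe Q) cfe sw opprK.
Qed.

Lemma region_diameter (eps : R) Q q : edges_at_most G eps -> region Q q ->
  nrm (q - ppos (qp1 Q)) <= 3 * eps.
Proof.
move=> le; have len x u : adj x u -> nrm (dpos u - ppos x) <= eps.
  by move=> /le; rewrite eucl_nrm nrmB.
have [/len a1 /len a2 /len a3 /len a4] := quad_adj Q.
have eps0 : 0 <= eps by apply: le_trans a1; exact: nrm_ge0.
have [sp|sp] := quad_split Q.
  rewrite (region_kite sp) => h.
  have := kite_interior_le (qe_gt0 Q) (qf_gt0 Q) (qe_qf Q) sp a1 a4 a2 h; lra.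
rewrite (region_kite_swap sp) => h.
rewrite nrmB in a1; rewrite nrmB in a2; rewrite nrmB in a4.
have := kite_interior_le (qf_gt0 Q) (qe_gt0 Q) (qf_qe Q) sp a1 a2 a4 h.
have := ler_nrmD (q - dpos (qd1 Q)) (dpos (qd1 Q) - ppos (qp1 Q)).
by rewrite addrA subrK [X in _ <= _ + X]nrmB; lra.
Qed.

End Drawing.

(** * Edges separating faces, and the flux balance at inner vertices *)

Section EdgeNeighbourhood.
Variables (R : realType) (G : orthodiagonal_map R).
Implicit Types (x y : primal G) (u v w : dual G) (Q : quad G).
Notation D := (drawing_set G).

Definition edge_cross x u (q : R * R) : R := cross (dpos u - ppos x) (q - ppos x).

Definition inner_point x u (m : R * R) : Prop :=
  [/\ edge_seg x u m, m <> ppos x & m <> dpos u].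

Lemma is_affine_edge_cross x u : is_affine (edge_cross x u).
Proof. exact: is_affine_cross. Qed.

Lemma edge_cross_seg x u m : edge_seg x u m -> edge_cross x u m = 0.
Proof.
move=> [t _ <-]; rewrite /edge_cross /cross /=; ring.
Qed.

Lemma inner_point_not_vertex x u m z : adj x u -> inner_point x u m -> @vpos R G z <> m.
Proof.
move=> xu [sm mx mu] zm; rewrite -zm in sm.
by have [h|h] := vertex_on_edge xu sm; [apply: mx|apply: mu]; rewrite -zm h.
Qed.

Lemma inner_point_edge x u y w m : adj x u -> inner_point x u m -> adj y w ->
  edge_seg y w m -> x = y /\ u = w.
Proof.
move=> xu im yw ym; have [//|[z zm]] := edges_meet xu yw (let: And3 h _ _ := im in h) ym.
by case: (inner_point_not_vertex xu im zm).
Qed.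

Lemma near_edge x u m : adj x u -> inner_point x u m ->
  \forall p \near m, D p -> edge_seg x u p.
Proof.
move=> xu im.
have h1 : \forall p \near m, forall z, @vpos R G z <> p.
  apply: (@filter_forall _ (primal G + dual G)%type (fun z p => @vpos R G z <> p) (nbhs m) _) => z.
  have zm := inner_point_not_vertex xu im (z := z).
  have : \forall p \near m, ~ [set vpos z] p.
    apply: near_closed_out; last by move=> /= /esym.
    by apply: compact_closed; [exact: norm_hausdorff|exact: compact_set1].
  by apply: filterS => p h /esym.
have h2 : \forall p \near m, forall yw : primal G * dual G,
    adj yw.1 yw.2 -> edge_seg yw.1 yw.2 p -> x = yw.1 /\ u = yw.2.
  apply: (@filter_forall _ (primal G * dual G)%type (fun yw p =>
    adj yw.1 yw.2 -> edge_seg yw.1 yw.2 p -> x = yw.1 /\ u = yw.2) (nbhs m) _) => -[y w] /=.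
  have [yw|nyw] := boolP (adj y w); last by apply: nearW.
  have [ym|nym] := pselect (edge_seg y w m).
    by apply: nearW => p _ _; exact: inner_point_edge ym.
  by have := near_closed_out (@closed_seg R _ _) nym; apply: filterS => p np _ /np.
apply: filterS2 h1 h2 => p h1 h2 [[z zp]|[y [w [yw yp]]]]; first by case: (h1 z).
by have [/= -> ->] := h2 (y, w) yw yp.
Qed.

Definition half_ball x u m (r s : R) : set (R * R) :=
  ball m r `&` [set q | 0 < s * edge_cross x u q].

Lemma half_ball_convex x u m r s : convex_set (half_ball x u m r s).
Proof.
apply: convex_setI; first exact: convex_ball.
by apply: convex_is_affine_gt0; apply: is_affineZ; exact: is_affine_edge_cross.
Qed.

Lemma edge_vector_neq0 x u : dpos u - ppos x != 0 :> R * R.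
Proof. by rewrite subr_eq0; apply/eqP => /esym/ppos_dpos. Qed.

Lemma half_ball_nonempty x u m r s : edge_seg x u m -> 0 < r -> s != 0 ->
  half_ball x u m r s !=set0.
Proof.
move=> sm r0 s0; set v : R * R := dpos u - ppos x.
have v0 : 0 < dot v v by rewrite -nrm_sqr exprn_gt0// nrm_gt0// edge_vector_neq0.
pose t := r / (`|v.1| + `|v.2| + 1) * Num.sg s.
have n0 : 0 < `|v.1| + `|v.2| + 1 by rewrite ltr_wpDl ?addr_ge0.
have tE : `|t| = r / (`|v.1| + `|v.2| + 1).
  by rewrite /t normrM normr_sg s0 mulr1 gtr0_norm// divr_gt0.
exists (m.1 - t * v.2, m.2 + t * v.1); split.
  have h1 := normr_ge0 v.1; have h2 := normr_ge0 v.2.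
  apply/plane_ballP; split => /=.
    rewrite opprB addrC subrK normrM tE mulrAC ltr_pdivrMr// ltr_pM2l//; lra.
  rewrite opprD addrA subrr sub0r normrN normrM tE mulrAC ltr_pdivrMr// ltr_pM2l//; lra.
rewrite /=; have -> : edge_cross x u (m.1 - t * v.2, m.2 + t * v.1) = t * dot v v.
  apply: (@eq_trans _ _ (edge_cross x u m + t * dot v v)); last first.
    by rewrite edge_cross_seg// add0r.
  by rewrite /edge_cross -/v /cross /dot /=; ring.
rewrite mulrA mulr_gt0// /t mulrCA mulr_gt0 ?divr_gt0//.
by rewrite mulrC -normrEsg normr_gt0.
Qed.

Lemma half_ball_off_drawing x u m : adj x u -> inner_point x u m ->
  \forall r \near (0 : R)^'+, forall s, half_ball x u m r s `<=` ~` D.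
Proof.
move=> xu im; have [r0 r00 hr] := near_plane (near_edge xu im).
near=> r => s q [mq /= sq] Dq.
have : edge_seg x u q.
  apply: hr => //; apply: le_ball mq; near: r; exact: nbhs_right_le.
by move=> /edge_cross_seg h; rewrite h mulr0 ltxx in sq.
Unshelve. all: by end_near. Qed.

Definition orientq Q : R := orient (qe Q) (qf Q).

(** Zero unless the edge is a side of [Q]; otherwise a sign that tells on which side of the edge the
    face lies, however its corners are listed (see [edge_sign_side]). *)
Definition edge_sign Q x u : R :=
  orientq Q * ((x == qp1 Q)%:R - (x == qp2 Q)%:R) * ((u == qd2 Q)%:R - (u == qd1 Q)%:R).

Let crossn0 Q : cross (qe Q) (qf Q) != 0.
Proof. exact: cross_neq0 (qe_gt0 Q) (qf_gt0 Q) (qe_qf Q). Qed.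

Let orient_pos Q (A : R) : 0 < A * cross (qe Q) (qf Q) -> 0 < orientq Q * A.
Proof.
move=> h; rewrite mulrC; have : 0 < A * (orientq Q * `|cross (qe Q) (qf Q)|).
  by rewrite /orientq /orient mulr_sg_norm.
by rewrite mulrA pmulr_lgt0// normr_gt0.
Qed.

Let orient_neg Q (A : R) : A * cross (qe Q) (qf Q) < 0 -> orientq Q * A < 0.
Proof.
move=> h; rewrite mulrC; have : A * (orientq Q * `|cross (qe Q) (qf Q)|) < 0.
  by rewrite /orientq /orient mulr_sg_norm.
by rewrite mulrA pmulr_llt0// normr_gt0.
Qed.

Let p12 Q : (qp1 Q == qp2 Q) = false.
Proof. by apply/eqP; have [] := od_quad_distinct Q. Qed.
Let d12 Q : (qd1 Q == qd2 Q) = false.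
Proof. by apply/eqP; have [] := od_quad_distinct Q. Qed.

Let p21 Q : (qp2 Q == qp1 Q) = false. Proof. by rewrite eq_sym p12. Qed.
Let d21 Q : (qd2 Q == qd1 Q) = false. Proof. by rewrite eq_sym d12. Qed.

Lemma edge_sign_sqr Q x u : edge_sign Q x u != 0 ->
  edge_sign Q x u = 1 \/ edge_sign Q x u = - 1.
Proof.
have o : orientq Q = 1 \/ orientq Q = - 1.
  have := orient_sqr (qe_gt0 Q) (qf_gt0 Q) (qe_qf Q).
  by move=> /eqP; rewrite sqrf_eq1 => /orP[] /eqP; [left|right].
rewrite /edge_sign; case: o => ->; case: (x == qp1 Q); case: (x == qp2 Q);
  case: (u == qd1 Q); case: (u == qd2 Q) => /= /eqP h;
  first [by left; ring | by right; ring | by case: h; ring].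
Qed.

Lemma edge_sign_adj Q x u : edge_sign Q x u != 0 -> adj x u.
Proof.
have [a1 a2 a3 a4] := quad_adj Q.
rewrite /edge_sign => es; have [xx uu] : (x = qp1 Q \/ x = qp2 Q) /\ (u = qd1 Q \/ u = qd2 Q).
  split.
    case: (eqVneq x (qp1 Q)) es => [->|_]; first by left.
    by case: (eqVneq x (qp2 Q)) => [->|_]; [right|rewrite subrr mulr0 mul0r eqxx].
  case: (eqVneq u (qd1 Q)) es => [->|_]; first by left.
  by case: (eqVneq u (qd2 Q)) => [->|_]; [right|rewrite subrr mulr0 eqxx].
by case: xx uu => -> [] ->.
Qed.

Lemma edge_sign_side Q x u m : inner_point x u m -> edge_sign Q x u != 0 ->
  \forall q \near m, region Q q -> edge_sign Q x u * edge_cross x u q < 0.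
Proof.
move=> [sm mx mu]; have [s1 s2 s3 s4] := region_side Q m.
rewrite /edge_sign /edge_cross.
case: (eqVneq x (qp1 Q)) => [ex|nx1].
  subst x; rewrite p12 subr0 mulr1; case: (eqVneq u (qd2 Q)) => [eu|nu].
    subst u; rewrite d21 subr0 mulr1 => _.
    by have := s2 sm mx mu; apply: filterS => q h /h /orient_neg.
  rewrite sub0r; case: (eqVneq u (qd1 Q)) => [eu|nu']; last by rewrite oppr0 mulr0 eqxx.
  subst u; rewrite mulrN1 => _.
  have := s1 sm mx mu; apply: filterS => q h /h /orient_pos.
  by rewrite mulNr oppr_lt0.
rewrite sub0r; case: (eqVneq x (qp2 Q)) => [ex|nx2]; last by rewrite oppr0 mulr0 mul0r eqxx.
subst x; rewrite mulrN1; case: (eqVneq u (qd2 Q)) => [eu|nu].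
  subst u; rewrite d21 subr0 mulr1 => _.
  have := s4 sm mx mu; apply: filterS => q h /h /orient_pos.
  by rewrite mulNr oppr_lt0.
rewrite sub0r; case: (eqVneq u (qd1 Q)) => [eu|nu']; last by rewrite oppr0 mulr0 eqxx.
subst u; rewrite mulrN1 opprK => _.
by have := s3 sm mx mu; apply: filterS => q h /h /orient_neg.
Qed.

Lemma edge_sign_closure Q x u m : adj x u -> inner_point x u m ->
  edge_sign Q x u != 0 <-> closure (region Q) m.
Proof.
move=> xu im; have [sm mx mu] := im; have [a1 a2 a3 a4] := quad_adj Q.
have on0 : orientq Q != 0.
  by rewrite -normr_gt0 /orientq (norm_orient (qe_gt0 Q) (qf_gt0 Q) (qe_qf Q)).
split=> [es|clm].
  suff : frontier (region Q) m by case.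
  rewrite od_quad_frontier; move: es; rewrite /edge_sign.
  case: (eqVneq x (qp1 Q)) => [ex|nx1].
    subst x; case: (eqVneq u (qd2 Q)) => [eu|nu]; first by subst u; right.
    case: (eqVneq u (qd1 Q)) => [eu|nu']; first by subst u; do 3 left.
    by rewrite subrr mulr0 eqxx.
  case: (eqVneq x (qp2 Q)) => [ex|nx2]; last by rewrite subrr mulr0 mul0r eqxx.
  subst x; case: (eqVneq u (qd2 Q)) => [eu|nu]; first by subst u; left; right.
  case: (eqVneq u (qd1 Q)) => [eu|nu']; first by subst u; do 2 left; right.
  by rewrite subrr mulr0 eqxx.
have : frontier (region Q) m.
  split => // /interior_subset /region_off_drawing; apply.
  exact: edge_sub_drawing sm.
rewrite od_quad_frontier /edge_sign => -[[[h|h]|h]|h].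
- have [-> ->] := inner_point_edge xu im a1 h.
  by rewrite !eqxx p12 d12 /= subr0 sub0r mulr1 mulrN1 oppr_eq0.
- have [-> ->] := inner_point_edge xu im a2 h.
  by rewrite !eqxx p21 d12 /= !sub0r !mulrN1 opprK.
- have [-> ->] := inner_point_edge xu im a3 h.
  by rewrite !eqxx p21 d21 /= subr0 sub0r mulr1 mulrN1 oppr_eq0.
- have [-> ->] := inner_point_edge xu im a4 h.
  by rewrite !eqxx p12 d21 /= !subr0 !mulr1.
Qed.

Lemma half_ball_region Q x u m : adj x u -> inner_point x u m -> edge_sign Q x u != 0 ->
  \forall r \near (0 : R)^'+, half_ball x u m r (- edge_sign Q x u) `<=` region Q.
Proof.
move=> xu im es; have [r0 r00 hr] := near_plane (edge_sign_side im es).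
have clm : closure (region Q) m by apply/(edge_sign_closure _ xu im).
near=> r => q hq.
have r1 : 0 < r by near: r; exact: nbhs_right_gt.
have [q' Qq' mq'] := (closure_near _ _).1 clm r r1.
have rr0 : r <= r0 by near: r; exact: nbhs_right_le.
have q'n : half_ball x u m r (- edge_sign Q x u) q'.
  split => //=; rewrite mulNr oppr_gt0; apply: hr => //.
  exact: le_ball mq'.
suff : half_ball x u m r (- edge_sign Q x u) `<=` region Q by exact.
apply: connected_sub_region q'n Qq'.
  by apply: convex_connected; exact: half_ball_convex.
move: (- _); near: r; exact: half_ball_off_drawing.
Unshelve. all: by end_near. Qed.

Lemma inner_point_near x u : adj x u -> forall A : set (R * R), nbhs (ppos x) A ->
  exists2 m, inner_point x u m & A m.
Proof.
move=> xu A /nbhs_ballP[r r0 rA].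
set v : R * R := dpos u - ppos x.
have n0 : 0 < `|v.1| + `|v.2| + 1 by rewrite ltr_wpDl ?addr_ge0.
pose t := Num.min 2^-1 (r / (`|v.1| + `|v.2| + 1)).
have t0 : 0 < t by rewrite lt_min invr_gt0 ltr0n divr_gt0.
have t1 : t <= 2^-1 by rewrite ge_min lexx.
have t2 : t * (`|v.1| + `|v.2| + 1) <= r by rewrite -ler_pdivlMr// ge_min lexx orbT.
set m := ((1 - t) * (ppos x).1 + t * (dpos u).1, (1 - t) * (ppos x).2 + t * (dpos u).2).
have mE : m = ppos x + t *: v.
  by rewrite /m /v; coordwise ring.
have mE' : m = dpos u - (1 - t) *: v.
  by rewrite /m /v; coordwise ring.
have v0 : v != 0 by exact: edge_vector_neq0.
exists m.
  split.
  - by exists t => //=; rewrite in_itv /= ltW//=; lra.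
  - rewrite mE => /eqP; rewrite -subr_eq0 addrC addKr scaler_eq0 (negPf v0) orbF.
    by rewrite gt_eqF.
  - rewrite mE' => /eqP; rewrite -subr_eq0 addrC addKr oppr_eq0 scaler_eq0 (negPf v0) orbF.
    by rewrite gt_eqF//; lra.
have h1 := normr_ge0 v.1; have h2 := normr_ge0 v.2.
have h3 : 0 <= t * `|v.1| by rewrite mulr_ge0// ltW.
have h4 : 0 <= t * `|v.2| by rewrite mulr_ge0// ltW.
apply: rA; rewrite mE; apply/plane_ballP; rewrite /= /GRing.scale /=.
by split; rewrite opprD addrA subrr sub0r normrN normrM (gtr0_norm t0); lra.
Qed.

(** The sign determines the side, and a small half ball on that side lies in a single face. *)
Lemma edge_sign_inj Q Q' x u : edge_sign Q x u != 0 ->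
  edge_sign Q x u = edge_sign Q' x u -> Q = Q'.
Proof.
move=> es eqs; have xu := edge_sign_adj es.
have [m im _] := inner_point_near xu (A := setT) filterT.
have es' : edge_sign Q' x u != 0 by rewrite -eqs.
have [r [r0 h1 h2]] : exists r, [/\ 0 < r, half_ball x u m r (- edge_sign Q x u) `<=` region Q
    & half_ball x u m r (- edge_sign Q x u) `<=` region Q'].
  near (0 : R)^'+ => r; exists r; split.
  - by near: r; exact: nbhs_right_gt.
  - by near: r; exact: half_ball_region.
  - by rewrite eqs; near: r; exact: half_ball_region.
have esN : - edge_sign Q x u != 0 by rewrite oppr_eq0.
have [sm _ _] := im; have [q hq] := half_ball_nonempty sm r0 esN.
exact: region_inj_meet (h1 q hq) (h2 q hq).
Unshelve. all: by end_near. Qed.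

Lemma hat_domain_region p : hat_domain G p -> ~ D p -> exists Q, region Q p.
Proof. by move=> /interior_subset[//|[Q _ Qp] _]; exists Q. Qed.

(** Inside the domain, a small half ball on either side of the edge avoids the drawing, so it lies
    in an inner face having [m] in its closure. The half ball is taken on the side [- s], since a
    face lies where [edge_sign] and [edge_cross] disagree. *)
Lemma edge_sign_exists x u m (s : R) : adj x u -> inner_point x u m ->
  hat_domain G m -> s = 1 \/ s = - 1 -> exists Q, edge_sign Q x u = s.
Proof.
move=> xu im hm s1; have [sm mx mu] := im.
have s0 : s != 0 by case: s1 => ->; rewrite ?oppr_eq0 oner_eq0.
have [r [r0 hD hhat]] : exists r, [/\ 0 < r, (forall s, half_ball x u m r s `<=` ~` D) &
    ball m r `<=` hat_domain G].
  have : nbhs m (hat_domain G) by apply: open_nbhs_nbhs; split => //; exact: open_interior.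
  move=> /nbhs_ballP[r' r'0 hr'].
  near (0 : R)^'+ => r; exists r; split.
  - by near: r; exact: nbhs_right_gt.
  - by near: r; exact: half_ball_off_drawing.
  - by apply: subset_trans hr'; apply: le_ball; near: r; exact: nbhs_right_le.
have sN : - s != 0 by rewrite oppr_eq0.
have [q hq] := half_ball_nonempty sm r0 sN.
have [|Q Qq] := @hat_domain_region q _ (hD _ q hq); first by apply: hhat; case: hq.
have HQ : half_ball x u m r (- s) `<=` region Q.
  apply: (connected_sub_region _ (hD _) hq Qq).
  by apply: convex_connected; exact: half_ball_convex.
have clm : closure (region Q) m.
  apply/closure_near => r' r'0.
  have r''0 : 0 < Num.min r r' by rewrite lt_min r0.
  have [q' [b h]] := half_ball_nonempty sm r''0 sN.
  exists q'; last by apply: le_ball b; rewrite ge_min lexx orbT.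
  by apply: HQ; split => //; apply: le_ball b; rewrite ge_min lexx.
have es := (edge_sign_closure Q xu im).2 clm.
exists Q.
have [r1 r10 hr1] := near_plane (edge_sign_side im es).
have r20 : 0 < Num.min r r1 by rewrite lt_min r0.
have [q' [b h]] := half_ball_nonempty sm r20 sN.
have b1 : ball m r q' by apply: le_ball b; rewrite ge_min lexx.
have b2 : ball m r1 q' by apply: le_ball b; rewrite ge_min lexx orbT.
have := hr1 q' b2 (HQ q' (conj b1 h)); rewrite /= in h.
have [->|->] := edge_sign_sqr es; case: s1 h => -> ; rewrite ?opprK ?mulN1r ?mul1r// => h h'; lra.
Unshelve. all: by end_near. Qed.

(** Close to [x] the edge is inside the domain, so it has exactly one face on each side, with
    opposite signs. *)
Lemma edge_sign_balance x u : hat_domain G (ppos x) -> \sum_Q edge_sign Q x u = 0.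
Proof.
move=> hx; have [xu|nxu] := boolP (adj x u); last first.
  rewrite big1// => Q _; apply/eqP; apply: contraNT nxu; exact: edge_sign_adj.
have [m im hm] : exists2 m, inner_point x u m & hat_domain G m.
  by apply: inner_point_near xu _ _; apply: open_nbhs_nbhs; split => //; exact: open_interior.
have [Q1 h1] := edge_sign_exists xu im hm (or_introl erefl).
have [Q2 h2] := edge_sign_exists xu im hm (or_intror erefl).
have Q21 : Q2 != Q1.
  by apply/eqP => h; have : (1 : R) = - 1 by [rewrite -[LHS]h1 -h h2]; lra.
rewrite (bigD1 Q1)//= (bigD1 Q2)//= h1 h2 big1; first by rewrite addr0 subrr.
move=> Q /andP[QQ1 QQ2]; apply: contraNeq QQ1 => es; apply/eqP.
have [e1|e1] := edge_sign_sqr es.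
  by apply: (edge_sign_inj es); rewrite e1 h1.
by case/eqP: QQ2; apply: (edge_sign_inj es); rewrite e1 h2.
Qed.

(** After expanding in the values of [F], the coefficient of [F u] is the sum of the signs of the
    edge [x u]. No cyclic ordering of the faces around [x] has to be constructed. *)
Lemma flux_balance x (F : dual G -> R) : hat_domain G (ppos x) ->
  \sum_Q orientq Q * ((x == qp1 Q)%:R - (x == qp2 Q)%:R) * (F (qd2 Q) - F (qd1 Q)) = 0.
Proof.
move=> hx.
have pick w : F w = \sum_u (u == w)%:R * F u.
  rewrite (bigD1 w)//= eqxx mul1r big1 ?addr0// => u /negPf ->.
  by rewrite mul0r.
transitivity (\sum_Q \sum_u edge_sign Q x u * F u).
  apply: eq_bigr => Q _; rewrite [in LHS]pick [X in _ * (_ - X)]pick -sumrB mulr_sumr.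
  by apply: eq_bigr => u _; rewrite /edge_sign; ring.
rewrite exchange_big big1//= => u _.
by rewrite -mulr_suml edge_sign_balance// mul0r.
Qed.

End EdgeNeighbourhood.

(** * A half-angle parity function along polygons *)

Section ConnectedComplement.
Variable R : realType.
Implicit Types (p q : R * R) (A B : set (R * R)).

Lemma connected_same_sign A (f : R * R -> R) p q : connected A -> continuous f ->
  (forall r, A r -> f r != 0) -> A p -> A q -> 0 < f p -> 0 < f q.
Proof.
move=> cA cf f0 Ap Aq fp.
suff : A `<=` [set r | 0 < f r] by exact.
apply: connected_sub_frontier => //; first by exists p.
apply/seteqP; split => // r [Ar [clr nir]].
have or : open [set r | 0 < f r].
  by apply: (@open_comp _ _ f [set x | 0 < x]) (@open_gt _ 0); move=> ? _; exact: cf.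
have cr : closed [set r | 0 <= f r].
  by apply: (@closed_comp _ _ f [set x | 0 <= x]) (@closed_ge _ 0); move=> ? _; exact: cf.
have fr : 0 <= f r.
  by apply: (cr r); apply: closure_subset clr => s /ltW.
apply: nir; rewrite ((interior_id _).1 or) /=.
by rewrite lt_neqAle fr andbT eq_sym f0.
Qed.

(** Four half-planes overlapping in a chain. Far from the drawing this set joins all unbounded
    components, which [outer_face] merges into one set. *)
Lemma connected_outside_box (M : R) : 0 <= M ->
  connected [set p : R * R | M < `|p.1| \/ M < `|p.2|].
Proof.
move=> M0.
pose H (a b : R) : set (R * R) := [set p | 0 < affine a b (- M) p].
have cH a b : connected (H a b) by apply: convex_connected; exact: convex_affine_gt0.
have -> : [set p : R * R | M < `|p.1| \/ M < `|p.2|] =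
    (H 1 0 `|` H 0 1) `|` (H (-1) 0 `|` H 0 (-1)).
  apply/seteqP; split => p; rewrite /H /affine /=.
    move=> [h|h].
      by case: (ler0P p.1) h => p0 h; [right; left|left; left]; lra.
    by case: (ler0P p.2) h => p0 h; [right; right|left; right]; lra.
  have h1 := ler_norm p.1; have h2 := ler_norm p.2.
  have h3 := ler_norm (- p.1); have h4 := ler_norm (- p.2); rewrite !normrN in h3 h4.
  move=> [[h|h]|[h|h]]; [left|right|left|right]; lra.
apply: connectedU.
- by exists (- (M + 1), M + 1); rewrite /H /affine /=; split; [right|left]; lra.
- apply: connectedU => //; exists (M + 1, M + 1); rewrite /H /affine /=; split; lra.
- apply: connectedU => //; exists (- (M + 1), - (M + 1)); rewrite /H /affine /=; split; lra.
Qed.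

End ConnectedComplement.

Section HalfAngle.
Variable R : realType.
Implicit Types (a b p q z u : R * R) (s : seq (R * R)).

Lemma nrm0_eq p : nrm p = 0 -> p = 0.
Proof. by move=> h; apply/eqP; apply: contraTT isT => /nrm_gt0; rewrite h ltxx. Qed.

(** By the equality case of Cauchy-Schwarz, vanishing would make [a - p] and [b - p] point in
    opposite directions, with [p] between [a] and [b]. *)
Lemma off_seg_gt0 a b p : ~ seg a b p ->
  0 < nrm (a - p) * nrm (b - p) + dot (a - p) (b - p).
Proof.
move=> nab; rewrite ltNge; apply/negP => h; apply: nab.
set x := a - p in h *; set y := b - p in h *.
have z0 : nrm y *: x + nrm x *: y = 0.
  have nn : 0 <= nrm x * nrm y by rewrite mulr_ge0 ?nrm_ge0.
  apply: nrm0_eq; apply/eqP; rewrite -sqrf_eq0 nrm_sqr eq_le dot_ge0 andbT.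
  have -> : dot (nrm y *: x + nrm x *: y) (nrm y *: x + nrm x *: y) =
     nrm y ^+ 2 * dot x x + nrm x ^+ 2 * dot y y + 2 * (nrm x * nrm y) * dot x y.
    by rewrite /dot /= /GRing.scale /=; ring.
  rewrite -!nrm_sqr.
  have -> : nrm y ^+ 2 * nrm x ^+ 2 + nrm x ^+ 2 * nrm y ^+ 2 + 2 * (nrm x * nrm y) * dot x y =
    2 * (nrm x * nrm y) * (nrm x * nrm y + dot x y) by ring.
  by rewrite mulr_ge0_le0// mulr_ge0.
have [xy0|xy0] := eqVneq (nrm x + nrm y) 0.
  have x0 : nrm x = 0 by have := nrm_ge0 x; have := nrm_ge0 y; lra.
  have -> : p = a by apply/eqP; rewrite eq_sym -subr_eq0 -/x (nrm0_eq x0).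
  exact: seg_left.
have xy1 : 0 < nrm x + nrm y by rewrite lt_neqAle eq_sym xy0 addr_ge0 ?nrm_ge0.
exists (nrm x / (nrm x + nrm y)).
  rewrite /= in_itv /= divr_ge0 ?nrm_ge0 ?(ltW xy1)//= ler_pdivrMr// mul1r lerDl.
  exact: nrm_ge0.
have aE : a = p + x by rewrite /x addrC subrK.
have bE : b = p + y by rewrite /y addrC subrK.
move: z0 => /(congr1 (fun r => (r.1, r.2))) [].
rewrite /GRing.scale /= => z1 z2.
have [e1 e2] : nrm y * x.1 + nrm x * y.1 = 0 /\ nrm y * x.2 + nrm x * y.2 = 0 by [].
rewrite aE bE [RHS]surjective_pairing; congr pair.
  apply: (mulfI xy0); rewrite -[RHS]addr0 -[X in _ = _ + X]e1 /=; field.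
  by rewrite xy0.
apply: (mulfI xy0); rewrite -[RHS]addr0 -[X in _ = _ + X]e2 /=; field.
by rewrite xy0.
Qed.

(* Points of the plane are multiplied as complex numbers; [dot a b] and [cross a b] are the
   real and imaginary parts of [conj a * b]. *)
Definition cmul (x y : R * R) : R * R := (x.1 * y.1 - x.2 * y.2, x.1 * y.2 + x.2 * y.1).
Definition conj_mul (x y : R * R) : R * R := (dot x y, cross x y).

Lemma scale_conj_mul (k : R) x y : k *: conj_mul x y = (k * dot x y, k * cross x y).
Proof. by []. Qed.

(* A multiple of the principal square root of [(b - p) / (a - p)], i.e. of the half-angle
   rotation from [a] to [b] as seen from [p]; continuous off the segment [a b]. *)
Definition half_turn a b p : R * R :=
  (nrm (a - p) * nrm (b - p) + dot (a - p) (b - p), cross (a - p) (b - p)).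

Fixpoint half_turns a s p : R * R :=
  if s is b :: s' then cmul (half_turn a b p) (half_turns b s' p) else (1, 0).

Fixpoint on_polyline a s p : Prop :=
  if s is b :: s' then seg a b p \/ on_polyline b s' p else p = a.

Lemma half_turn_sqr a b p : cmul (half_turn a b p) (half_turn a b p) =
  (2 * (nrm (a - p) * nrm (b - p) + dot (a - p) (b - p))) *: conj_mul (a - p) (b - p).
Proof.
set x := a - p; set y := b - p.
have h := dot_cross_sqr x y; rewrite exprMn in h.
rewrite /cmul /half_turn /conj_mul -/x -/y /=.
congr pair; rewrite /= /GRing.scale /=; last by ring.
have -> : cross x y * cross x y = nrm x ^+ 2 * nrm y ^+ 2 - dot x y ^+ 2 by rewrite -h; ring.
ring.
Qed.

(** The squares telescope: as complex numbers, [conj (a - p) (b - p)] times [conj (b - p) (q - p)]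
    is [|b - p|^2 conj (a - p) (q - p)]. *)
Lemma half_turns_sqr a s p : ~ on_polyline a s p ->
  exists2 l : R, 0 < l & cmul (half_turns a s p) (half_turns a s p) =
    l *: conj_mul (a - p) (last a s - p).
Proof.
elim: s a => [|b s IH] a /= np.
  have ap : a - p != 0 by rewrite subr_eq0; apply/eqP => h; apply: np.
  have d0 : 0 < dot (a - p) (a - p) by rewrite -nrm_sqr exprn_gt0// nrm_gt0.
  exists (dot (a - p) (a - p))^-1; first by rewrite invr_gt0.
  have c0 : cross (a - p) (a - p) = 0 by rewrite /cross; ring.
  rewrite /cmul /conj_mul c0 /=; congr pair; rewrite /= /GRing.scale /=.
    by rewrite mulVf ?gt_eqF// mulr0 subr0 mulr1.
  by rewrite !mulr0 mul0r addr0.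
have [l l0 hl] : exists2 l : R, 0 < l & cmul (half_turns b s p) (half_turns b s p) =
    l *: conj_mul (b - p) (last b s - p).
  by apply: IH => h; apply: np; right.
have h0 : 0 < nrm (a - p) * nrm (b - p) + dot (a - p) (b - p).
  by apply: off_seg_gt0 => h; apply: np; left.
have bp : b - p != 0.
  by rewrite subr_eq0; apply/eqP => h; apply: np; left; rewrite -h; exact: seg_right.
have d0 : 0 < dot (b - p) (b - p) by rewrite -nrm_sqr exprn_gt0// nrm_gt0.
exists (2 * (nrm (a - p) * nrm (b - p) + dot (a - p) (b - p)) * l * dot (b - p) (b - p)).
  by apply: mulr_gt0 d0; apply: mulr_gt0 l0; apply: mulr_gt0.
have cmulACA x y : cmul (cmul x y) (cmul x y) = cmul (cmul x x) (cmul y y).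
  by rewrite /cmul /=; congr pair; ring.
rewrite cmulACA half_turn_sqr hl; set k := 2 * _.
move: (last b s - p) => y; move: (a - p) (b - p) => x v.
by rewrite !scale_conj_mul /cmul /dot /cross /=; congr pair; ring.
Qed.

Let dot_sub_continuous a b : continuous (fun p : R * R => dot (a - p) (b - p)).
Proof.
move=> p; rewrite /dot; apply: cvgD; apply: cvgM; apply: cvgB;
  (try exact: cvg_cst); (try exact: cvg_fst); exact: cvg_snd.
Qed.

Let cross_sub_continuous a b : continuous (fun p : R * R => cross (a - p) (b - p)).
Proof.
move=> p; rewrite /cross; apply: cvgB; apply: cvgM; apply: cvgB;
  (try exact: cvg_cst); (try exact: cvg_fst); exact: cvg_snd.
Qed.

Let nrm_sub_continuous a : continuous (fun p : R * R => nrm (a - p)).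
Proof.
move=> p; rewrite /nrm.
apply: (@continuous_comp _ _ _ (fun p : R * R => dot (a - p) (a - p)) Num.sqrt).
  exact: dot_sub_continuous.
exact: sqrt_continuous.
Qed.

Lemma half_turn_continuous a b :
  continuous (fun p => (half_turn a b p).1) /\ continuous (fun p => (half_turn a b p).2).
Proof.
split; last exact: cross_sub_continuous.
move=> p; apply: cvgD; last exact: dot_sub_continuous.
by apply: cvgM; exact: nrm_sub_continuous.
Qed.

Lemma half_turns_continuous a s :
  continuous (fun p => (half_turns a s p).1) /\ continuous (fun p => (half_turns a s p).2).
Proof.
elim: s a => [|b s IH] a /=; first by split; exact: cst_continuous.
have [h1 h2] := half_turn_continuous a b; have [h3 h4] := IH b.
split=> p.
  by apply: cvgB; apply: cvgM; [exact: h1|exact: h3|exact: h2|exact: h4].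
by apply: cvgD; apply: cvgM; [exact: h1|exact: h4|exact: h2|exact: h3].
Qed.

(** Around a closed polygon the half turns multiply to a real number, positive or negative according
    to the parity of the winding number about [p]; this is its real part. *)
Definition closed_turn a s p : R :=
  (cmul (half_turns a s p) (half_turn (last a s) a p)).1.

Lemma closed_turn_continuous a s : continuous (closed_turn a s).
Proof.
have [h1 h2] := half_turn_continuous (last a s) a; have [h3 h4] := half_turns_continuous a s.
move=> p; apply: cvgB; apply: cvgM; [exact: h3|exact: h1|exact: h4|exact: h2].
Qed.

(** The square of the full product telescopes to a positive real number, so its real part cannot
    vanish. *)
Lemma closed_turn_neq0 a s p : ~ on_polyline a s p -> ~ seg (last a s) a p ->
  closed_turn a s p != 0.
Proof.
move=> np ns; have [l l0 hl] := half_turns_sqr np; have h0 := off_seg_gt0 ns.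
set S := half_turns a s p in hl; set H := half_turn (last a s) a p.
have HH := half_turn_sqr (last a s) a p; rewrite -/H in HH.
move: h0 HH; move: (nrm _ * _ + _) => k h0 HH.
set x := a - p in hl HH; set y := last a s - p in hl HH.
have y0 : dot y y != 0.
  rewrite -nrm_sqr expf_neq0// gt_eqF// nrm_gt0// subr_eq0; apply/eqP => h.
  by apply: ns; rewrite -h; exact: seg_left.
have x0 : dot x x != 0.
  rewrite -nrm_sqr expf_neq0// gt_eqF// nrm_gt0// subr_eq0; apply/eqP => h.
  by apply: ns; rewrite -h; exact: seg_right.
have sq : (cmul S H).1 ^+ 2 - (cmul S H).2 ^+ 2 = 2 * k * l * (dot x x * dot y y).
  have -> : (cmul S H).1 ^+ 2 - (cmul S H).2 ^+ 2 = (cmul (cmul S S) (cmul H H)).1.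
    by rewrite /cmul /=; ring.
  rewrite hl HH !scale_conj_mul /cmul /dot /cross /=; ring.
have pos : 0 < (cmul S H).1 ^+ 2 - (cmul S H).2 ^+ 2.
  rewrite sq; apply: mulr_gt0; first by apply: mulr_gt0 l0; apply: mulr_gt0.
  by apply: mulr_gt0; rewrite lt_neqAle eq_sym ?x0 ?y0 dot_ge0.
apply/eqP => T0; move: pos; rewrite -/(closed_turn a s p) T0 expr0n /= sub0r oppr_gt0.
by rewrite ltNge sqr_ge0.
Qed.

(* [closed_turn] changes sign across the closing edge. *)
Lemma closed_turn_flip a s m : ~ on_polyline a s m ->
  cross (a - m) (last a s - m) = 0 -> dot (a - m) (last a s - m) < 0 ->
  exists2 y : R, y != 0 & \forall p \near m,
    cross (a - p) (last a s - p) != 0 ->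
    ~ on_polyline a s p -> 0 < y * closed_turn a s p * cross (a - p) (last a s - p).
Proof.
move=> nm c0 d0; have [l l0] := half_turns_sqr nm.
rewrite scale_conj_mul /cmul c0 => -[h1 h2].
(* On the closing edge the square of the open product is a negative real number, so the product
   itself is purely imaginary and [y] is nonzero. *)
set y := (half_turns a s m).2 in h1 h2.
have y0 : y != 0.
  apply/eqP => y0; rewrite y0 mulr0 subr0 in h1.
  have := sqr_ge0 (half_turns a s m).1; rewrite expr2 h1.
  by rewrite leNgt nmulr_llt0// l0.
exists y => //.
have ny : \forall p \near m, 0 < y * (half_turns a s p).2.
  have cy : continuous (fun p => y * (half_turns a s p).2).
    by move=> p; apply: cvgM; [exact: cvg_cst|exact: (half_turns_continuous a s).2].
  apply: open_nbhs_nbhs; split.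
    apply: (@open_comp _ _ (fun p => y * (half_turns a s p).2) [set x | 0 < x]); last exact: open_gt.
    by move=> ? _; exact: cy.
  by rewrite /= -/y -expr2 exprn_even_gt0.
apply: filterS ny => p yp cp np.
have [l' l'0] := half_turns_sqr np.
rewrite scale_conj_mul /cmul => -[_ k2].
set X := (half_turns a s p).1 in k2; set Y := (half_turns a s p).2 in k2 yp.
set k := cross _ _ in k2 cp *.
have E : closed_turn a s p = X * (nrm (last a s - p) * nrm (a - p) + dot (last a s - p) (a - p)) + Y * k.
  rewrite /closed_turn /cmul /half_turn /= -/X -/Y /k /cross; ring.
have h0 : 0 <= nrm (last a s - p) * nrm (a - p) + dot (last a s - p) (a - p).
  have := ler_norm_dot (last a s - p) (a - p); rewrite ler_norml => /andP[]; lra.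
move: E h0; set W := _ + dot _ _ => E W0.
have Y0 : Y != 0 by apply: contraTneq yp => ->; rewrite mulr0 ltxx.
have k20 : 0 < k ^+ 2 by rewrite exprn_even_gt0.
have Y20 : 0 < Y ^+ 2 by rewrite exprn_even_gt0.
(* The imaginary part of the square gives [2 X Y = l' k]; substituted in [E], it leaves [k^2] times
   a positive number. *)
have pos : 0 < Y * closed_turn a s p * k.
  have -> : Y * closed_turn a s p * k = k ^+ 2 * (2^-1 * l' * W + Y ^+ 2).
    have : X * Y = 2^-1 * (l' * k) by rewrite -k2; field.
    rewrite E => XY.
    have -> : Y * (X * W + Y * k) * k = (X * Y) * W * k + Y ^+ 2 * k ^+ 2 by ring.
    by rewrite XY; ring.
  apply: mulr_gt0 => //; apply: ltr_wpDl => //.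
  by apply: mulr_ge0 W0; apply: mulr_ge0 (ltW l'0); rewrite invr_ge0.
have : 0 < (y * Y) * (Y * closed_turn a s p * k) by apply: mulr_gt0.
have -> : (y * Y) * (Y * closed_turn a s p * k) = Y ^+ 2 * (y * closed_turn a s p * k) by ring.
by rewrite pmulr_rgt0.
Qed.

End HalfAngle.

(** * The outer boundary *)

Section OuterFace.
Variables (R : realType) (G : orthodiagonal_map R).
Implicit Types (x y : primal G) (u v w : dual G) (Q : quad G) (p q m : R * R).
Notation D := (drawing_set G).
Notation O := (outer_face G).

Lemma outer_off_drawing p : O p -> ~ D p.
Proof. by move=> [F [[p0 h ->] _]] /connected_component_sub. Qed.

Lemma outer_component p : O p -> ~ bounded_set (connected_component (~` D) p).
Proof. by move=> [F [[p0 h ->] nb Fp]]; rewrite -(connected_component_eq Fp). Qed.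

Lemma region_or_outer p : ~ D p -> (exists Q, region Q p) \/ O p.
Proof.
move=> Dp; have [b|nb] := pselect (bounded_set (connected_component (~` D) p)).
  left; have : [set F | inner_face G F] (connected_component (~` D) p).
    by split => //; exists p.
  by rewrite -od_region_faces => -[Q _ hQ]; exists Q; rewrite hQ; exact: connected_component_refl.
right; exists (connected_component (~` D) p); split => //; first by exists p.
exact: connected_component_refl.
Qed.

Lemma region_not_outer Q p : region Q p -> ~ O p.
Proof.
move=> Qp /outer_component; apply; rewrite -(region_component Qp).
exact: region_bounded.
Qed.

Lemma connected_sub_outer (A : set (R * R)) p : connected A -> A `<=` ~` D ->
  A p -> O p -> A `<=` O.
Proof.
move=> cA AD Ap [F [[p0 h FE] nb Fp]]; have := Fp; rewrite FE => Fp' q Aq.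
exists F; split => //; first by exists p0.
rewrite FE (connected_component_eq Fp').
exact: (connected_component_max Ap AD cA) q Aq.
Qed.

Lemma near_off_drawing p : ~ D p -> exists2 r : R, 0 < r & ball p r `<=` ~` D.
Proof. by move=> /(near_closed_out (@closed_drawing R G))/near_plane. Qed.

Lemma frontier_outer p : frontier O p <-> closure O p /\ D p.
Proof.
split=> [[clp nip]|[clp Dp]]; split => //; last first.
  by move=> /interior_subset/outer_off_drawing.
apply: contrapT => /near_off_drawing[r r0 rD]; apply: nip.
have [q Oq pq] := (closure_near _ _).1 clp r r0.
apply/nbhs_ballP; exists r => //; apply: connected_sub_outer pq Oq => //.
by apply: convex_connected; exact: convex_ball.
Qed.

Lemma hat_not_closure_outer p : hat_domain G p -> ~ closure O p.
Proof.
move=> hp clp; have : nbhs p (hat_domain G).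
  by apply: open_nbhs_nbhs; split => //; exact: open_interior.
move=> /clp [q [Oq /interior_subset[/(outer_off_drawing Oq)//|[Q _ Qq]]]].
exact: region_not_outer Qq Oq.
Qed.

Lemma hat_not_bdry x : hat_domain G (ppos x) -> ~ bdry x.
Proof. by move=> /hat_not_closure_outer h [/h]. Qed.

Lemma not_hat_closure_outer p : ~ hat_domain G p -> closure O p.
Proof.
move=> np; apply/closure_near => r r0; apply: contrapT => nO; apply: np.
apply/nbhs_ballP; exists r => // q pq.
have [Dq|nDq] := pselect (D q); first by left.
have [[Q Qq]|Oq] := region_or_outer nDq; first by right; exists Q.
by case: nO; exists q.
Qed.

Lemma dist_to_le p (A : set (R * R)) q : A q -> dist_to p A <= eucl p q.
Proof.
move=> Aq; apply: ge_inf; last by exists q.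
by exists 0 => _ [q' _ <-]; rewrite eucl_nrm nrm_ge0.
Qed.

Lemma dist_hat_sub p q : hat_domain G p -> nrm (q - p) < dist_to p (frontier (hat_domain G)) ->
  hat_domain G q.
Proof.
move=> hp pq; suff : seg p q `<=` hat_domain G by apply; exact: seg_right.
apply: connected_sub_frontier; first exact: connected_seg.
  by exists p; split => //; exact: seg_left.
apply/seteqP; split => // _ [[t /= t01 <-]] /(dist_to_le p) h.
have := lt_le_trans pq h; rewrite eucl_nrm.
have -> : p - ((1 - t) * p.1 + t * q.1, (1 - t) * p.2 + t * q.2) = (- t) *: (q - p).
  by coordwise ring.
move: t01; rewrite in_itv /= => /andP[t0 t1].
by rewrite nrmZ normrN ger0_norm// ltNge ler_piMl ?nrm_ge0.
Qed.

Lemma near_edge_line x u m : inner_point x u m ->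
  \forall q \near m, edge_cross x u q = 0 -> edge_seg x u q.
Proof.
move=> [sm mx mu]; set v : R * R := dpos u - ppos x.
have v0 : dot v v != 0 by rewrite -nrm_sqr expf_neq0// gt_eqF// nrm_gt0// edge_vector_neq0.
pose lam p := dot (p - ppos x) v / dot v v.
have al : is_affine lam.
  have [a [b [c h]]] := is_affineZ (dot v v)^-1 (is_affine_dot (ppos x) v).
  by exists a, b, c => p; rewrite -h /lam mulrC.
have al' : is_affine (fun p => 1 - lam p).
  have [a [b [c h]]] := is_affineD (is_affine_cst 1) (is_affineZ (-1) al).
  by exists a, b, c => p; rewrite -h mulN1r.
have [t t01 tm] := sm; rewrite /= in_itv /= in t01; case/andP: t01 => t0 t1.
have lm : lam m = t.
  rewrite -tm /lam /= -[RHS](mulfK v0); congr (_ / _); rewrite /v /dot /=; ring.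
have l0 : 0 < lam m.
  rewrite lm lt_neqAle eq_sym t0 andbT; apply/eqP => tt; apply: mx.
  by rewrite -tm tt subr0 !mul1r !mul0r !addr0; case: (ppos x).
have l1 : 0 < 1 - lam m.
  rewrite lm subr_gt0 lt_neqAle t1 andbT; apply/eqP => tt; apply: mu.
  by rewrite -tm tt subrr !mul1r !mul0r !add0r; case: (dpos u).
apply: filterS2 (near_is_affine_gt0 al l0) (near_is_affine_gt0 al' l1) => q q0 q1 cq.
exists (lam q).
  by rewrite /= in_itv /= (ltW q0) -subr_ge0 (ltW q1).
have e1 : dot v v * (q.1 - (ppos x).1) = dot (q - ppos x) v * v.1.
  apply/eqP; rewrite -subr_eq0; apply/eqP.
  by transitivity (- v.2 * edge_cross x u q);
    [rewrite /edge_cross -/v /cross /dot /=; ring|rewrite cq mulr0].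
have e2 : dot v v * (q.2 - (ppos x).2) = dot (q - ppos x) v * v.2.
  apply/eqP; rewrite -subr_eq0; apply/eqP.
  by transitivity (v.1 * edge_cross x u q);
    [rewrite /edge_cross -/v /cross /dot /=; ring|rewrite cq mulr0].
have f1 : q.1 = (ppos x).1 + lam q * v.1.
  apply: (mulfI v0); rewrite mulrDr /lam mulrAC -e1; field; exact: v0.
have f2 : q.2 = (ppos x).2 + lam q * v.2.
  apply: (mulfI v0); rewrite mulrDr /lam mulrAC -e2; field; exact: v0.
by rewrite [RHS]surjective_pairing f1 f2 /v /=; congr pair; ring.
Qed.

Lemma outer_half_ball x u m : adj x u -> inner_point x u m -> closure O m ->
  exists r s : R, [/\ 0 < r, s != 0 & half_ball x u m r s `<=` O].
Proof.
move=> xu im clm.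
have [r1 r10 h1] := near_plane (near_edge_line im).
have [r [r0 rr1 hD]] : exists r, [/\ 0 < r, r <= r1 & forall s, half_ball x u m r s `<=` ~` D].
  near (0 : R)^'+ => r; exists r; split.
  - by near: r; exact: nbhs_right_gt.
  - by near: r; exact: nbhs_right_le.
  - by near: r; exact: half_ball_off_drawing.
have [q Oq mq] := (closure_near _ _).1 clm r r0.
have cq : edge_cross x u q != 0.
  apply/eqP => cq; apply: (outer_off_drawing Oq); apply: (edge_sub_drawing xu).
  by apply: h1 => //; apply: le_ball mq.
exists r, (edge_cross x u q); split => //.
apply: (connected_sub_outer _ (hD _) _ Oq).
  by apply: convex_connected; exact: half_ball_convex.
by split => //=; rewrite -expr2 exprn_even_gt0.
Unshelve. all: by end_near. Qed.

Lemma half_ball_closure x u m q r s : edge_seg x u q -> ball m r q -> s != 0 ->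
  closure (half_ball x u m r s) q.
Proof.
move=> sq mq s0; apply/closure_near => r' r'0.
have : \forall p \near q, ball m r p /\ ball q r' p.
  near=> p; split; near: p; last exact: nbhsx_ballx.
  by apply: open_nbhs_nbhs; split => //; exact: ball_open.
move=> /near_plane[r'' r''0 h].
have [p [bp hp]] := half_ball_nonempty sq r''0 s0.
by have [h1 h2] := h p bp; exists p.
Unshelve. all: by end_near. Qed.

Lemma inner_pointP x u m : inner_point x u m <->
  exists2 t : R, 0 < t < 1 & m = ppos x + t *: (dpos u - ppos x).
Proof.
set v : R * R := dpos u - ppos x.
have v0 : v != 0 by exact: edge_vector_neq0.
have E (t : R) : ((1 - t) * (ppos x).1 + t * (dpos u).1, (1 - t) * (ppos x).2 + t * (dpos u).2)
    = ppos x + t *: v.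
  by rewrite /v; coordwise ring.
have E0 (t : R) : (ppos x + t *: v == ppos x) = (t == 0).
  by rewrite -subr_eq0 addrC addKr scaler_eq0 (negPf v0) orbF.
have E1 (t : R) : (ppos x + t *: v == dpos u) = (t == 1).
  have -> : ppos x + t *: v = dpos u - (1 - t) *: v.
    by rewrite -E /v; coordwise ring.
  by rewrite -subr_eq0 addrC addKr oppr_eq0 scaler_eq0 (negPf v0) orbF subr_eq0 eq_sym.
split=> [[[t t01 tm] mx mu]|[t /andP[t0 t1] ->]].
  rewrite E in tm; exists t => //; rewrite -tm in mx mu.
  move: t01; rewrite /= in_itv /= => /andP[t0 t1]; rewrite !lt_neqAle t0 t1 !andbT eq_sym.
  by rewrite -E0 -E1; apply/andP; split; apply/eqP.
split.
- by exists t; rewrite ?E//= in_itv /= !ltW.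
- by apply/eqP; rewrite E0 gt_eqF.
- by apply/eqP; rewrite E1 lt_eqF.
Qed.

Lemma inner_segment_convex x u : convex_set [set m | inner_point x u m].
Proof.
move=> p q /= /inner_pointP[a /andP[a0 a1] ->] /inner_pointP[b /andP[b0 b1] ->] _ [t t01 <-] /=.
apply/inner_pointP; exists ((1 - t) * a + t * b); last first.
  by coordwise ring.
move: t01; rewrite /= in_itv /= => t01.
rewrite conv_gt0//= -subr_gt0.
have -> : 1 - ((1 - t) * a + t * b) = (1 - t) * (1 - a) + t * (1 - b) by ring.
by apply: conv_gt0 => //; rewrite subr_gt0.
Qed.

(** Where the outer face touches an open edge it contains a whole half ball, so the points of the
    edge it touches form a relatively clopen subset, hence the full open edge, whose closure
    contains [ppos x]. *)
Lemma outer_edge x u m : adj x u -> inner_point x u m -> closure O m ->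
  closure O (ppos x).
Proof.
move=> xu im clm.
pose S : set (R * R) := [set q | inner_point x u q].
have SO : S `&` closure O = S.
  have /(_ (S `&` closure O)) := convex_connected (@inner_segment_convex x u); apply.
  - by exists m.
  - exists [set q | S q -> closure O q]^°; first exact: open_interior.
    apply/seteqP; split => q [Sq].
      move=> clq; split => //.
      have [r [s [r0 s0 hO]]] := outer_half_ball xu Sq clq.
      apply/nbhs_ballP; exists r => // q' qq' [sq' _ _].
      exact: closure_subset hO _ (half_ball_closure sq' qq' s0).
    by move=> /interior_subset h; split => //; exact: h.
  - by exists (closure O) => //; exact: closed_closure.
have : closure (closure O) (ppos x).
  move=> A /(inner_point_near xu)[q iq Aq]; exists q; split => //.
  by have : S q by []; rewrite -SO => -[].
by rewrite -((closure_id _).1 (@closed_closure _ _)).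
Qed.

Notation J := (frontier O).

Lemma vertex_boundary_infinite : exists2 p, J p & forall z, @vpos R G z <> p.
Proof.
have [g [cg g01 ig gJ]] := od_outer_boundary G.
apply: contrapT => nv.
have Jv p : J p -> exists z, @vpos R G z = p.
  move=> Jp; apply: contrapT => nz; apply: nv; exists p => // z zp.
  by apply: nz; exists z.
(* One more point of the curve than there are vertices; the parameters [i / N] stay below [1], where
   [g] is injective. *)
pose N := #|{: primal G + dual G}|.+1.
pose t (i : 'I_N) : R := i%:R / N%:R.
have N0 : 0 < N%:R :> R by rewrite ltr0n.
have t01 i : 0 <= t i < 1.
  by rewrite divr_ge0 ?ler0n//= ltr_pdivrMr// mul1r ltr_nat.
have Jt i : J (g (t i)).
  have /andP[h1 h2] := t01 i.
  by rewrite -gJ; exists (t i) => //; rewrite /= in_itv /= h1 ltW.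
have mem01 (a : R) : 0 <= a < 1 -> a \in `[0, 1[%R by rewrite in_itv.
have /choice[z zE] : forall i, exists z, @vpos R G z = g (t i) by move=> i; exact: Jv.
have zi : injective z.
  move=> i j zij; have : g (t i) = g (t j) by rewrite -!zE zij.
  move=> /(ig _ _ (mem01 _ (t01 i)) (mem01 _ (t01 j))); rewrite /t => /(mulIf (invr_neq0 (lt0r_neq0 N0))).
  by move=> /eqP; rewrite eqr_nat => /eqP/val_inj.
by have := leq_card z zi; rewrite card_ord ltnn.
Qed.

Lemma boundary_edge : exists x u m, [/\ adj x u, inner_point x u m & closure O m].
Proof.
have [p /frontier_outer[clp Dp] pv] := vertex_boundary_infinite.
case: Dp => [[z zp]|[x [u [xu px]]]]; first by case: (pv z).
exists x, u, p; split => //; split => // h; [apply: (pv (inl x))|apply: (pv (inr u))].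
  by [].
by [].
Qed.

Lemma bdry_nonempty : exists x, @bdry R G x.
Proof.
have [x [u [m [xu im clm]]]] := boundary_edge; exists x.
by apply/frontier_outer; split; [exact: outer_edge im clm|left; exists (inl x)].
Qed.

Lemma incident_edge x : exists u, adj x u.
Proof.
have [y [w _]] := boundary_edge.
have /connectP[[|[z|u] s]//= /andP[xu _] _] := od_connected (inl x : primal G + dual G) (inr w).
by exists u.
Qed.

(** A closed curve without a point is the image of an open interval, or of two half-open intervals
    whose images share [g 0 = g 1]. *)
Lemma connected_boundary_minus m : J m -> connected (J `&` [set p | p <> m]).
Proof.
have [g [cg g01 ig gJ]] := od_outer_boundary G.
have cimg (I : set R) : is_interval I -> I `<=` `[0, 1] -> connected (g @` I).
  move=> iI I01; apply: connected_continuous_connected; first by apply/connected_intervalP.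
  exact: continuous_subspaceW cg.
have mem01 (a : R) : 0 <= a < 1 -> a \in `[0, 1[%R by rewrite in_itv.
have gI (t t' : R) : 0 <= t <= 1 -> 0 <= t' <= 1 -> g t = g t' ->
    t = t' \/ ((t = 0 /\ t' = 1) \/ (t = 1 /\ t' = 0)).
  have h (s : R) : 0 <= s <= 1 -> s = 1 \/ s \in `[0, 1[%R.
    move=> /andP[s0]; rewrite le_eqVlt => /orP[/eqP|s1]; first by left.
    by right; apply: mem01; rewrite s0.
  have z01 : (0 : R) \in `[0, 1[%R by apply: mem01; rewrite lexx ltr01.
  move=> /h[->|i1] /h[->|i2] gg; first by left.
  - right; right; split => //; apply/esym; apply: ig => //.
    by rewrite g01.
  - right; left; split => //; apply: ig => //.
    by rewrite g01.
  - by left; exact: ig.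
rewrite -{1}gJ => -[t0 t01 <-].
have [t00|t00] := pselect (g t0 = g 0).
  have -> : J `&` [set p | p <> g t0] = g @` `]0, 1[.
    apply/seteqP; split => p.
      rewrite -gJ => -[[t t1 <-]]; rewrite /= t00 => tn; exists t => //.
      move: t1; rewrite /= !in_itv /= => /andP[t1 t2].
      rewrite !lt_neqAle t1 t2 !andbT; apply/andP; split; apply/eqP => h; apply: tn.
        by rewrite -h.
      by rewrite h g01.
    move=> [t t1 <-]; have {}t1 : 0 < t < 1 by move: t1; rewrite /= in_itv.
    have ti : 0 <= t <= 1 by lra.
    split; first by rewrite -gJ; exists t => //; rewrite /= in_itv.
    have z0 : 0 <= (0 : R) <= 1 by rewrite lexx ler01.
    by rewrite /= t00 => /(gI _ _ ti z0) [|[[]|[]]]; lra.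
  apply: cimg; first exact: interval_is_interval.
  by move=> t /=; rewrite !in_itv /=; lra.
have {}t01 : 0 <= t0 <= 1 by move: t01; rewrite /= in_itv.
have t0p : 0 < t0 < 1.
  move: (t01) => /andP[t1 t2].
  rewrite !lt_neqAle t1 t2 !andbT; apply/andP; split; apply/eqP => h; apply: t00.
    by rewrite -h.
  by rewrite h g01.
have -> : J `&` [set p | p <> g t0] = g @` `[0, t0[ `|` g @` `]t0, 1].
  apply/seteqP; split => p.
    rewrite -gJ => -[[t t1 <-]] /= tn; move: t1; rewrite /= in_itv /= => /andP[t1 t2].
    have [tt|tt|tt] := ltgtP t t0.
    - by left; exists t => //; rewrite /= in_itv /= t1.
    - by right; exists t => //; rewrite /= in_itv /= t2 tt.
    - by case: tn; rewrite tt.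
  have gt (t : R) : 0 <= t <= 1 -> t <> t0 -> (J `&` [set p | p <> g t0]) (g t).
    move=> ti tn; split; first by rewrite -gJ; exists t => //; rewrite /= in_itv.
    by rewrite /= => /(gI _ _ ti t01) [//|[[]|[]]]; lra.
  by move=> [[t tt <-]|[t tt <-]]; apply: gt; move: tt; rewrite /= !in_itv /=; lra.
apply: connectedU.
- exists (g 0); split; first by exists 0 => //; rewrite /= in_itv /=; lra.
  by exists 1; rewrite ?g01//= in_itv /=; lra.
- by apply: cimg; [exact: interval_is_interval|move=> t; rewrite /= !in_itv /=; lra].
- by apply: cimg; [exact: interval_is_interval|move=> t; rewrite /= !in_itv /=; lra].
Qed.

End OuterFace.

(** * Vertices at positive distance from the boundary are inner *)

Section VertexInHat.
Variables (R : realType) (G : orthodiagonal_map R).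
Implicit Types (x y : primal G) (u v w : dual G) (Q : quad G) (p q : R * R).
Notation D := (drawing_set G).
Notation O := (outer_face G).
Notation J := (frontier O).

Lemma drawing_bounded : exists2 M : R, 0 <= M & forall p, D p -> `|p.1| <= M /\ `|p.2| <= M.
Proof.
pose N p : R := `|p.1| + `|p.2|.
have N0 p : 0 <= N p by rewrite addr_ge0.
pose M := \sum_(z : primal G + dual G) N (vpos z).
have NM z : N (@vpos R G z) <= M.
  by rewrite /M (bigD1 z)//= lerDl sumr_ge0.
have M0 : 0 <= M by exact: sumr_ge0.
have vM z : `|(@vpos R G z).1| <= M /\ `|(@vpos R G z).2| <= M.
  have h := NM z; rewrite /N in h.
  have h1 := normr_ge0 (@vpos R G z).1; have h2 := normr_ge0 (@vpos R G z).2.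
  split; [apply: le_trans h; rewrite lerDl//|apply: le_trans h; rewrite lerDr//].
exists M => // p [[z <-]|[x [u [_ [t t01 <-]]]]]; first exact: vM.
have [x1 x2] := vM (inl x); have [u1 u2] := vM (inr u).
move: t01; rewrite /= in_itv /= => /andP[t0 t1].
have cv (a b : R) : `|a| <= M -> `|b| <= M -> `|(1 - t) * a + t * b| <= M.
  have t1' : 0 <= 1 - t by rewrite subr_ge0.
  move=> ha hb; apply: le_trans (ler_normD _ _) _.
  rewrite !normrM (ger0_norm t0) (ger0_norm t1').
  have h1 : (1 - t) * `|a| <= (1 - t) * M by rewrite ler_wpM2l// subr_ge0.
  have h2 : t * `|b| <= t * M by rewrite ler_wpM2l.
  lra.
by split; apply: cv.
Qed.

Section Edge.
Variables (z : primal G) (u : dual G) (m : R * R).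
Hypotheses (zu : adj z u) (im : inner_point z u m).

Definition edge_removed : rel (primal G + dual G) := fun a b =>
  vadj a b && ((a, b) != (inl z, inr u)) && ((a, b) != (inr u, inl z)).

Lemma edge_removed_sym a b : edge_removed a b = edge_removed b a.
Proof.
rewrite /edge_removed; have -> : @vadj R G a b = vadj b a by case: a; case: b.
rewrite -andbA [X in _ && X]andbC andbA.
congr (_ && _ && _); rewrite !xpair_eqE andbC; congr negb; by rewrite andbC.
Qed.

Lemma edge_removed_adj y w : adj y w -> (y, w) != (z, u) -> edge_removed (inl y) (inr w).
Proof.
move=> yw ne; rewrite /edge_removed /= yw /= andbT.
by apply: contra ne; rewrite !xpair_eqE.
Qed.

(* Otherwise the parts of the drawing joined to the two ends would meet at [m] only, and so
   would separate [J] with [m] removed. *)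
Lemma edge_removed_connect :
  (\forall q \near m, edge_seg z u q -> J q) -> connect edge_removed (inr u) (inl z).
Proof.
move=> mJ; apply: contrapT => /negP nc.
pose reach := connect edge_removed (inr u).
have reach_edge y w : adj y w -> (y, w) != (z, u) -> reach (inl y) = reach (inr w).
  move=> yw ne; have e1 := edge_removed_adj yw ne.
  apply/idP/idP => h; apply: connect_trans h _; apply: connect1 => //.
  by rewrite edge_removed_sym.
(* [K true] gathers the vertices reachable from [u] without the edge, with the edges at them, and
   [K false] the rest. The removed edge is cut at [m] and each half goes with its own end. *)
pose K (b : bool) : set (R * R) :=
  (\bigcup_(a in [set a | reach a = b]) [set vpos a]) `|`
  (\bigcup_(yw in [set yw : primal G * dual G | [/\ adj yw.1 yw.2, yw != (z, u) & reach (inr yw.2) = b]])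
     edge_seg yw.1 yw.2) `|`
  (if b then seg m (dpos u) else seg (ppos z) m).
have cK b : closed (K b).
  apply: closedU; [apply: closedU; apply: closed_bigcup|].
  - exact: finite_finset.
  - move=> a _; apply: compact_closed; [exact: norm_hausdorff|exact: compact_set1].
  - exact: finite_finset.
  - by move=> yw _; exact: closed_seg.
  - by case: b; exact: closed_seg.
have [t t01 mE] := (inner_pointP _ _ _).1 im.
set d : R * R := dpos u - ppos z in mE.
have d0 : d != 0 by exact: edge_vector_neq0.
have zd (s s' : R) : ppos z + s *: d = ppos z + s' *: d -> s = s'.
  move=> /addrI/eqP; rewrite -subr_eq0 -scalerBl scaler_eq0 (negPf d0) orbF subr_eq0.
  by move/eqP.
case/andP: t01 => t0 t1.
have seg1 p : seg (ppos z) m p <-> exists2 s, 0 <= s <= t & p = ppos z + s *: d.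
  rewrite mE; split=> [[s s01 <-]|[s /andP[s0 s1] ->]].
    move: s01; rewrite /= in_itv /= => /andP[s0 s1]; exists (s * t).
      by rewrite mulr_ge0 ?(ltW t0)//= ler_piMl// ltW.
    by coordwise ring.
  have tn : t != 0 by rewrite gt_eqF.
  exists (s / t); first by rewrite /= in_itv /= divr_ge0 ?(ltW t0)//= ler_pdivrMr// mul1r.
  by coordwise field.
have seg2 p : seg m (dpos u) p <-> exists2 s, t <= s <= 1 & p = ppos z + s *: d.
  have uE : dpos u = ppos z + 1 *: d by rewrite scale1r /d addrC subrK.
  have tn : 1 - t != 0 by rewrite subr_eq0 gt_eqF.
  have tp : 0 < 1 - t by rewrite subr_gt0.
  rewrite mE uE; split=> [[s s01 <-]|[s /andP[s0 s1] ->]].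
    move: s01; rewrite /= in_itv /= => /andP[s0 s1]; exists (t + s * (1 - t)).
      rewrite lerDl mulr_ge0 ?(ltW tp)//=.
      have : s * (1 - t) <= 1 - t by rewrite ler_piMl// ltW.
      lra.
    by coordwise ring.
  exists ((s - t) / (1 - t)).
    by rewrite /= in_itv /= divr_ge0 ?subr_ge0 ?(ltW t1)//= ler_pdivrMr// mul1r lerD2r.
  by coordwise field.
have seg12 b p : (if b then seg m (dpos u) else seg (ppos z) m) p -> edge_seg z u p.
  move=> h; have [s s01 ->] : exists2 s : R, 0 <= s <= 1 & p = ppos z + s *: d.
    by case: b h => [/seg2|/seg1] [s /andP[s0 s1] ->]; exists s => //; split_lra.
  exists s; first by rewrite /= in_itv.
  by rewrite /d; coordwise ring.
have vK a b : K b (vpos a) -> reach a = b.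
  move=> [[[a' <- /vpos_inj ->]//|[[y w] /= [yw ne <-] ha]]|ha].
    have [->|->] := vertex_on_edge yw ha; last by [].
    exact: reach_edge.
  have [ae|ae] := vertex_on_edge zu (seg12 _ _ ha); subst a.
    case: b ha => [/seg2[s /andP[s0 s1] sE]|_]; last by apply/negbTE.
    have : ppos z + 0 *: d = ppos z + s *: d by rewrite -sE scale0r addr0.
    by move=> /zd; lra.
  case: b ha => [_|/seg1[s /andP[s0 s1] sE]]; first by rewrite /reach connect0.
  have : ppos z + 1 *: d = ppos z + s *: d by rewrite -sE scale1r /d addrC subrK.
  by move=> /zd; lra.
have K12 p : K true p -> K false p -> p = m.
  move=> k1 k2; have [[a ap]|nv] := pselect (exists a, @vpos R G a = p).
    by rewrite -ap in k1 k2; have := vK _ _ k1; rewrite (vK _ _ k2).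
  have cert b : K b p -> (exists y w, [/\ adj y w, (y, w) != (z, u), reach (inr w) = b & edge_seg y w p])
      \/ (if b then seg m (dpos u) else seg (ppos z) m) p.
    move=> [[[a _ ap]|[[y w] /= [yw ne ra] h]]|h]; first by case: nv; exists a.
      by left; exists y, w.
    by right.
  have same y w y' w' : adj y w -> adj y' w' -> edge_seg y w p -> edge_seg y' w' p -> y = y' /\ w = w'.
    by move=> h1 h2 h3 h4; have [//|] := edges_meet h1 h2 h3 h4.
  case: (cert _ k1) => [[y [w [yw ne rw yp]]]|p1]; case: (cert _ k2) => [[y' [w' [yw' ne' rw' yp']]]|p2].
  - by have [_ ww] := same _ _ _ _ yw yw' yp yp'; move: rw'; rewrite -ww rw.
  - have [e1 e2] := same _ _ _ _ yw zu yp (seg12 false p p2).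
    by move: ne; rewrite e1 e2 eqxx.
  - have [e1 e2] := same _ _ _ _ yw' zu yp' (seg12 true p p1).
    by move: ne'; rewrite e1 e2 eqxx.
  - case/seg2: p1 => s /andP[s0 s1] sE; case/seg1: p2 => s' /andP[s'0 s'1] sE'.
    have ss : s = s' by apply: zd; rewrite -sE -sE'.
    by rewrite sE mE; congr (_ + _ *: _); lra.
have DK : D `<=` K true `|` K false.
  move=> p [[a <-]|[y [w [yw yp]]]].
    have [ra|ra] := boolP (reach a); [left|right]; left; left; exists a => //=.
    exact/negbTE.
  case: (eqVneq (y, w) (z, u)) => [[ey ew]|ne].
    subst y w; move: yp => [s s01 sE]; move: s01; rewrite /= in_itv /= => /andP[s0 s1].
    have pE : p = ppos z + s *: d.
      by rewrite -sE /d; coordwise ring.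
    have [st|ts] := leP s t.
      by right; right; apply/seg1; exists s; rewrite ?s0.
    by left; right; apply/seg2; exists s; rewrite ?s1 ?andbT// ltW.
  have [ra|ra] := boolP (reach (inr w)); [left|right]; left; right; exists (y, w) => //=.
  by split => //; exact/negbTE.
have [r r0 rJ] := near_plane mJ.
have n0 : 0 < `|d.1| + `|d.2| + 1 by rewrite ltr_wpDl ?addr_ge0.
(* Small enough that the points of parameters [t - sg] and [t + sg] stay on the edge and within the
   ball where the edge lies in [J]. *)
pose sg : R := Num.min (Num.min (t / 2) ((1 - t) / 2)) (r / (2 * (`|d.1| + `|d.2| + 1))).
have sg0 : 0 < sg.
  by rewrite !lt_min !divr_gt0 ?subr_gt0//= mulr_gt0.
have sgt : sg <= t / 2 by rewrite !ge_min lexx.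
have sgt' : sg <= (1 - t) / 2 by rewrite !ge_min lexx !orbT.
have sgr : sg * (`|d.1| + `|d.2| + 1) <= r / 2.
  have h : sg <= r / (2 * (`|d.1| + `|d.2| + 1)) by rewrite /sg ge_min lexx orbT.
  apply: le_trans (ler_wpM2r (ltW n0) h) _.
  have -> : r / (2 * (`|d.1| + `|d.2| + 1)) * (`|d.1| + `|d.2| + 1) = r / 2.
    by field; rewrite gt_eqF.
  exact: lexx.
have Jpt (s : R) : `|s - t| <= sg -> J (ppos z + s *: d).
  move=> st; have pE : ppos z + s *: d = m + (s - t) *: d by rewrite mE -addrA -scalerDl addrC [t + _]addrC subrK addrC.
  have s01 : 0 <= s <= 1.
    by move: st; rewrite ler_norml => /andP[h1 h2]; split_lra.
  apply: rJ; last first.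
    exists s; first by rewrite /= in_itv.
    by rewrite /d; coordwise ring.
  have h1 := normr_ge0 d.1; have h2 := normr_ge0 d.2.
  have h3 : `|s - t| * `|d.1| <= sg * `|d.1| by rewrite ler_wpM2r.
  have h4 : `|s - t| * `|d.2| <= sg * `|d.2| by rewrite ler_wpM2r.
  have h5 : 0 <= sg * `|d.1| by rewrite mulr_ge0// ltW.
  have h6 : 0 <= sg * `|d.2| by rewrite mulr_ge0// ltW.
  rewrite pE; apply/plane_ballP; rewrite /= /GRing.scale /=.
  by split; rewrite opprD addrA subrr sub0r normrN normrM; lra.
have sgn : `|sg| = sg by rewrite gtr0_norm.
set qp := ppos z + (t + sg) *: d; set qm := ppos z + (t - sg) *: d.
have Jqp : J qp by apply: Jpt; rewrite addrC addKr sgn.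
have Jqm : J qm by apply: Jpt; rewrite addrC addKr normrN sgn.
have qpm : qp <> m by rewrite mE => /zd; lra.
have qmm : qm <> m by rewrite mE => /zd; lra.
have Kqp : K true qp by right; apply/seg2; exists (t + sg) => //; split_lra.
have Kqm : K false qm by right; apply/seg1; exists (t - sg) => //; split_lra.
have Jm : J m by apply: (nbhs_singleton mJ); case: im.
(* Away from [m] the closed sets [K true] and [K false] are disjoint and cover [J], so a connected
   [J] without [m] lies in one of them; [qp] and [qm] contradict this. *)
have JK : J `&` [set p | p <> m] `&` K true = J `&` [set p | p <> m].
  apply: (connected_boundary_minus Jm).
  - by exists qp.
  - exists (~` K false); first exact: closed_openC.
    apply/seteqP; split => p [[Jp pm] kp]; split => //.
      by move=> kp'; apply: pm; exact: K12.
    have /frontier_outer[_ /DK [//|]] := Jp.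
    by move=> /kp.
  - by exists (K true).
have : (J `&` [set p | p <> m] `&` K true) qm by rewrite JK.
by move=> [_ kqm]; apply: qmm; exact: K12.
Qed.

Lemma polyline_on_drawing (a : primal G + dual G) s p : path edge_removed a s ->
  on_polyline (vpos a) (map (@vpos R G) s) p ->
  (exists b, @vpos R G b = p) \/
  (exists y w, [/\ adj y w, (y, w) != (z, u) & edge_seg y w p]).
Proof.
elim: s a => [|b s IH] a /=; first by move=> _ ->; left; exists a.
move=> /andP[ab bs] [pab|h]; last exact: IH bs h.
right; move: ab pab => /andP[/andP[+ +] +]; clear IH bs; case: a b => [y|w] [y'|w'] //.
  by move=> yw ne _ pab; exists y, w'.
move=> yw _ ne pab; exists y', w; split => //.
  by apply: contra ne => /eqP[-> ->].
by rewrite /edge_seg segC.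
Qed.

End Edge.

Lemma region_sub_hat Q q : region Q q -> hat_domain G q.
Proof.
move=> Qq; have [r r0 rD] := near_off_drawing (region_off_drawing Qq).
apply/nbhs_ballP; exists r => // p pq; right; exists Q => //.
apply: (connected_sub_region _ rD (ballxx q r0) Qq) pq.
by apply: convex_connected; exact: convex_ball.
Qed.

(** A positive distance to the frontier does not by itself exclude a vertex off the closure of the
    domain, such as the tip of a dangling edge. Such a vertex would have an edge with the outer face
    on both sides. By [edge_removed_connect] this edge lies on a closed polygon, whose parity
    function changes sign across it, although both sides are joined off the drawing through points
    far away. *)
Lemma vertex_in_hat (z : primal G) : 0 < dist_hat z -> hat_domain G (ppos z).
Proof.
move=> dz; apply: contrapT => nz.
have nfr : ~ frontier (hat_domain G) (ppos z).
  move=> /(dist_to_le (ppos z)); rewrite eucl_nrm subrr.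
  have -> : nrm (0 : R * R) = 0 by rewrite /nrm /dot /= mulr0 addr0 sqrtr0.
  by rewrite leNgt dz.
have ncl : ~ closure (hat_domain G) (ppos z).
  by move=> cl; apply: nfr; split => // /interior_subset.
have [u zu] := incident_edge z.
have [m im nclm] : exists2 m, inner_point z u m & ~ closure (hat_domain G) m.
  apply: (inner_point_near zu (A := ~` closure (hat_domain G))).
  apply: open_nbhs_nbhs; split => //.
  by apply: closed_openC; exact: closed_closure.
have near_hat : \forall q \near m, ~ hat_domain G q.
  have := near_closed_out (@closed_closure _ _) nclm.
  by apply: filterS => q nq hq; apply: nq; exact: subset_closure.
have sm : edge_seg z u m by case: im.
have mJ : \forall q \near m, edge_seg z u q -> J q.
  apply: filterS near_hat => q nq sq; apply/frontier_outer; split.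
    exact: not_hat_closure_outer.
  exact: edge_sub_drawing sq.
have /connectP[s ps sz] := edge_removed_connect zu im mJ.
pose S := map (@vpos R G) s.
have lastS : last (dpos u) S = ppos z.
  by rewrite /S -[dpos u]/(@vpos R G (inr u)) last_map -sz.
have offD p : ~ D p -> ~ on_polyline (dpos u) S p.
  move=> nD /(polyline_on_drawing ps)[[v vp]|[y [w [yw _ yp]]]]; apply: nD.
    by left; exists v.
  exact: edge_sub_drawing yp.
have offm : ~ on_polyline (dpos u) S m.
  move=> /(polyline_on_drawing ps)[[v vp]|[y [w [yw ne yp]]]].
    exact: inner_point_not_vertex zu im vp.
  by have [ey ew] := inner_point_edge zu im yw yp; move: ne; rewrite -ey -ew eqxx.
have crossE q : cross (dpos u - q) (last (dpos u) S - q) = - edge_cross z u q.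
  by rewrite lastS /edge_cross /cross /=; ring.
have c0 : cross (dpos u - m) (last (dpos u) S - m) = 0.
  by rewrite crossE edge_cross_seg// oppr0.
have d0 : dot (dpos u - m) (last (dpos u) S - m) < 0.
  have [t /andP[t0 t1] ->] := (inner_pointP _ _ _).1 im.
  set d : R * R := dpos u - ppos z.
  have -> : dot (dpos u - (ppos z + t *: d)) (last (dpos u) S - (ppos z + t *: d)) =
      - (t * (1 - t) * dot d d).
    by rewrite lastS /dot /d /= /GRing.scale /=; ring.
  rewrite oppr_lt0; apply: mulr_gt0; first by rewrite mulr_gt0// subr_gt0.
  by rewrite -nrm_sqr exprn_gt0// nrm_gt0// edge_vector_neq0.
have [y y0 hy] := closed_turn_flip offm c0 d0.
have [r1 r10 h1] := near_plane near_hat.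
have [r2 r20 h2] := near_plane hy.
have [r [r0 rr1 rr2 hD]] : exists r, [/\ 0 < r, r <= r1, r <= r2 &
    forall s, half_ball z u m r s `<=` ~` D].
  near (0 : R)^'+ => r; exists r; split.
  - by near: r; exact: nbhs_right_gt.
  - by near: r; exact: nbhs_right_le.
  - by near: r; exact: nbhs_right_le.
  - by near: r; exact: half_ball_off_drawing.
have half (k : R) : k != 0 -> exists q, [/\ half_ball z u m r k q, O q, ~ D q &
    0 < y * closed_turn (dpos u) S q * - edge_cross z u q].
  move=> k0; have [q hq] := half_ball_nonempty sm r0 k0.
  have nDq := hD _ _ hq; have [bq cq] := hq.
  exists q; split => //.
    have [[Q /region_sub_hat hQ]|//] := region_or_outer nDq.
    by case: (h1 q (le_ball rr1 bq)).
  rewrite -crossE; apply: (h2 q (le_ball rr2 bq)); last exact: offD.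
  rewrite crossE oppr_eq0; apply: contraTneq cq => h.
  by rewrite /= h mulr0 ltxx.
have [qa [[_ /= ha] Oa nDa ya]] := half 1 (oner_neq0 _).
have [qb [[_ /= hb] Ob nDb yb]] : exists q, [/\ half_ball z u m r (-1) q, O q, ~ D q &
    0 < y * closed_turn (dpos u) S q * - edge_cross z u q].
  by apply: half; rewrite oppr_eq0 oner_neq0.
have [M M0 DM] := drawing_bounded.
pose B : set (R * R) := [set p | M < `|p.1| \/ M < `|p.2|].
have BD : B `<=` ~` D.
  by move=> p Bp /DM[p1 p2]; case: Bp; rewrite ltNge ?p1 ?p2.
have meetB q : O q -> connected_component (~` D) q `&` B !=set0.
  move=> /outer_component nb; apply: contrapT => nB; apply: nb.
  apply/bounded_planeP; exists M => p cp.
  by rewrite !leNgt; split; apply/negP => h; apply: nB; exists p; split => //; [left|right].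
(* The unbounded components on the two sides of the edge, linked through the outside of a box
   containing the drawing. *)
pose W := (connected_component (~` D) qa `|` B) `|` connected_component (~` D) qb.
have cW : connected W.
  apply: connectedU.
  - have [p [p1 p2]] := meetB _ Ob; exists p; split => //.
    by right.
  - apply: connectedU; [exact: meetB|exact: component_connected|exact: connected_outside_box].
  - exact: component_connected.
have WD : W `<=` ~` D.
  by move=> p [[/connected_component_sub|/BD]|/connected_component_sub].
have T0 p : W p -> y * closed_turn (dpos u) S p != 0.
  move=> /WD nDp; rewrite mulf_neq0// closed_turn_neq0//; first exact: offD.
  rewrite lastS => sp; apply: nDp; exact: edge_sub_drawing sp.
have cT : continuous (fun p => y * closed_turn (dpos u) S p).
  by move=> p; apply: cvgM; [exact: cvg_cst|exact: closed_turn_continuous].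
have Wa : W qa by left; left; exact: connected_component_refl.
have Wb : W qb by right; exact: connected_component_refl.
rewrite mulN1r oppr_gt0 in hb; rewrite mul1r in ha.
have pb : 0 < y * closed_turn (dpos u) S qb by rewrite pmulr_lgt0 ?oppr_gt0 in yb.
have pa := connected_same_sign cW cT T0 Wb Wa pb.
by move: ya; rewrite pmulr_rgt0// oppr_gt0 ltNge ltW.
Unshelve. all: by end_near. Qed.

End VertexInHat.

(** * Lebesgue measure of parallelograms *)

Notation mplane R := (measurableTypeR R * measurableTypeR R)%type.

Section PlaneMeasure.
Variable R : realType.
Notation leb := (@lebesgue_measure R).
Definition leb2 : {measure set (mplane R) -> \bar R} :=
  (leb \x leb)%E.

Lemma lebesgue_translation (k : R) (A : set (measurableTypeR R)) : measurable A ->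
  leb ((fun y : measurableTypeR R => (y + k : measurableTypeR R)) @^-1` A) = leb A.
Proof.
move=> mA; have mf : measurable_fun setT (fun y : measurableTypeR R => (y + k : measurableTypeR R)).
  by apply: measurable_funD => //; exact: measurable_cst.
rewrite -[LHS]/(pushforward leb (fun y : measurableTypeR R => (y + k : measurableTypeR R)) A).
apply/esym/lebesgue_measure_unique => //= _ [[a b]] _ <-.
rewrite /pushforward.
rewrite (_ : _ @^-1` _ = `]a - k, b - k]); last first.
  by apply/seteqP; split => y /=; rewrite !in_itv /= ltrBlDr lerBrDr.
rewrite !lebesgue_measure_itv/= !lte_fin ltrD2r; case: ifP => // _.
by rewrite -!EFinB; congr EFin; ring.
Qed.

Let shear_y (k : R) (p : mplane R) :
  mplane R := (p.1, p.2 + k * p.1).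
Let shear_x (k : R) (p : mplane R) :
  mplane R := (p.1 + k * p.2, p.2).

Let measurable_shear_y k : measurable_fun setT (shear_y k).
Proof.
apply: measurable_fun_pair; first exact: measurable_fst.
apply: measurable_funD; first exact: measurable_snd.
by apply: measurable_funM; [exact: measurable_cst|exact: measurable_fst].
Qed.

Let measurable_shear_x k : measurable_fun setT (shear_x k).
Proof.
apply: measurable_fun_pair; last exact: measurable_snd.
apply: measurable_funD; first exact: measurable_fst.
by apply: measurable_funM; [exact: measurable_cst|exact: measurable_snd].
Qed.

Lemma leb2_shear_y k A : measurable A -> leb2 (shear_y k @^-1` A) = leb2 A.
Proof.
move=> mA; rewrite /leb2 /= /product_measure1.
apply: eq_integral => x _ /=.
rewrite -(lebesgue_translation (k * x) (measurable_xsection x mA)); congr (leb _).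
Qed.

(** A shear in the first coordinate is a translation of each row, so it calls for the other order of
    integration; uniqueness of the product measure provides it. *)
Let leb2E A : measurable A -> leb2 A = (leb \x^ leb)%E A.
Proof.
by move=> mA; apply: product_measure_unique => //= ? ? ? ?; rewrite product_measure2E.
Qed.

Lemma leb2_shear_x k A : measurable A -> leb2 (shear_x k @^-1` A) = leb2 A.
Proof.
move=> mA; rewrite !leb2E//; last first.
  by rewrite -[X in measurable X]setTI; exact: measurable_shear_x.
rewrite /product_measure2; apply: eq_integral => y _ /=.
rewrite -(lebesgue_translation (k * y) (measurable_ysection y mA)); congr (leb _).
Qed.

Definition strip (a b c A : R) (p : R * R) : Prop := 0 <= a * p.1 + b * p.2 + c <= A.

Definition parallelogram (a b c A a' b' c' A' : R) :
    set (mplane R) :=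
  [set p | strip a b c A p /\ strip a' b' c' A' p].

Let interval (a c A : R) : set (measurableTypeR R) := [set x : R | 0 <= a * x + c <= A].

Let measurable_interval a c A : measurable (interval a c A).
Proof.
have mf : measurable_fun setT (fun x : measurableTypeR R => a * x + c : R).
  by apply: measurable_funD => //; apply: measurable_funM => //; exact: measurable_cst.
rewrite (_ : interval a c A = setT `&` (fun x : R => a * x + c) @^-1` `[0, A]); last first.
  by rewrite setTI; apply/seteqP; split => x; rewrite /interval /= in_itv.
exact: mf.
Qed.

Let leb_interval a c A : a != 0 -> 0 <= A -> leb (interval a c A) = (A / `|a|)%:E.
Proof.
move=> a0 A0; pose l := if 0 < a then - c / a else (A - c) / a.
pose r := if 0 < a then (A - c) / a else - c / a.
have lr : l <= r.
  rewrite /l /r; case: ltP => h; first by rewrite ler_pM2r ?invr_gt0//; lra.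
  have an : a < 0 by rewrite lt_neqAle a0.
  by rewrite ler_nM2r ?invr_lt0//; lra.
have -> : interval a c A = `[l, r].
  apply/seteqP; split => x; rewrite /interval /= in_itv /= /l /r; case: ltP => h.
  - by move=> /andP[h1 h2]; rewrite ler_pdivrMr// ler_pdivlMr//; split_lra.
  - have an : a < 0 by rewrite lt_neqAle a0.
    by move=> /andP[h1 h2]; rewrite ler_ndivrMr// ler_ndivlMr//; split_lra.
  - by rewrite ler_pdivrMr// ler_pdivlMr// => /andP[h1 h2]; split_lra.
  - have an : a < 0 by rewrite lt_neqAle a0.
    by rewrite ler_ndivrMr// ler_ndivlMr// => /andP[h1 h2]; split_lra.
rewrite lebesgue_measure_itv /= lte_fin; case: ltP => h.
  rewrite -EFinB; congr EFin; rewrite /l /r; case: ltrgt0P a0 => // a0 _; field.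
    by rewrite gt_eqF.
  by rewrite lt_eqF.
have lre : l = r by apply/eqP; rewrite eq_le lr.
congr EFin; apply/esym; rewrite -(subrr r) -{2}lre /l /r; case: ltrgt0P a0 => // a0 _; field.
  by rewrite gt_eqF.
by rewrite lt_eqF.
Qed.

Let measurable_strip a b c A :
  measurable ([set p | strip a b c A p] : set (mplane R)).
Proof.
have mf : measurable_fun setT (fun p : mplane R => a * p.1 + b * p.2 + c : R).
  apply: measurable_funD; last exact: measurable_cst.
  by apply: measurable_funD; apply: measurable_funM; (try exact: measurable_cst);
    [exact: measurable_fst|exact: measurable_snd].
rewrite (_ : [set p | _] = setT `&` (fun p : mplane R => a * p.1 + b * p.2 + c : R) @^-1` `[0, A]).
  exact: mf.
by rewrite setTI; apply/seteqP; split => p; rewrite /strip /= in_itv.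
Qed.

Lemma measurable_parallelogram a b c A a' b' c' A' :
  measurable (parallelogram a b c A a' b' c' A').
Proof. exact: (measurableI _ _ (measurable_strip a b c A) (measurable_strip a' b' c' A')). Qed.

(** Two shears, each preserving area, straighten the strips one after the other into a product of
    intervals; [t] is the determinant divided by [a]. *)
Let leb2_parallelogram0 a b c A a' b' c' A' : a != 0 -> a * b' - b * a' != 0 ->
  0 <= A -> 0 <= A' ->
  leb2 (parallelogram a b c A a' b' c' A') = (A * A' / `|a * b' - b * a'|)%:E.
Proof.
move=> a0 d0 A0 A'0; pose t := b' - a' * b / a.
have at0 : a * t = a * b' - b * a' by rewrite /t; field.
have t0 : t != 0 by apply: contra d0 => /eqP t0; rewrite -at0 t0 mulr0.
have e1 : parallelogram a b c A a' b' c' A' =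
    shear_x (b / a) @^-1` (parallelogram a 0 c A a' t c' A').
  have s1 p : strip a 0 c A (shear_x (b / a) p) = strip a b c A p.
    rewrite /strip /shear_x /=.
    by have -> : a * (p.1 + b / a * p.2) + 0 * p.2 + c = a * p.1 + b * p.2 + c by field.
  have s2 p : strip a' t c' A' (shear_x (b / a) p) = strip a' b' c' A' p.
    rewrite /strip /shear_x /=.
    by have -> : a' * (p.1 + b / a * p.2) + t * p.2 + c' = a' * p.1 + b' * p.2 + c'
      by rewrite /t; field.
  by apply/seteqP; split => p; rewrite /parallelogram /= s1 s2.
have e2 : parallelogram a 0 c A a' t c' A' =
    shear_y (a' / t) @^-1` (parallelogram a 0 c A 0 t c' A').
  have s1 p : strip a 0 c A (shear_y (a' / t) p) = strip a 0 c A p.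
    by rewrite /strip /shear_y /= !mul0r.
  have s2 p : strip 0 t c' A' (shear_y (a' / t) p) = strip a' t c' A' p.
    rewrite /strip /shear_y /=.
    by have -> : 0 * p.1 + t * (p.2 + a' / t * p.1) + c' = a' * p.1 + t * p.2 + c' by field.
  by apply/seteqP; split => p; rewrite /parallelogram /= s1 s2.
have e3 : parallelogram a 0 c A 0 t c' A' = interval a c A `*` interval t c' A'.
  by apply/seteqP; split => p; rewrite /parallelogram /strip /interval /= !mul0r addr0 add0r.
rewrite e1 leb2_shear_x; last exact: measurable_parallelogram.
rewrite e2 leb2_shear_y; last exact: measurable_parallelogram.
rewrite e3 /leb2 /= product_measure1E//= !leb_interval// -EFinM; congr EFin.
by rewrite -at0 normrM; field; rewrite !normr_eq0 a0 t0.
Qed.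

Lemma leb2_parallelogram a b c A a' b' c' A' : a * b' - b * a' != 0 ->
  0 <= A -> 0 <= A' ->
  leb2 (parallelogram a b c A a' b' c' A') = (A * A' / `|a * b' - b * a'|)%:E.
Proof.
move=> d0 A0 A'0; have [a0|a0] := eqVneq a 0; last exact: leb2_parallelogram0.
(* When [a = 0] a shear replaces this coefficient by [- b], which is nonzero because the determinant
   is. *)
have e : parallelogram a b c A a' b' c' A' =
    shear_y 1 @^-1` (parallelogram (a - b) b c A (a' - b') b' c' A').
  have s1 x y z B p : strip (x - y) y z B (shear_y 1 p) = strip x y z B p.
    rewrite /strip /shear_y /=.
    by have -> : (x - y) * p.1 + y * (p.2 + 1 * p.1) + z = x * p.1 + y * p.2 + z by ring.
  by apply/seteqP; split => p; rewrite /parallelogram /= !s1.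
have d : (a - b) * b' - b * (a' - b') = a * b' - b * a' by ring.
rewrite e leb2_shear_y; last exact: measurable_parallelogram.
rewrite leb2_parallelogram0// ?d//.
by apply: contra d0; rewrite a0 sub0r oppr_eq0 => /eqP ->; rewrite !mul0r subrr.
Qed.

Lemma fsum_finType (I : finType) (P : pred I) (f : I -> \bar R) :
  (\sum_(i \in [set i | P i]) f i = \sum_(i | P i) f i)%E.
Proof.
rewrite -[RHS]big_filter (_ : [set i | P i] = [set` [seq i <- index_enum I | P i]]).
  by rewrite -fsbig_seq ?filter_uniq ?index_enum_uniq.
by apply/seteqP; split => i /=; rewrite mem_filter mem_index_enum andbT.
Qed.

Lemma measure_pack (I : finType) (P : pred I) (F : I -> set (mplane R))
    (B : set (mplane R)) (f : I -> R) (b : R) :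
  (forall i, measurable (F i)) -> measurable B ->
  (forall i j p, P i -> P j -> F i p -> F j p -> i = j) -> (forall i, P i -> F i `<=` B) ->
  (forall i, P i -> leb2 (F i) = (f i)%:E) -> leb2 B = b%:E ->
  \sum_(i | P i) f i <= b.
Proof.
move=> mF mB dF FB fE bE.
have h : leb2 (\bigcup_(i in [set i | P i]) F i) = (\sum_(i \in [set i | P i]) leb2 (F i))%E.
  apply: measure_fin_bigcup => //; first exact: finite_finset.
  move=> i j /= Pi Pj [p [Fi Fj]]; exact: (dF i j p).
have hs : (\sum_(i \in [set i | P i]) leb2 (F i))%E = (\sum_(i | P i) f i)%:E.
  by rewrite fsum_finType -sumEFin; apply: eq_bigr => i /fE.
rewrite -lee_fin -hs -h -bE; apply: le_measure; rewrite ?inE//.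
  by apply: fin_bigcup_measurable => //; exact: finite_finset.
by move=> p [i /= Pi Fip]; exact: FB Pi _ Fip.
Qed.

Lemma measure_cover (I : finType) (P : pred I) (F : I -> set (mplane R))
    (B : set (mplane R)) (f : I -> R) (b : R) :
  (forall i, measurable (F i)) -> measurable B ->
  (forall p, B p -> exists2 i, P i & F i p) ->
  (forall i, P i -> leb2 (F i) = (f i)%:E) -> leb2 B = b%:E ->
  b <= \sum_(i | P i) f i.
Proof.
move=> mF mB BF fE bE.
have hs : (\sum_(i \in [set i | P i]) leb2 (F i))%E = (\sum_(i | P i) f i)%:E.
  by rewrite fsum_finType -sumEFin; apply: eq_bigr => i /fE.
rewrite -lee_fin -hs -bE; apply: content_sub_fsum => //; first exact: finite_finset.
Qed.

End PlaneMeasure.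

(** * Areas of faces *)

Section KiteArea.
Variables (R : realType) (p1 p2 w1 w2 : R * R).
Let e : R * R := p2 - p1.
Let f : R * R := w2 - w1.
Hypotheses (e0 : 0 < nrm e) (f0 : 0 < nrm f) (ef : dot e f = 0).
Hypothesis split : -1 < kite_y p1 w1 w2 w1 < 0.
Notation X := (kite_x p1 p2 w1).
Notation Y := (kite_y p1 w1 w2).
Let a := X p1.
Let c := Y w1.
Let d := c + 1.
Let c0 : c < 0. Proof. by case/andP: split. Qed.
Let d0 : 0 < d. Proof. by rewrite /d; case/andP: split => h _; rewrite -ltrBlDr sub0r. Qed.

Let ee0 : dot e e != 0. Proof. by rewrite -nrm_sqr expf_neq0// gt_eqF. Qed.
Let ff0 : dot f f != 0. Proof. by rewrite -nrm_sqr expf_neq0// gt_eqF. Qed.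

(** In the coordinates [y = Y / k] and [x = X - a (1 - Y / k)] the triangle with apex at height [k]
    becomes the standard one, [0 < x], [0 <= y], [x + y < 1]. The strip is a rectangle there. *)
Definition kite_strip (k s A s' A' : R) : set (mplane R) :=
  [set p : R * R | 0 <= Y p / k - s <= A /\ 0 <= X p - a * (1 - Y p / k) - s' <= A'].

Lemma kite_strip_area k s A s' A' : k != 0 -> 0 <= A -> 0 <= A' ->
  measurable (kite_strip k s A s' A') /\
  leb2 R (kite_strip k s A s' A') = (A * A' * (nrm e * nrm f) * `|k|)%:E.
Proof.
move=> k0 A0 A'0.
pose y1 := f.1 / dot f f / k; pose y2 := f.2 / dot f f / k.
pose y3 := - dot p1 f / dot f f / k - s.
pose z1 := e.1 / dot e e + a * y1; pose z2 := e.2 / dot e e + a * y2.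
pose z3 := - dot w1 e / dot e e - a + a * (- dot p1 f / dot f f / k) - s'.
have -> : kite_strip k s A s' A' = parallelogram y1 y2 y3 A z1 z2 z3 A'.
  have h1 p : y1 * p.1 + y2 * p.2 + y3 = Y p / k - s.
    rewrite /kite_y -/f.
    have -> : dot (p - p1) f = f.1 * p.1 + f.2 * p.2 - dot p1 f by rewrite /dot /=; ring.
    by rewrite /y1 /y2 /y3; field; rewrite k0 ff0.
  have h2 p : z1 * p.1 + z2 * p.2 + z3 = X p - a * (1 - Y p / k) - s'.
    rewrite /kite_x /kite_y -/f -/e.
    have -> : dot (p - p1) f = f.1 * p.1 + f.2 * p.2 - dot p1 f by rewrite /dot /=; ring.
    have -> : dot (p - w1) e = e.1 * p.1 + e.2 * p.2 - dot w1 e by rewrite /dot /=; ring.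
    by rewrite /z1 /z2 /z3 /y1 /y2; field; rewrite k0 ff0 ee0.
  apply/seteqP; split => p; rewrite /kite_strip /parallelogram /strip /= h1 h2.
    by [].
  by [].
have det : y1 * z2 - y2 * z1 = - (cross e f / (dot e e * dot f f * k)).
  by rewrite /z1 /z2 /y1 /y2 /cross; field; rewrite k0 ff0 ee0.
have detn : `|y1 * z2 - y2 * z1| = (nrm e * nrm f * `|k|)^-1.
  rewrite det normrN normrM normfV (norm_cross_orthogonal ef) !normrM.
  rewrite (ger0_norm (dot_ge0 e)) (ger0_norm (dot_ge0 f)) -!nrm_sqr; field.
  by rewrite normr_eq0 k0 !gt_eqF.
split; first exact: measurable_parallelogram.
rewrite leb2_parallelogram ?detn//; first by rewrite invrK; congr EFin; ring.
by rewrite -normr_gt0 detn invr_gt0; rewrite !mulr_gt0// normr_gt0.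
Qed.

Let tauE k p : (k = c \/ k = d) -> 0 <= Y p / k -> kite_tau p1 w1 w2 (Y p) = 1 - Y p / k.
Proof.
rewrite /kite_tau => -[->|->] h; last first.
  have y0 : 0 <= Y p by move: h; rewrite pmulr_lge0// invr_gt0.
  by rewrite y0.
have y0 : Y p <= 0 by move: h; rewrite nmulr_lge0// invr_lt0.
case: ifP => // y1; have -> : Y p = 0 by apply/eqP; rewrite eq_le y0.
by rewrite !mul0r.
Qed.

(** The heights of the two triangles add up to [1], so one has [|k| >= 1/2]. The rectangle with [x]
    in [[1/8, 3/8]] and [y] in [[1/8, 1/2]] fits in the standard triangle, and
    [32 * (3/32) * (1/2) >= 1]. *)
Lemma kite_inner_area : exists S m, [/\ measurable S,
  S `<=` kite_interior p1 p2 w1 w2, leb2 R S = m%:E & nrm e * nrm f <= 32 * m].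
Proof.
have [k kcd k2] : exists2 k, k = c \/ k = d & 2^-1 <= `|k|.
  have [h|h] := lerP 2^-1 d.
    by exists d; [right|rewrite gtr0_norm].
  by exists c; [left|rewrite ltr0_norm//; rewrite /d in h; lra].
have k0 : k != 0 by rewrite -normr_gt0; lra.
have A1 : (0 : R) <= 3/8 by lra.
have A2 : (0 : R) <= 1/4 by lra.
have [mS eS] := kite_strip_area (1/8) (1/8) k0 A1 A2.
exists (kite_strip k (1/8) (3/8) (1/8) (1/4)), (3/8 * (1/4) * (nrm e * nrm f) * `|k|).
split => //.
  move=> p [/andP[h1 h2] /andP[h3 h4]]; rewrite /kite_interior /= (tauE kcd); last by lra.
  rewrite -/a; move: (Y p / k) (X p) h1 h2 h3 h4 => y x h1 h2 h3 h4.
  by split_lra.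
have W0 : 0 <= nrm e * nrm f by rewrite mulr_ge0 ?nrm_ge0.
have : nrm e * nrm f * 2^-1 <= nrm e * nrm f * `|k| by rewrite ler_wpM2l.
lra.
Qed.

(** Each standard triangle lies in the unit square, and [|c| + d = 1]. The true area is half of
    this; only the order of magnitude matters. *)
Lemma kite_outer_area : exists (S : bool -> set (mplane R)) m,
  [/\ forall b, measurable (S b), kite_interior p1 p2 w1 w2 `<=` S true `|` S false,
   forall b, leb2 R (S b) = (m b)%:E & m true + m false = nrm e * nrm f].
Proof.
have dn : d != 0 by rewrite gt_eqF.
have cn : c != 0 by rewrite lt_eqF.
have [mS eS] := kite_strip_area 0 0 dn ler01 ler01.
have [mS' eS'] := kite_strip_area 0 0 cn ler01 ler01.
exists (fun b => if b then kite_strip d 0 1 0 1 else kite_strip c 0 1 0 1),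
  (fun b => if b then 1 * 1 * (nrm e * nrm f) * `|d| else 1 * 1 * (nrm e * nrm f) * `|c|).
split.
- by case.
- move=> p Ip; have t0 := kite_interior_tau Ip; move: Ip => /andP[].
  have [y0|y0] := lerP 0 (Y p).
    have h : 0 <= Y p / d by rewrite divr_ge0// ltW.
    rewrite (tauE _ h) in t0 *; last by right.
    rewrite -/a => h1 h2; left; rewrite /kite_strip /=.
    move: (Y p / d) (X p) h h1 h2 t0 => y x h h1 h2 t0.
    by split; split_lra.
  have h : 0 <= Y p / c by rewrite nmulr_lge0 ?invr_lt0// ltW.
  rewrite (tauE _ h) in t0 *; last by left.
  rewrite -/a => h1 h2; right; rewrite /kite_strip /=.
  move: (Y p / c) (X p) h h1 h2 t0 => y x h h1 h2 t0.
  by split; split_lra.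
- by case.
- by rewrite (gtr0_norm d0) (ltr0_norm c0) /d; ring.
Qed.

End KiteArea.

Section QuadArea.
Variables (R : realType) (G : orthodiagonal_map R).
Implicit Types (x y : primal G) (u v w : dual G) (Q : quad G) (p q : R * R).
Notation D := (drawing_set G).

Definition qweight Q : R := nrm (qe Q) * nrm (qf Q).

Lemma region_inner_area Q : exists S m, [/\ measurable S, S `<=` region Q,
  leb2 R S = m%:E & qweight Q <= 32 * m].
Proof.
have [sp|sp] := quad_split Q.
  rewrite (region_kite sp); exact: kite_inner_area (qe_gt0 Q) (qf_gt0 Q) (qe_qf Q) sp.
rewrite (region_kite_swap sp) /qweight mulrC.
exact: kite_inner_area (qf_gt0 Q) (qe_gt0 Q) (qf_qe Q) sp.
Qed.

Lemma region_outer_area Q : exists (S : bool -> set (mplane R)) m,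
  [/\ forall b, measurable (S b), region Q `<=` S true `|` S false,
   forall b, leb2 R (S b) = (m b)%:E & m true + m false = qweight Q].
Proof.
have [sp|sp] := quad_split Q.
  rewrite (region_kite sp); exact: kite_outer_area (qe_gt0 Q) (qf_gt0 Q) (qe_qf Q) sp.
rewrite (region_kite_swap sp) /qweight mulrC.
exact: kite_outer_area (qf_gt0 Q) (qe_gt0 Q) (qf_qe Q) sp.
Qed.

Lemma qweight_gt0 Q : 0 < qweight Q.
Proof. by rewrite mulr_gt0 ?qe_gt0 ?qf_gt0. Qed.

Let box p0 (r : R) : set (mplane R) :=
  parallelogram 1 0 (r - p0.1) (2 * r) 0 1 (r - p0.2) (2 * r).

Let boxP p0 r p : box p0 r p <-> `|p.1 - p0.1| <= r /\ `|p.2 - p0.2| <= r.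
Proof.
rewrite /box /parallelogram /strip /= !ler_norml.
split=> [[/andP[? ?] /andP[? ?]]|[/andP[? ?] /andP[? ?]]].
  by split; split_lra.
by split; split_lra.
Qed.

Let box_area p0 r : 0 <= r -> leb2 R (box p0 r) = (4 * r ^+ 2)%:E.
Proof.
move=> r0; rewrite leb2_parallelogram ?mulr0 ?mulr1 ?subr0 ?oner_neq0 ?mulr_ge0//.
by rewrite normr1 divr1; congr EFin; ring.
Qed.

(** Disjoint pieces of faces are packed in a square of half-side [r + 3 * eps]; the constant is
    [32 * 4]. *)
Lemma sum_qweight_le (eps : R) p0 (r : R) : edges_at_most G eps -> 0 <= eps -> 0 <= r ->
  \sum_(Q | nrm (ppos (qp1 Q) - p0) <= r) qweight Q <= 128 * (r + 3 * eps) ^+ 2.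
Proof.
move=> le eps0 r0.
have /choice[S /choice[m Sm]] : forall Q, exists S m, [/\ measurable S, S `<=` region Q,
    leb2 R S = m%:E & qweight Q <= 32 * m] by move=> Q; exact: region_inner_area.
have rho0 : 0 <= r + 3 * eps by rewrite addr_ge0 ?mulr_ge0.
have h : \sum_(Q | nrm (ppos (qp1 Q) - p0) <= r) m Q <= 4 * (r + 3 * eps) ^+ 2.
  apply: (@measure_pack R _ _ S (box p0 (r + 3 * eps))).
  - by move=> Q; have [] := Sm Q.
  - exact: measurable_parallelogram.
  - move=> Q Q' p _ _; have [_ h1 _ _] := Sm Q; have [_ h2 _ _] := Sm Q'.
    by move=> /h1 k1 /h2 k2; exact: region_inj_meet k1 k2.
  - move=> Q Qr p; have [_ h1 _ _] := Sm Q; move=> /h1 /(region_diameter le) pQ.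
    have h2 : nrm (p - p0) <= r + 3 * eps.
      have := ler_nrmD (p - ppos (qp1 Q)) (ppos (qp1 Q) - p0).
      by rewrite addrA subrK; lra.
    by apply/boxP; split; [apply: le_trans h2; exact: (ler_nrm_coord1 (p - p0))|apply: le_trans h2; exact: (ler_nrm_coord2 (p - p0))].
  - by move=> Q _; have [] := Sm Q.
  - by rewrite box_area.
have : \sum_(Q | nrm (ppos (qp1 Q) - p0) <= r) qweight Q <=
    \sum_(Q | nrm (ppos (qp1 Q) - p0) <= r) 32 * m Q.
  by apply: ler_sum => Q _; have [] := Sm Q.
rewrite -mulr_sumr; lra.
Qed.

Lemma drawing_edge p : D p -> exists x u, adj x u /\ edge_seg x u p.
Proof.
move=> [[[x|u] <-]|//].
  by have [u xu] := incident_edge x; exists x, u; split => //; exact: seg_left.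
have [x0 _] := bdry_nonempty G.
have /connectP[[|[x|w] s]//= /andP[xu _] _] := od_connected (inr u : primal G + dual G) (inl x0).
by exists x, u; split => //; exact: seg_right.
Qed.

(* The edges are negligible: they are covered by parallelograms of area [2 * t]. *)
Let edge_strip (t : R) (xu : primal G * dual G) : set (mplane R) :=
  let v : R * R := dpos xu.2 - ppos xu.1 in
  parallelogram (- v.2) v.1 (t - cross v (ppos xu.1)) (2 * t)
    v.1 v.2 (- dot v (ppos xu.1)) (dot v v).

Let edge_strip_area t xu : 0 <= t -> leb2 R (edge_strip t xu) = (2 * t)%:E.
Proof.
move=> t0; rewrite /edge_strip; set v : R * R := _ - _.
have v0 : 0 < dot v v by rewrite -nrm_sqr exprn_gt0// nrm_gt0// edge_vector_neq0.
have dE : - v.2 * v.2 - v.1 * v.1 = - dot v v by rewrite /dot; ring.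
rewrite leb2_parallelogram ?dE ?oppr_eq0 ?gt_eqF ?mulr_ge0 ?dot_ge0//.
by rewrite normrN gtr0_norm// mulfK// gt_eqF.
Qed.

Let edge_strip_sub t x u p : 0 <= t -> edge_seg x u p -> edge_strip t (x, u) p.
Proof.
move=> t0 sp; rewrite /edge_strip /=; set v : R * R := _ - _.
have c0 := edge_cross_seg sp; rewrite /edge_cross -/v in c0.
rewrite /parallelogram /strip /=.
have -> : - v.2 * p.1 + v.1 * p.2 + (t - cross v (ppos x)) = t.
  have -> : - v.2 * p.1 + v.1 * p.2 + (t - cross v (ppos x)) = t + cross v (p - ppos x).
    by rewrite /cross /=; ring.
  by rewrite c0 addr0.
have -> : v.1 * p.1 + v.2 * p.2 - dot v (ppos x) = dot v (p - ppos x).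
  by rewrite /dot /=; ring.
case: sp => s s01 <-; move: s01; rewrite /= in_itv /= => /andP[s0 s1].
have -> : dot v (((1 - s) * (ppos x).1 + s * (dpos u).1, (1 - s) * (ppos x).2 + s * (dpos u).2) - ppos x)
    = s * dot v v by rewrite /v /dot /=; ring.
have := dot_ge0 v => v0; rewrite mulr_ge0// ler_piMl// t0/=; split => //.
by lra.
Qed.

(** The square of half-side [r / 4] is covered by faces and edges. Its points are within [r / 2] of
    [p0], so the faces used have their corner [qp1] within [r / 2 + 3 * eps <= r]; letting the width
    [t] of the edge strips tend to [0] removes the edges. *)
Lemma sum_qweight_ge (eps : R) p0 (r : R) : edges_at_most G eps ->
  0 < r -> 6 * eps <= r -> (forall p, nrm (p - p0) < r -> hat_domain G p) ->
  r ^+ 2 <= 4 * \sum_(Q | nrm (ppos (qp1 Q) - p0) <= r) qweight Q.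
Proof.
move=> le r0 er hr; set N := \sum_(Q | _) _.
have /choice[S /choice[m Sm]] : forall Q, exists (S : bool -> set (mplane R)) m,
  [/\ forall b, measurable (S b), region Q `<=` S true `|` S false,
   forall b, leb2 R (S b) = (m b)%:E & m true + m false = qweight Q].
  by move=> Q; exact: region_outer_area.
have key t : 0 < t -> 4 * (r / 4) ^+ 2 <= N + t * (2 * #|{: primal G * dual G}|%:R).
  move=> t0.
  pose I : finType := ((quad G * bool) + (primal G * dual G))%type.
  pose F (i : I) := match i with inl Qb => S Qb.1 Qb.2 | inr xu => edge_strip t xu end.
  pose f (i : I) : R := match i with inl Qb => m Qb.1 Qb.2 | inr xu => 2 * t end.
  pose P : pred I := fun i => match i with inl Qb => nrm (ppos (qp1 Qb.1) - p0) <= r | inr xu => true end.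
  have h : 4 * (r / 4) ^+ 2 <= \sum_(i | P i) f i.
    apply: (@measure_cover R _ P F (box p0 (r / 4)) f).
    - by move=> [[Q b]|xu] /=; [have [] := Sm Q|exact: measurable_parallelogram].
    - exact: measurable_parallelogram.
    - move=> p /boxP[p1 p2].
      have pr : nrm (p - p0) <= r / 2.
        have -> : p - p0 = (p.1 - p0.1, 0) + (0, p.2 - p0.2) :> R * R.
          by congr pair => /=; rewrite ?addr0 ?add0r.
        apply: le_trans (ler_nrmD _ _) _.
        rewrite /nrm /dot /= !mulr0 addr0 add0r -!expr2 !sqrtr_sqr; lra.
      have hp : hat_domain G p by apply: hr; lra.
      have [Dp|nDp] := pselect (D p).
        have [x [u [xu xup]]] := drawing_edge Dp.
        by exists (inr (x, u)) => //=; apply: edge_strip_sub => //; exact: ltW.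
      have [Q Qp] := hat_domain_region hp nDp.
      have Pr : nrm (ppos (qp1 Q) - p0) <= r.
        have := region_diameter le Qp; rewrite nrmB => h1.
        have := ler_nrmD (ppos (qp1 Q) - p) (p - p0).
        by rewrite addrA subrK; lra.
      have [_ h _ _] := Sm Q; case: (h p Qp) => hS.
        by exists (inl (Q, true)).
      by exists (inl (Q, false)).
    - by move=> [[Q b]|xu] /= _; [have [_ _ + _] := Sm Q; exact|apply: edge_strip_area; exact: ltW].
    - by rewrite box_area// divr_ge0// ltW.
  apply: le_trans h _; rewrite big_sumType /=; apply: lerD.
    have -> : \sum_(Qb : quad G * bool | nrm (ppos (qp1 Qb.1) - p0) <= r) m Qb.1 Qb.2 =
        \sum_(Q | nrm (ppos (qp1 Q) - p0) <= r) \sum_(b : bool) m Q b.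
      rewrite (pair_big (fun Q => nrm (ppos (qp1 Q) - p0) <= r) xpredT m) /=.
      by apply: eq_bigl => Qb; rewrite andbT.
    by apply: ler_sum => Q _; have [_ _ _ <-] := Sm Q; rewrite big_bool.
  by rewrite sumr_const -(mulr_natr (2 * t)) mulrAC mulrC.
have k0 : 0 <= 2 * #|{: primal G * dual G}|%:R :> R by rewrite mulr_ge0 ?ler0n.
move: (2 * _) k0 key => k k0 key.
have : r ^+ 2 / 4 <= N.
  apply/ler_addgt0Pr => t t0.
  have k1 : 0 < k + 1 by lra.
  have := key (t / (k + 1)) (divr_gt0 t0 k1).
  have : t / (k + 1) * k <= t by rewrite mulrAC ler_pdivrMr// ler_pM2l//; lra.
  have -> : 4 * (r / 4) ^+ 2 = r ^+ 2 / 4 by field.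
  lra.
lra.
Qed.

End QuadArea.

Local Close Scope classical_set_scope.

(** * Averages of harmonic functions *)

Section Laplacian.
Variables (R : realType) (G : orthodiagonal_map R).
Implicit Types (x y z : primal G) (Q : quad G) (h : primal G -> R).

Lemma len_primalE Q : len_primal Q = nrm (qe Q).
Proof. by rewrite /len_primal eucl_nrm nrmB. Qed.

Lemma len_dualE Q : len_dual Q = nrm (qf Q).
Proof. by rewrite /len_dual eucl_nrm nrmB. Qed.

Lemma laplacian_quads h x :
  laplacian h x = \sum_Q nrm (qf Q) / nrm (qe Q) * incid R (@qp1 R G) (@qp2 R G) x Q *
    (h (qp2 Q) - h (qp1 Q)).
Proof.
rewrite /laplacian /cond.
under eq_bigr do rewrite mulr_suml.
rewrite (exchange_big_dep xpredT) //=; apply: eq_bigr => Q _.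
rewrite -mulr_sumr len_primalE len_dualE -[RHS]mulrA; congr (_ * _).
have [/eqP n12 _] := od_quad_distinct Q; rewrite /incid.
have sum1 a b : a != b ->
    \sum_(y | [set a; b]%SET == [set a; y]%SET) (h y - h a) = h b - h a.
  move=> ab; rewrite (bigD1 b) ?eqxx//= big1 ?addr0// => y /andP[/eqP/setP s yb].
  have := s y; rewrite !inE eqxx orbT (negPf yb) orbF => /eqP ya.
  by rewrite ya subrr.
have [->|x1] := eqVneq x (qp1 Q).
  by rewrite sum1// (negPf n12) subr0 mul1r.
have [->|x2] := eqVneq x (qp2 Q).
  by rewrite finset.setUC sum1 1?eq_sym// sub0r mulN1r opprB.
rewrite subr0 mul0r big1// => y /eqP/setP /(_ x).
by rewrite !inE eqxx (negPf x1) (negPf x2).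
Qed.

Lemma supnorm_ge h x : `|h x| <= supnorm h.
Proof. by rewrite /supnorm; exact: (le_bigmax _ (fun x => `|h x|)). Qed.

Lemma supnorm_ge0 h : 0 <= supnorm h.
Proof. by rewrite /supnorm; exact: bigmax_ge_id. Qed.

End Laplacian.

Section Subdivision.
Variable R : realType.
Implicit Types F : R -> R.

(* Cutting the interval into [n] equal pieces makes the total quadratic error
   [O(1 / n)]. *)
Lemma lipschitz_of_quadratic_error F (a b L B : R) : a <= b ->
  (forall u v, a <= u -> u <= v -> v <= b ->
    `|F v - F u| <= L * (v - u) + B * (v - u) ^+ 2) ->
  `|F b - F a| <= L * (b - a).
Proof.
move=> ab hF.
have step n : `|F b - F a| <= L * (b - a) + B * (b - a) ^+ 2 / n.+1%:R.
  have n0 : (0 : R) < n.+1%:R by rewrite ltr0n.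
  set s := (b - a) / n.+1%:R.
  have s0 : 0 <= s by rewrite divr_ge0 ?subr_ge0// ltW.
  have sb : a + n.+1%:R * s = b by rewrite /s mulrCA mulfV ?gt_eqF// mulr1 addrC subrK.
  have E k : (k <= n.+1)%N -> `|F (a + k%:R * s) - F a| <= k%:R * (L * s + B * s ^+ 2).
    elim: k => [_|k IH kn]; first by rewrite !mul0r addr0 subrr normr0.
    have k1 : a <= a + k%:R * s by rewrite lerDl mulr_ge0.
    have k2 : a + k%:R * s <= a + k.+1%:R * s by rewrite lerD2l ler_wpM2r// ler_nat.
    have k3 : a + k.+1%:R * s <= b by rewrite -sb lerD2l ler_wpM2r// ler_nat.
    have := hF _ _ k1 k2 k3.
    have -> : a + k.+1%:R * s - (a + k%:R * s) = s by rewrite -natr1; ring.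
    have := IH (ltnW kn) => h1 h2.
    have -> : F (a + k.+1%:R * s) - F a =
      (F (a + k.+1%:R * s) - F (a + k%:R * s)) + (F (a + k%:R * s) - F a) by ring.
    apply: le_trans (ler_normD _ _) _;
    have -> : k.+1%:R * (L * s + B * s ^+ 2) = (L * s + B * s ^+ 2) + k%:R * (L * s + B * s ^+ 2).
      by rewrite -natr1; ring.
    exact: lerD.
  have := E _ (leqnn _); rewrite sb => /le_trans; apply.
  by rewrite le_eqVlt; apply/orP; left; apply/eqP; rewrite /s; field; rewrite gt_eqF.
apply/ler_addgt0Pr => t t0.
have [n hn] : exists n, B * (b - a) ^+ 2 / t < n.+1%:R.
  exists (Num.bound `|B * (b - a) ^+ 2 / t|).
  apply: le_lt_trans (ler_norm _) _; apply: lt_trans (archi_boundP (normr_ge0 _)) _.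
  by rewrite ltr_nat.
apply: le_trans (step n) _; rewrite lerD2l ler_pdivrMr ?ltr0n// [leRHS]mulrC.
by rewrite -ler_pdivrMr// ltW.
Qed.

End Subdivision.

(** * The averaging kernel under a change of scale *)

Section ScaledKernel.
Variable R : realType.
Implicit Types (p q : R * R) (u v : R).

Lemma dotZ u p : dot (u *: p) (u *: p) = u ^+ 2 * dot p p.
Proof. by rewrite /dot /= /GRing.scale /=; ring. Qed.

Lemma radial_sqr_le1 p : 0 <= radial p ^+ 2 <= 1.
Proof. by rewrite sqr_ge0/= exprn_ile1 ?radial_ge0 ?radial_le1. Qed.

(** The linear term is the derivative of the kernel in the scale. Only the quadratic order of the
    remainder matters: its coefficient may depend on the map, since [lipschitz_of_quadratic_error]
    makes it disappear. *)
Lemma dilated_kernel_taylor p u v c : 0 <= u -> u <= v -> v <= c ->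
  `|v ^+ 2 * radial (v *: p) ^+ 2 - u ^+ 2 * radial (u *: p) ^+ 2 -
    2 * u * radial_theta (u *: p) * (v - u)| <=
  (4 * c ^+ 4 * dot p p ^+ 2 + 1 + 10 * c ^+ 2 * dot p p) * (v - u) ^+ 2.
Proof.
move=> u0 uv vc; have q0 := dot_ge0 p; rewrite /radial_theta.
have r0 := radial_ge0 (u *: p); have r1 := radial_le1 (u *: p).
have v0 : 0 <= v by exact: le_trans uv.
have := pos_sqr_taylor (1 - dot (u *: p) (u *: p)) (1 - dot (v *: p) (v *: p)).
rewrite -/(radial (u *: p)) -/(radial (v *: p)) !dotZ.
move: (radial (u *: p)) (radial (v *: p)) (dot p p) q0 r0 r1 => a b q q0 a0 a1 h.
have -> : v ^+ 2 * b ^+ 2 - u ^+ 2 * a ^+ 2 - 2 * u * (a ^+ 2 - 2 * (u ^+ 2 * q) * a) * (v - u) =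
  v ^+ 2 * (b ^+ 2 - a ^+ 2 - 2 * a * (1 - v ^+ 2 * q - (1 - u ^+ 2 * q))) +
  (a ^+ 2 - a * q * (2 * (v ^+ 2 + 2 * u * v + 2 * u ^+ 2))) * (v - u) ^+ 2 by ring.
apply: le_trans (ler_normD _ _) _.
rewrite [leRHS](_ : _ = 4 * c ^+ 4 * q ^+ 2 * (v - u) ^+ 2 +
  (1 + 10 * c ^+ 2 * q) * (v - u) ^+ 2); last by ring.
apply: lerD.
  rewrite normrM ger0_norm ?sqr_ge0//.
  apply: le_trans (ler_wpM2l (sqr_ge0 v) h) _.
  have -> : v ^+ 2 * (1 - v ^+ 2 * q - (1 - u ^+ 2 * q)) ^+ 2 =
    (v ^+ 2 * (v + u) ^+ 2 * q ^+ 2) * (v - u) ^+ 2 by ring.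
  apply: ler_wpM2r (sqr_ge0 _) _ _ _; apply: ler_wpM2r (sqr_ge0 _) _ _ _.
  have -> : 4 * c ^+ 4 = c ^+ 2 * (2 * c) ^+ 2 by ring.
  have c0 : 0 <= c by exact: le_trans vc.
  apply: ler_pM; rewrite ?sqr_ge0//; rewrite ler_pXn2r ?nnegrE//; try lra.
rewrite normrM [X in _ * X]ger0_norm ?sqr_ge0//.
apply: ler_wpM2r (sqr_ge0 _) _ _ _.
apply: le_trans (ler_normB _ _) _; apply: lerD.
  by rewrite ger0_norm ?sqr_ge0// exprn_ile1.
have c0 : 0 <= c by exact: le_trans vc.
have uc : u <= c by exact: le_trans vc.
have w0 : 0 <= 2 * (v ^+ 2 + 2 * u * v + 2 * u ^+ 2).
  by rewrite mulr_ge0// !addr_ge0// ?mulr_ge0// sqr_ge0.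
have w1 : 2 * (v ^+ 2 + 2 * u * v + 2 * u ^+ 2) <= 10 * c ^+ 2.
  have : u * v <= c * c by exact: ler_pM.
  have : v * v <= c * c by exact: ler_pM.
  have : u * u <= c * c by exact: ler_pM.
  by rewrite !expr2; lra.
rewrite ger0_norm; last by apply: mulr_ge0 => //; apply: mulr_ge0.
have -> : 10 * c ^+ 2 * q = q * (10 * c ^+ 2) by ring.
apply: ler_pM => //; first exact: mulr_ge0.
by rewrite ler_piMl.
Qed.

End ScaledKernel.

Lemma mesh_gt0 (R : realType) (G : orthodiagonal_map R) eps : edges_at_most G eps -> 0 < eps.
Proof.
move=> le; have [x0 _] := bdry_nonempty G; have [u xu] := incident_edge x0.
apply: lt_le_trans (le _ _ xu); rewrite eucl_nrm nrmB nrm_gt0//.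
exact: edge_vector_neq0.
Qed.

Section KernelAverage.
Variables (R : realType) (G : orthodiagonal_map R) (eps : R).
Hypothesis le : edges_at_most G eps.
Implicit Types (x : primal G) (Q : quad G) (h : primal G -> R) (p : R * R) (u : R).

(** Deliberately not normalised: the total mass is the average of the constant [1], itself harmonic,
    so the same estimates control how it varies. *)
Definition average u p0 h : R :=
  \sum_Q h (qp1 Q) * qweight Q * (u ^+ 2 * radial (u *: (ppos (qp1 Q) - p0)) ^+ 2).

Let eps0 : 0 < eps := mesh_gt0 le.

Let scaleB u p q r : u *: (p - r) - u *: (q - r) = u *: (p - q) :> R * R.
Proof. by rewrite -scalerBr opprB addrA subrK. Qed.

(** Rescaling by [u] gives mesh [eps * u], and [radial_kernel_sum_le] applies. The constant is
    [2 * 600] times the bound [128 * (5 + 3/8)^2 <= 128 * 36] on the weight within radius [5]. *)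
Lemma theta_sum_le u p0 h : 0 < u -> eps * u <= 8^-1 -> discrete_harmonic h ->
  (forall p, nrm (p - p0) < 5 / u -> hat_domain G p) ->
  `|\sum_Q h (qp1 Q) * qweight Q * (2 * u * radial_theta (u *: (ppos (qp1 Q) - p0)))| <=
  1200 * (128 * 36) * eps * supnorm h.
Proof.
move=> u0 eu hh hr.
have nZ p : nrm (u *: p) = u * nrm p by rewrite nrmZ gtr0_norm.
have hat x : nrm (u *: (ppos x - p0)) < 5 -> hat_domain G (ppos x).
  by rewrite nZ => h1; apply: hr; rewrite ltr_pdivlMr// mulrC.
have edge x (v : dual G) : adj x v -> nrm (u *: (dpos v - p0) - u *: (ppos x - p0)) <= eps * u.
  move=> xv; rewrite scaleB nZ mulrC ler_pM2r//; apply: le_trans (le xv).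
  by rewrite eucl_nrm nrmB.
have e0 : 0 <= eps * u <= 8^-1 by rewrite eu mulr_ge0// ltW.
pose X x : R * R := u *: (ppos x - p0).
pose U (v : dual G) : R * R := u *: (dpos v - p0).
pose W := quad_weight X U (@qp1 R G) (@qp2 R G) (@qd1 R G) (@qd2 R G).
have wE Q : W Q = u ^+ 2 * qweight Q.
  by rewrite /W /quad_weight /X /U !scaleB !nZ /qweight /qe /qf; ring.
have adj4 Q := and4P (od_quad_adj Q).
have main : `|\sum_Q h (qp1 Q) * W Q *
    radial_theta (X (qp1 Q))| <= 600 * (eps * u) * supnorm h *
    \sum_(Q | nrm (X (qp1 Q)) <= 5)
      W Q.
  apply: radial_kernel_sum_le => //.
  - by move=> Q; rewrite /X scaleB nZ mulr_gt0// qe_gt0.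
  - by move=> Q; rewrite /U scaleB nZ mulr_gt0// qf_gt0.
  - move=> Q; rewrite /X /U !scaleB.
    have -> : dot (u *: (ppos (qp2 Q) - ppos (qp1 Q))) (u *: (dpos (qd2 Q) - dpos (qd1 Q))) =
      u ^+ 2 * dot (qe Q) (qf Q) by rewrite /dot /= /GRing.scale /= /qe /qf; ring.
    by rewrite qe_qf mulr0.
  - by move=> Q; apply: edge; have [] := adj4 Q.
  - by move=> Q; apply: edge; have [] := adj4 Q.
  - by move=> Q; apply: edge; have [] := adj4 Q.
  - by move=> Q; apply: edge; have [] := adj4 Q.
  - move=> x /hat/hat_not_bdry/hh; rewrite laplacian_quads => lap; rewrite -[RHS]lap.
    apply: eq_bigr => Q _; rewrite /X /U !scaleB !nZ -mulf_div divff ?mul1r//.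
    by rewrite gt_eqF.
  - move=> x /hat/flux_balance fl F; rewrite -[RHS](fl F).
    apply: eq_bigr => Q _; rewrite /incid; congr (_ * _ * _).
    rewrite /X /U !scaleB /orientq /orient.
    have -> : cross (u *: (ppos (qp2 Q) - ppos (qp1 Q))) (u *: (dpos (qd2 Q) - dpos (qd1 Q))) =
      u ^+ 2 * cross (qe Q) (qf Q) by rewrite /cross /= /GRing.scale /= /qe /qf; ring.
    by rewrite sgrM gtr0_sg ?mul1r// exprn_gt0.
  - by move=> x; exact: supnorm_ge.
have -> : \sum_Q h (qp1 Q) * qweight Q * (2 * u * radial_theta (u *: (ppos (qp1 Q) - p0))) =
    2 / u * \sum_Q h (qp1 Q) * W Q *
    radial_theta (X (qp1 Q)).
  rewrite mulr_sumr; apply: eq_bigr => Q _; rewrite wE /X; field; exact: lt0r_neq0.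
have wsum : \sum_(Q | nrm (X (qp1 Q)) <= 5)
    W Q <= 128 * 36.
  under eq_bigr do rewrite wE.
  rewrite -mulr_sumr.
  rewrite (eq_bigl (fun Q => nrm (ppos (qp1 Q) - p0) <= 5 / u)); last first.
    by move=> Q; rewrite /X nZ ler_pdivlMr// mulrC.
  have r0 : 0 <= 5 / u by rewrite divr_ge0// ltW.
  have := sum_qweight_le p0 le (ltW eps0) r0 => h1.
  apply: le_trans (ler_wpM2l (sqr_ge0 u) h1) _.
  have -> : u ^+ 2 * (128 * (5 / u + 3 * eps) ^+ 2) = 128 * (5 + 3 * (eps * u)) ^+ 2.
    by field; exact: lt0r_neq0.
  rewrite ler_pM2l//.
  have -> : 36 = 6 ^+ 2 :> R by ring.
  by move/andP: e0 => [? ?]; rewrite ler_pXn2r ?nnegrE//; lra.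
rewrite normrM gtr0_norm ?divr_gt0//.
apply: le_trans (ler_wpM2l _ main) _; first by rewrite divr_ge0// ltW.
apply: (@le_trans _ _ (2 / u * (600 * (eps * u) * supnorm h * (128 * 36)))).
  apply: ler_wpM2l; first by rewrite divr_ge0// ltW.
  apply: ler_wpM2l; last exact: wsum.
  apply: mulr_ge0 (supnorm_ge0 h).
  by apply: mulr_ge0; [exact: ler0n|apply: mulr_ge0; exact: ltW].
rewrite le_eqVlt; apply/orP; left; apply/eqP; field; exact: lt0r_neq0.
Qed.

Lemma average_dilation p0 h a b : 0 < a -> a <= b -> eps * b <= 8^-1 -> discrete_harmonic h ->
  (forall p, nrm (p - p0) < 5 / a -> hat_domain G p) ->
  `|average b p0 h - average a p0 h| <= 1200 * (128 * 36) * eps * supnorm h * (b - a).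
Proof.
move=> a0 ab eb hh hr.
pose rem Q : R := `|h (qp1 Q) * qweight Q| *
  (4 * b ^+ 4 * dot (ppos (qp1 Q) - p0) (ppos (qp1 Q) - p0) ^+ 2 + 1 +
   10 * b ^+ 2 * dot (ppos (qp1 Q) - p0) (ppos (qp1 Q) - p0)).
apply: (@lipschitz_of_quadratic_error R (fun u => average u p0 h) a b _ (\sum_Q rem Q)) => //.
move=> u v au uv vb.
have u0 : 0 < u by exact: lt_le_trans au.
have ub : u <= b by exact: le_trans vb.
have eu : eps * u <= 8^-1 by apply: le_trans eb; rewrite ler_pM2l.
have hr' p : nrm (p - p0) < 5 / u -> hat_domain G p.
  move=> h1; apply: hr; apply: lt_le_trans h1 _.
  by rewrite ler_pM2l// lef_pV2 ?posrE.
have vu0 : 0 <= v - u by rewrite subr_ge0.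
have := theta_sum_le u0 eu hh hr'; set S := \sum_Q _ => hS.
have -> : average v p0 h - average u p0 h = S * (v - u) +
    \sum_Q h (qp1 Q) * qweight Q * (v ^+ 2 * radial (v *: (ppos (qp1 Q) - p0)) ^+ 2 -
      u ^+ 2 * radial (u *: (ppos (qp1 Q) - p0)) ^+ 2 -
      2 * u * radial_theta (u *: (ppos (qp1 Q) - p0)) * (v - u)).
  rewrite /average /S mulr_suml -sumrB -big_split /=.
  by apply: eq_bigr => Q _; ring.
apply: le_trans (ler_normD _ _) _; apply: lerD.
  by rewrite normrM (ger0_norm vu0); exact: ler_wpM2r.
rewrite mulr_suml; apply: le_trans (ler_norm_sum _ _ _) _; apply: ler_sum => Q _.
rewrite normrM /rem -[leRHS]mulrA; apply: ler_wpM2l => //.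
by apply: dilated_kernel_taylor => //; exact: ltW.
Qed.

End KernelAverage.

(** * Translation, oscillation and total mass at a fixed scale *)

Section AverageBounds.
Variables (R : realType) (G : orthodiagonal_map R) (eps u : R).
Hypotheses (le : edges_at_most G eps) (u0 : 0 < u) (eu : eps * u <= 8^-1).
Implicit Types (x : primal G) (Q : quad G) (h : primal G -> R) (p q : R * R).

Let eps0 : 0 < eps := mesh_gt0 le.
Let nZ p : nrm (u *: p) = u * nrm p. Proof. by rewrite nrmZ gtr0_norm. Qed.

Lemma sum_scaled_qweight_le p (k : R) : 0 <= k ->
  \sum_(Q : quad G | nrm (ppos (qp1 Q) - p) <= k / u) u ^+ 2 * qweight Q <= 128 * (k + 1) ^+ 2.
Proof.
move=> k0; rewrite -mulr_sumr.
have r0 : 0 <= k / u by rewrite divr_ge0// ltW.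
have h1 := sum_qweight_le p le (ltW eps0) r0.
apply: le_trans (ler_wpM2l (sqr_ge0 u) h1) _.
have -> : u ^+ 2 * (128 * (k / u + 3 * eps) ^+ 2) = 128 * (k + 3 * (eps * u)) ^+ 2.
  by field; exact: lt0r_neq0.
have e0 : 0 <= eps * u by rewrite mulr_ge0// ltW.
rewrite ler_pM2l//; move: (eps * u) e0 eu => t e0 et.
by rewrite ler_pXn2r ?nnegrE//; lra.
Qed.

Lemma average_translation p q h : u * nrm (p - q) <= 1 ->
  `|average u q h - average u p h| <= 14 * (128 * 9) * supnorm h * (u * nrm (p - q)).
Proof.
move=> pq; rewrite /average -sumrB.
have l0 : 0 <= u * nrm (p - q) by rewrite mulr_ge0 ?nrm_ge0// ltW.
have H0 := supnorm_ge0 h.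
apply: (@le_trans _ _ (\sum_(Q : quad G | nrm (ppos (qp1 Q) - p) <= 2 / u)
    14 * supnorm h * (u * nrm (p - q)) * (u ^+ 2 * qweight Q))).
  have qE Q : u *: (ppos (qp1 Q) - q) = u *: (ppos (qp1 Q) - p) + u *: (p - q).
    by rewrite -scalerDr addrA subrK.
  apply: ler_norm_sum_pred => Q; rewrite qE; set P : R * R := u *: (ppos (qp1 Q) - p).
    move=> hQ; rewrite -mulrBr -mulrBr normrM.
    have w0 : 0 <= u ^+ 2 * qweight Q.
      by apply: mulr_ge0; [exact: sqr_ge0|exact: ltW (qweight_gt0 Q)].
    have -> : 14 * supnorm h * (u * nrm (p - q)) * (u ^+ 2 * qweight Q) =
      supnorm h * qweight Q * (u ^+ 2 * (14 * (u * nrm (p - q)))) by ring.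
    apply: ler_pM; rewrite ?normr_ge0//.
      rewrite normrM (gtr0_norm (qweight_gt0 Q)) ler_pM2r ?qweight_gt0//.
      exact: supnorm_ge.
    rewrite normrM (ger0_norm (sqr_ge0 u)); apply: ler_wpM2l; first exact: sqr_ge0.
    rewrite -nZ; apply: radial_sqr_lip; rewrite ?nZ//.
    by move: hQ; rewrite ler_pdivlMr// mulrC; lra.
  rewrite -ltNge ltr_pdivrMr// [X in _ < X]mulrC => hQ.
  have P1 : 2 < nrm P by rewrite nZ.
  have P2 : 1 <= nrm (P + u *: (p - q)).
    have := ler_nrmD (P + u *: (p - q)) (- (u *: (p - q))).
    by rewrite addrK nrmN (nZ (p - q)); lra.
  by rewrite (radial_eq0 P2) (@radial_eq0 _ P) ?expr0n/= ?mulr0 ?subrr//; lra.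
rewrite -mulr_sumr.
have k2 : (0 : R) <= 2 by [].
have := sum_scaled_qweight_le p k2 => h1.
apply: le_trans (ler_wpM2l _ h1) _; first by apply: mulr_ge0 => //; exact: mulr_ge0.
by rewrite le_eqVlt; apply/orP; left; apply/eqP; ring.
Qed.

Lemma average_oscillation p h (c E : R) : 0 <= E ->
  (forall x, nrm (ppos x - p) <= u^-1 -> `|h x - c| <= E) ->
  `|average u p h - c * average u p (fun _ : primal G => 1)| <= 512 * E.
Proof.
move=> E0 hE; rewrite /average mulr_sumr -sumrB.
apply: (@le_trans _ _ (\sum_(Q : quad G | nrm (ppos (qp1 Q) - p) <= 1 / u)
    E * (u ^+ 2 * qweight Q))).
  apply: ler_norm_sum_pred => Q; set P : R * R := u *: (ppos (qp1 Q) - p); last first.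
    rewrite -ltNge ltr_pdivrMr// [X in _ < X]mulrC => hQ.
    by rewrite (@radial_eq0 _ P) ?expr0n/= ?mulr0 ?subrr// nZ ltW.
  rewrite div1r => /hE hQ.
    have -> : h (qp1 Q) * qweight Q * (u ^+ 2 * radial P ^+ 2) -
        c * (1 * qweight Q * (u ^+ 2 * radial P ^+ 2)) =
      (h (qp1 Q) - c) * (u ^+ 2 * qweight Q * radial P ^+ 2) by ring.
    have w0 : 0 <= u ^+ 2 * qweight Q.
      by apply: mulr_ge0; [exact: sqr_ge0|exact: ltW (qweight_gt0 Q)].
    have /andP[r0 r1] := radial_sqr_le1 P.
    rewrite normrM; apply: ler_pM => //.
    by rewrite normrM (ger0_norm w0) (ger0_norm r0) ler_piMr.
rewrite -mulr_sumr.
have k1 : (0 : R) <= 1 by [].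
have h1 := sum_scaled_qweight_le p k1.
apply: le_trans (ler_wpM2l E0 h1) _.
by rewrite le_eqVlt; apply/orP; left; apply/eqP; ring.
Qed.

(** Within radius [1 / (2 u)] the kernel is at least [(9/16) u^2], and by [sum_qweight_ge] the
    weight there is at least [1 / (16 u^2)]; finally [32 * (9/256) >= 1]. *)
Lemma average_one_ge p : 12 * (eps * u) <= 1 ->
  (forall q, nrm (q - p) < u^-1 -> hat_domain G q) ->
  1 <= 32 * average u p (fun _ : primal G => 1).
Proof.
move=> e12 hat.
have r0 : 0 < (2 * u)^-1 by rewrite invr_gt0 mulr_gt0.
have ui : 0 < u^-1 by rewrite invr_gt0.
have rE : (2 * u)^-1 = u^-1 / 2 by field; exact: lt0r_neq0.
have er : 6 * eps <= (2 * u)^-1.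
  rewrite rE ler_pdivlMr// -(ler_pM2r u0) mulVf ?gt_eqF//; lra.
have hat' q : nrm (q - p) < (2 * u)^-1 -> hat_domain G q.
  by move=> h1; apply: hat; rewrite rE in h1; lra.
have := sum_qweight_ge le r0 er hat'; set N := \sum_(Q | _) _ => hN.
have : u ^+ 2 * (9 / 16) * N <= average u p (fun _ : primal G => 1).
  rewrite /N mulr_sumr /average big_mkcond; apply: ler_sum => Q _.
  set P : R * R := u *: _.
  have w0 := qweight_gt0 Q; have /andP[s0 _] := radial_sqr_le1 P.
  have u2 := sqr_ge0 u.
  case: ifP => hQ; last by apply: mulr_ge0; [rewrite mul1r ltW|exact: mulr_ge0].
  have h34 : 3 / 4 <= radial P.
    have : nrm P <= 2^-1.
      by rewrite nZ; move: hQ; rewrite invfM ler_pdivlMr// mulrC.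
    have := nrm_ge0 P; have := nrm_sqr P; rewrite /radial.
    move: (nrm P) (dot P P) => n d nd n0 n2.
    have : n ^+ 2 <= (2^-1) ^+ 2 by rewrite ler_pXn2r ?nnegrE.
    rewrite nd; case: posP; lra.
  have -> : u ^+ 2 * (9 / 16) * qweight Q = u ^+ 2 * qweight Q * (3 / 4) ^+ 2 by field.
  have -> : 1 * qweight Q * (u ^+ 2 * radial P ^+ 2) = u ^+ 2 * qweight Q * radial P ^+ 2 by ring.
  apply: ler_wpM2l; first by apply: mulr_ge0 => //; exact: ltW.
  by rewrite ler_pXn2r ?nnegrE//; lra.
have : u ^+ 2 * (2 * u)^-1 ^+ 2 <= u ^+ 2 * (4 * N) by apply: ler_wpM2l => //; exact: sqr_ge0.
have -> : u ^+ 2 * (2 * u)^-1 ^+ 2 = 4^-1 by field; exact: lt0r_neq0.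
lra.
Qed.

End AverageBounds.

Lemma const_harmonic (R : realType) (G : orthodiagonal_map R) (c : R) :
  discrete_harmonic (fun _ : primal G => c).
Proof. by move=> x _; rewrite /laplacian big1// => y _; rewrite subrr mulr0. Qed.

Lemma supnorm_one (R : realType) (G : orthodiagonal_map R) :
  supnorm (fun _ : primal G => 1 : R) <= 1.
Proof. by apply: bigmax_le => // x _; rewrite normr1. Qed.

(** * Comparing the values at two vertices through averages at two scales *)

Section Increment.
Variable R : realType.

(** The path from [h z] to [h w] goes through the averages at the small scale [1 / b], the large
    scale [1 / a], then back at the other centre. Since averages are not normalised, the masses at
    the two centres must also be compared. *)
Lemma increment_bound : exists2 c : R, 0 < c &
  forall (G : orthodiagonal_map R) (eps : R) (h : primal G -> R) (z w : primal G) (a b E : R),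
  edges_at_most G eps -> discrete_harmonic h -> 0 < a -> a <= b -> 12 * (eps * b) <= 1 ->
  (forall q, nrm (q - ppos z) < 5 / a -> hat_domain G q) ->
  (forall q, nrm (q - ppos w) < 5 / a -> hat_domain G q) ->
  a * nrm (ppos z - ppos w) <= 1 -> 0 <= E ->
  (forall x, nrm (ppos x - ppos z) <= b^-1 -> `|h x - h z| <= E) ->
  (forall x, nrm (ppos x - ppos w) <= b^-1 -> `|h x - h w| <= E) ->
  `|h z - h w| <= c * (E + supnorm h * (eps * b + a * nrm (ppos z - ppos w))).
Proof.
(* The numerical constants are sealed as [c1] and [c2]; the arithmetic below needs only their
   sign. *)
have [c1 c10 dilation] : exists2 c1 : R, 0 <= c1 &
    forall (G : orthodiagonal_map R) (eps : R) p (g : primal G -> R) (a b : R),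
    edges_at_most G eps -> 0 < a -> a <= b -> eps * b <= 8^-1 -> discrete_harmonic g ->
    (forall q, nrm (q - p) < 5 / a -> hat_domain G q) ->
    `|average b p g - average a p g| <= c1 * eps * supnorm g * (b - a).
  exists (1200 * (128 * 36)); first by apply: mulr_ge0; [exact: ler0n|apply: mulr_ge0; exact: ler0n].
  by move=> G eps p g a b le; exact: average_dilation.
have [c2 c20 translation] : exists2 c2 : R, 0 <= c2 &
    forall (G : orthodiagonal_map R) (eps u : R) p q (g : primal G -> R),
    edges_at_most G eps -> 0 < u -> eps * u <= 8^-1 -> u * nrm (p - q) <= 1 ->
    `|average u q g - average u p g| <= c2 * supnorm g * (u * nrm (p - q)).
  exists (14 * (128 * 9)); first by apply: mulr_ge0; [exact: ler0n|apply: mulr_ge0; exact: ler0n].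
  by move=> G eps u p q g le u0 eu pq; exact: (average_translation le u0 eu).
exists (32 * (1024 + 4 * c1 + 2 * c2)).
  lra.
move=> G eps h z w a b E le hh a0 ab eb hatz hatw azw E0 hEz hEw.
have b0 : 0 < b by exact: lt_le_trans ab.
have eps0 : 0 < eps := mesh_gt0 le.
have eb8 : eps * b <= 8^-1 by move: (eps * b) eb => t; lra.
have ea8 : eps * a <= 8^-1 by apply: le_trans eb8; rewrite ler_pM2l.
have H0 := supnorm_ge0 h.
have dil (g : primal G -> R) p : discrete_harmonic g ->
    (forall q, nrm (q - p) < 5 / a -> hat_domain G q) ->
    `|average b p g - average a p g| <= c1 * supnorm g * (eps * b).
  move=> hg hp; apply: le_trans (dilation _ _ _ _ _ _ le a0 ab eb8 hg hp) _.
  rewrite [leLHS](_ : _ = c1 * supnorm g * eps * (b - a)); last by ring.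
  rewrite mulrA; apply: ler_wpM2l; last by lra.
  by rewrite !mulr_ge0// ?supnorm_ge0// ltW.
have tra (g : primal G -> R) :
    `|average a (ppos w) g - average a (ppos z) g| <=
    c2 * supnorm g * (a * nrm (ppos z - ppos w)).
  exact: (translation _ _ _ _ _ _ le a0 ea8).
set t := a * nrm _ in azw tra *.
have t0 : 0 <= t by rewrite mulr_ge0 ?nrm_ge0// ltW.
have s0 : 0 <= eps * b by rewrite mulr_ge0// ltW.
set s := eps * b in eb eb8 dil s0 *.
have one := @const_harmonic R G 1.
have N1 := @supnorm_one R G.
have dil1 p (hp : forall q, nrm (q - p) < 5 / a -> hat_domain G q) :
    `|average b p (fun _ : primal G => 1) - average a p (fun _ : primal G => 1)| <= c1 * s.
  apply: le_trans (dil _ _ one hp) _; apply: ler_wpM2r => //.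
  by rewrite ler_piMr.
have tra1 : `|average a (ppos w) (fun _ : primal G => 1) -
    average a (ppos z) (fun _ : primal G => 1)| <= c2 * t.
  by apply: le_trans (tra _) _; apply: ler_wpM2r => //; rewrite ler_piMr.
have oz := average_oscillation le b0 eb8 E0 hEz.
have ow := average_oscillation le b0 eb8 E0 hEw.
have low : 1 <= 32 * average b (ppos z) (fun _ : primal G => 1).
  apply: (average_one_ge le b0 eb) => q hq; apply: hatz; apply: lt_le_trans hq _.
  have : b^-1 <= a^-1 by rewrite lef_pV2 ?posrE.
  have : 0 < a^-1 by rewrite invr_gt0.
  lra.
have dz := dil h _ hh hatz; have dw := dil h _ hh hatw; have th := tra h.
have d1z := dil1 _ hatz; have d1w := dil1 _ hatw.
have hw := supnorm_ge h w.
move: (average b (ppos z) (fun=> 1)) (average b (ppos w) (fun=> 1))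
  (average a (ppos z) (fun=> 1)) (average a (ppos w) (fun=> 1))
  (average b (ppos z) h) (average b (ppos w) h)
  (average a (ppos z) h) (average a (ppos w) h) (supnorm h) (h z) (h w)
  dz dw th d1z d1w tra1 oz ow low hw H0.
move=> m m' ma ma' A A' Aa Aa' H hz hw dz dw th d1z d1w tra1 oz ow low hwH H0.
have mm : `|m' - m| <= 2 * c1 * s + c2 * t.
  move: d1z d1w tra1; rewrite !ler_norml => /andP[? ?] /andP[? ?] /andP[? ?].
  by split_lra.
have hm : `|hw * (m' - m)| <= H * (2 * c1 * s + c2 * t).
  by rewrite normrM; exact: ler_pM.
(* [(hz - hw) m] is the sum of [hz m - A], [A - Aa], [Aa - Aa'], [Aa' - A'], [A' - hw m'] and
   [hw (m' - m)]. *)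
have main : `|(hz - hw) * m| <= 1024 * E + H * (4 * c1 * s + 2 * c2 * t).
  move: hm oz ow dz dw th; rewrite !ler_norml.
  move=> /andP[? ?] /andP[? ?] /andP[? ?] /andP[? ?] /andP[? ?] /andP[? ?].
  by split_lra.
have mge : `|hz - hw| <= 32 * `|(hz - hw) * m|.
  have m0 : 0 <= m by lra.
  rewrite normrM (ger0_norm m0) mulrCA.
  by rewrite ler_peMr.
apply: le_trans mge _; rewrite -mulrA ler_pM2l//; apply: le_trans main _.
have Hs : 0 <= H * s by exact: mulr_ge0.
have Ht : 0 <= H * t by exact: mulr_ge0.
have k1 : 0 <= c1 * E by exact: mulr_ge0.
have k2 : 0 <= c2 * E by exact: mulr_ge0.
have k3 : 0 <= c1 * (H * t) by exact: mulr_ge0.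
have k4 : 0 <= c2 * (H * s) by exact: mulr_ge0.
lra.
Qed.

End Increment.

Section NearInterior.
Variables (R : realType) (G : orthodiagonal_map R).
Implicit Types (x z : primal G) (r : R).

Lemma dist_bdry_ge x r : (forall q, nrm (q - ppos x) < r -> hat_domain G q) ->
  r <= dist_bdry x.
Proof.
move=> hr; rewrite /dist_bdry /dist_to; have [y hy] := bdry_nonempty G.
apply: lb_le_inf; first by exists (eucl (ppos x) (ppos y)); exists (ppos y) => //; exists y.
move=> _ [_ [y' hy' <-] <-]; rewrite leNgt; apply/negP; rewrite eucl_nrm nrmB => h.
by have := hat_not_bdry (hr _ h).
Qed.

Lemma oscillation_near C' K beta (hb : hoelder_estimate C' K beta) eps h z d r x :
  0 <= C' -> 0 <= beta <= 1 -> edges_at_most G eps -> discrete_harmonic h ->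
  0 < d -> (forall q, nrm (q - ppos z) < d -> hat_domain G q) ->
  2 * r <= d -> nrm (ppos x - ppos z) <= r ->
  `|h x - h z| <= C' * supnorm h * (2 * (Num.max r (K * eps) / d)) `^ beta.
Proof.
move=> C0 /andP[b0 b1] le hh d0 hat rd xr.
have dz : d <= dist_bdry z by exact: dist_bdry_ge.
have dx : d / 2 <= dist_bdry x.
  apply: dist_bdry_ge => q hq; apply: hat.
  have := ler_nrmD (q - ppos x) (ppos x - ppos z); rewrite addrA subrK; lra.
have m2 : d / 2 <= Num.min (dist_bdry z) (dist_bdry x).
  by rewrite le_min dx andbT; lra.
have m0 : 0 < Num.min (dist_bdry z) (dist_bdry x) by lra.
apply: le_trans (hb _ _ le _ hh _ _ m0) _.
apply: ler_wpM2l; first by apply: mulr_ge0 => //; exact: supnorm_ge0.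
have M0 : 0 <= Num.max (eucl (ppos x) (ppos z)) (K * eps).
  by rewrite le_max eucl_nrm nrm_ge0.
have MM : Num.max (eucl (ppos x) (ppos z)) (K * eps) <= Num.max r (K * eps).
  by rewrite ge_max !le_max lexx orbT andbT eucl_nrm xr.
apply: ge0_ler_powR => //.
- by rewrite nnegrE divr_ge0// ltW.
- by rewrite nnegrE mulr_ge0// divr_ge0//; [exact: le_trans MM|exact: ltW].
have -> : 2 * (Num.max r (K * eps) / d) = Num.max r (K * eps) / (d / 2).
  by field; exact: lt0r_neq0.
apply: ler_pM => //; first by rewrite invr_ge0 ltW.
by rewrite lef_pV2 ?posrE// divr_gt0.
Qed.

End NearInterior.

(** * Choice of the two scales *)

Theorem theorem7p1 (R : realType) (C C' K beta : R)
    (hbeta : beurling_constants C C' K beta)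
    (alpha : R) (halpha : 0 < alpha < beta / (1 + 3 * beta)) :
  exists2 Calpha : R, 0 < Calpha &
    forall (G : orthodiagonal_map R) (eps : R) (h : primal G -> R)
      (z w : primal G) (d : R),
      edges_at_most G eps ->
      discrete_harmonic h ->
      d = Num.min (dist_hat z) (dist_hat w) ->
      0 < d ->
      d * (eps / d) `^ alpha <= eucl (ppos z) (ppos w) ->
      `|h z - h w| <= Calpha * supnorm h * (eucl (ppos z) (ppos w) / d).
Proof.
case: hbeta => _ C'0 K0 /andP[b0 b2] [_ hb]; case/andP: halpha => a0 ab.
have b3 : 0 < 1 + 3 * beta by lra.
have {}ab : alpha * (1 + 3 * beta) < beta by rewrite -ltr_pdivlMr.
have ab0 : 0 < alpha * beta by exact: mulr_gt0.
(* This makes the Hoelder error at the small scale at most [(eps / d)^alpha]. *)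
have exponent : alpha <= (1 - alpha) * beta by lra.
have alpha2 : alpha <= 1 - alpha by move: ab ab0; rewrite mulrDr mulr1; lra.
have [c c0 hc] := increment_bound R.
pose k := Num.max 1 K; have k1 : 1 <= k by rewrite le_max lexx.
have Kk : K <= k by rewrite le_max lexx orbT.
have k0 : 0 <= C' * (2 * k) by rewrite !mulr_ge0//; lra.
have c1 : 0 <= c * (C' * (2 * k) + 6) by rewrite mulr_ge0//; lra.
exists (24 + c * (C' * (2 * k) + 6)); first by lra.
move=> G eps h z w d le hh dE d0; rewrite eucl_nrm.
set n := nrm (ppos z - ppos w) => hn.
have n0 : 0 <= n by exact: nrm_ge0.
have H0 := supnorm_ge0 h.
have eps0 : 0 < eps := mesh_gt0 le.
have hat p : p = z \/ p = w -> forall q, nrm (q - ppos p) < d -> hat_domain G q.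
  move=> pzw q hq.
  have dp : d <= dist_hat p by rewrite dE ge_min; case: pzw => ->; rewrite lexx ?orbT.
  apply: (dist_hat_sub (vertex_in_hat (lt_le_trans d0 dp))).
  exact: lt_le_trans dp.
have hatz := hat z (or_introl erefl); have hatw := hat w (or_intror erefl).
have nd : 0 <= n / d by rewrite divr_ge0// ltW.
have hzw : `|h z - h w| <= 2 * supnorm h.
  have := supnorm_ge h z; have := supnorm_ge h w; have := ler_normB (h z) (h w); lra.
have Hnd : 0 <= supnorm h * (n / d) by exact: mulr_ge0.
(* For distant vertices the trivial bound [2 * supnorm h] suffices, whence the [24]. For near ones,
   [n / d < 1/12] yields both smallness conditions of [increment_bound]. *)
have [far|near] := lerP 12^-1 (n / d).
  have : supnorm h * 12^-1 <= supnorm h * (n / d) by exact: ler_wpM2l.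
  have : 0 <= c * (C' * (2 * k) + 6) * (supnorm h * (n / d)) by exact: mulr_ge0.
  lra.
set x := eps / d in hn; have x0 : 0 < x by exact: divr_gt0.
set s := x `^ alpha in hn; have s0 : 0 < s by exact: powR_gt0.
have sn : s <= n / d by rewrite ler_pdivlMr// mulrC.
have x1 : x <= 1.
  rewrite leNgt; apply/negP => x1; have : x `^ 0 <= s by apply: ler_powR; exact: ltW.
  by rewrite powRr0; lra.
have x01 : 0 < x <= 1 by rewrite x0.
(* The small scale is [d * y]. As [x = s * y], the dilation error [eps / (d * y)] is exactly [s],
   which is at most [n / d]. *)
set y := x `^ (1 - alpha); have y0 : 0 < y by exact: powR_gt0.
have ys : y <= s by exact: ger_powR.
have xy : x <= y.
  by rewrite /y -[leLHS](powRr1 (ltW x0)); apply: ger_powR => //; lra.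
have xE : x = s * y.
  rewrite /s /y -powRD; last by rewrite (gt_eqF x0) implybT.
  by rewrite (_ : alpha + (1 - alpha) = 1) ?(powRr1 (ltW x0))//; ring.
have epsE : eps = d * (s * y) by rewrite -xE /x mulrC divfK// gt_eqF.
have dy0 : 0 < d * y by exact: mulr_gt0.
have bV : ((d * y)^-1)^-1 = d * y by rewrite invrK.
have osc p (hatp : forall q, nrm (q - ppos p) < d -> hat_domain G q) x' :
    nrm (ppos x' - ppos p) <= ((d * y)^-1)^-1 ->
    `|h x' - h p| <= C' * supnorm h * (2 * k * s).
  rewrite bV => hx'.
  have b01 : 0 <= beta <= 1 by split_lra.
  have rd : 2 * (d * y) <= d by rewrite mulrCA ger_pMr//; lra.
  apply: le_trans (oscillation_near hb (ltW C'0) b01 le hh d0 hatp rd hx') _.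
  apply: ler_wpM2l; first by rewrite mulr_ge0// ltW.
  have mx : Num.max (d * y) (K * eps) / d <= k * y.
    rewrite ler_pdivrMr// ge_max; apply/andP; split.
      by rewrite mulrAC mulrC [leRHS]mulrC ler_pM2l// ler_peMl// ltW.
    have -> : k * y * d = k * (d * y) by ring.
    apply: ler_pM => //; [exact: ltW|exact: ltW|].
    have -> : eps = d * x by rewrite xE.
    by rewrite ler_pM2l.
  have kk : 1 <= 2 * k by lra.
  have mx0 : 0 <= Num.max (d * y) (K * eps) / d.
    by rewrite divr_ge0 ?(ltW d0)// le_max (ltW dy0).
  (* [(2 k y)^beta <= 2 k y^beta] because [2 k >= 1] and [beta <= 1], and [y^beta <= s] by
     [exponent]. *)
  apply: (@le_trans _ _ ((2 * k * y) `^ beta)).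
    apply: ge0_ler_powR; rewrite ?nnegrE; [exact: ltW|exact: mulr_ge0| |].
      by rewrite mulr_ge0 ?ltW//; lra.
    by rewrite -mulrA ler_pM2l.
  rewrite powRM; [|lra|exact: ltW].
  apply: ler_pM; rewrite ?powR_ge0//.
    rewrite -[leRHS]powRr1; last lra.
    by apply: ler_powR => //; lra.
  by rewrite /y -powRrM; exact: ger_powR.
have E0 : 0 <= C' * supnorm h * (2 * k * s).
  by rewrite !mulr_ge0// ?ltW//; lra.
have epsb : eps * (d * y)^-1 = s.
  by rewrite epsE; field; rewrite !gt_eqF.
have an : 5 / d * n = 5 * (n / d) by ring.
have ab' : 5 / d <= (d * y)^-1.
  rewrite invfM mulrC ler_pM2l ?invr_gt0// -[5]invrK lef_pV2 ?posrE ?invr_gt0//.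
  lra.
have five : 5 / (5 / d) = d by field; rewrite gt_eqF.
(* With [a = 5 / d] the disc of radius [5 / a] required around each vertex has radius exactly
   [d]. *)
have := hc G eps h z w (5 / d) (d * y)^-1 _ le hh (divr_gt0 (ltr0n _ 5) d0) ab' _ _ _ _ E0
  (osc z hatz) (osc w hatw).
rewrite five epsb an => /(_ _ hatz hatw) fin.
apply: (le_trans (fin _ _)); [lra|lra|].
have -> : (24 + c * (C' * (2 * k) + 6)) * supnorm h * (n / d) =
  24 * (supnorm h * (n / d)) + c * (C' * (2 * k) * supnorm h * (n / d) +
    supnorm h * (n / d + 5 * (n / d))) by ring.
have : c * (C' * supnorm h * (2 * k * s) + supnorm h * (s + 5 * (n / d))) <=
  c * (C' * (2 * k) * supnorm h * (n / d) + supnorm h * (n / d + 5 * (n / d))).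
  rewrite ler_pM2l//; apply: lerD.
    have -> : C' * supnorm h * (2 * k * s) = C' * (2 * k) * supnorm h * s by ring.
    by apply: ler_wpM2l sn; exact: mulr_ge0.
  by apply: ler_wpM2l => //; rewrite lerD2r.
lra.
Qed.
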